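(* Let $A$ be an integral domain with field of fractions $K$, integrally closed in $K$, and let $H=\bigoplus_{i\in\mathbb{Z}}H_i$ be a $\mathbb{Z}$-graded associative $A$-algebra, finitely generated and free as an $A$-module. Let $\theta:A\to L$ and $\theta':A\to L'$ be ring homomorphisms into fields such that $L$ is the field of fractions of $\theta(A)$ and $L'$ is the field of fractions of $\theta'(A)$. Assume $\operatorname{Ker}(\theta)\subseteq\operatorname{Ker}(\theta')$, and let $\phi:\theta(A)\to L'$ be the ring homomorphism with $\phi(\theta(a))=\theta'(a)$ for all $a\in A$. Assume that $\phi$ extends to a ring homomorphism (still denoted $\phi$) $B\to L'$, where $B$ is a ring with $\theta(A)\subseteq B\subseteq L$ that is integrally closed in $L$. Assume that the algebras $LH$ and $L'H$ are split. Let $$d^{\mathrm{gr}}_{\theta}:\mathcal{R}_0^+(KH)\to\mathcal{R}_0^+(LH),\quad d^{\mathrm{gr}}_{\theta'}:\mathcal{R}_0^+(KH)\to\mathcal{R}_0^+(L'H),\quad d^{\mathrm{gr}}_{\theta,\theta'}:\mathcal{R}_0^+(LH)\to\mathcal{R}_0^+(L'H)$$ be the graded decomposition maps associated with the specializations $\theta:A\to L$, $\theta':A\to L'$ and $\phi:B\to L'$ respectively. Then $$d^{\mathrm{gr}}_{\theta'}=d^{\mathrm{gr}}_{\theta,\theta'}\circ d^{\mathrm{gr}}_{\theta}.$$ In particular, if $D^{\mathrm{gr}}_{\theta}(q)$, $D^{\mathrm{gr}}_{\theta'}(q)$ and $D^{\mathrm{gr}}_{\theta,\theta'}(q)$ are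 the associated graded decomposition matrices (rows indexed by the simple modules of the source algebra, columns by those of the target algebra), then $$D^{\mathrm{gr}}_{\theta'}(q)=D^{\mathrm{gr}}_{\theta}(q)\,D^{\mathrm{gr}}_{\theta,\theta'}(q).$$
   Context: Algebras and modules are unital. A $\mathbb{Z}$-grading on an algebra $H$ over a commutative ring $R$ is a decomposition $H=\bigoplus_{i\in\mathbb{Z}}H_i$ into $R$-submodules with $H_iH_j\subseteq H_{i+j}$. A graded $H$-module is an $H$-module $M=\bigoplus_i M_i$ ($R$-submodules) with $H_iM_j\subseteq M_{i+j}$; $\underline{M}$ denotes $M$ with its grading forgotten. The shift $M\langle j\rangle$ is given by $M\langle j\rangle_i=M_{i-j}$. Morphisms of graded modules are module morphisms $f$ with $f(M_i)\subseteq N_i$ for all $i$. For an $A$-algebra $F$, $FH:=F\otimes_A H$ with grading $FH=\bigoplus_i FH_i$; a field $L$ is an $A$-algebra via $\theta$. Modules over algebras over a field are finite-dimensional. For a graded finite-dimensional algebra $\mathcal{H}$ over a field, $\underline{\mathrm{Irr}}(\mathcal{H})$ is the set of (isomorphism classes of) simple ungraded $\mathcal{H}$-modules. Each $\underline{M}\in\underline{\mathrm{Irr}}(\mathcal{H})$ admits a grading, unique up to shift; one such grading $M$ is fixed once and for all for each $\underline{M}$, and the simple graded modules are, up to isomorphism, the pairwise non-isomorphic $M\langle j\rangle$, $j\in\mathbb{Z}$. $\mathcal{R}_0(\mathcal{H})$ is the Grothendieck group of finite-dimensional graded $\mathcal{H}$-modules, and $\mathcal{R}_0^+(\mathcal{H})$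 is the subset of classes $[V]$ of graded modules $V$. With $q$ an indeterminate, $\mathbb{Z}[q,q^{-1}]$ acts on $\mathcal{R}_0(\mathcal{H})$ by $q^j[V]=[V\langle j\rangle]$. $[V:M\langle n\rangle]^{\mathrm{gr}}$ is the multiplicity of $M\langle n\rangle$ in a graded composition series of $V$. An algebra over a field $F$ is split if every simple module has endomorphism ring $F$. A valuation ring $\mathcal{O}\subseteq K$ is a subring such that for all $0\ne x\in K$, $x\in\mathcal{O}$ or $x^{-1}\in\mathcal{O}$. A graded $\mathcal{O}H$-lattice is a graded $\mathcal{O}H$-module that is finitely generated and free over $\mathcal{O}$. Graded decomposition map: given $A$ (integrally closed in its field of fractions $K$), $H$, and $\theta:A\to L$ with $L$ the field of fractions of $\theta(A)$ and $LH$ split, choose a valuation ring $\mathcal{O}$ with $A\subseteq\mathcal{O}\subseteq K$ whose maximal ideal $J(\mathcal{O})$ satisfies $J(\mathcal{O})\cap A=\operatorname{Ker}(\theta)$ (such $\mathcal{O}$ exists), with residue field $k$; then $L$ is a subfield of $k$ via $\theta(a)\mapsto a+J(\mathcal{O})$, and since $LH$ is split, $[V]\mapsto[k\otimes_L V]$ identifies $\mathcal{R}_0(LH)$ with $\mathcal{R}_0(kH)$. Every finite-dimensional graded $KH$-module $V$ is isomorphic, as a graded module, to $K\otimes_{\mathcal{O}}\widetilde{V}$ for some graded $\mathcal{O}H$-lattice $\widetilde{V}$, and $d^{\mathrm{gr}}_\theta([K\otimes_{\mathcal{O}}\widetilde{V}]):=[k\otimes_{\mathcal{O}}\widetilde{V}]\in\mathcal{R}_0^+(kH)=\mathcal{R}_0^+(LH)$.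 This is well defined and independent of the choices of $\widetilde{V}$ and $\mathcal{O}$. The map $d^{\mathrm{gr}}_{\theta,\theta'}$ is defined in the same way with $B$, $L$, $B\otimes_A H$, $\phi:B\to L'$ in place of $A$, $K$, $H$, $\theta:A\to L$. Graded decomposition matrix: $D^{\mathrm{gr}}_\theta(q)=\left(\sum_{n\in\mathbb{Z}}q^n[k\otimes_{\mathcal{O}}\widetilde{V}:M\langle n\rangle]^{\mathrm{gr}}\right)_{\underline{V}\in\underline{\mathrm{Irr}}(KH),\,\underline{M}\in\underline{\mathrm{Irr}}(LH)}$, where for $\underline V\in\underline{\mathrm{Irr}}(KH)$ with its fixed grading $V$, $\widetilde{V}$ is a graded $\mathcal{O}H$-lattice with $V\cong K\otimes_{\mathcal{O}}\widetilde{V}$, and the multiplicities are taken in $LH$-modules via the identification of $\mathcal{R}_0(LH)$ with $\mathcal{R}_0(kH)$ given by $[W]\mapsto[k\otimes_L W]$ for graded $LH$-modules $W$; equivalently, row $\underline{V}$ gives the coefficients of $d^{\mathrm{gr}}_\theta([V])$ in the basis $\{[M]\}$. The matrix $D^{\mathrm{gr}}_{\theta,\theta'}(q)$ is defined likewise from $d^{\mathrm{gr}}_{\theta,\theta'}$, with rows indexed by $\underline{\mathrm{Irr}}(LH)$ and columns by $\underline{\mathrm{Irr}}(L'H)$. *)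

(* Defs.v *)
From HB Require Import structures.
From mathcomp Require Import all_boot ssralg ssrint zmodp poly matrix.
From mathcomp Require Import mxpoly vector fraction generic_quotient ring_quotient.
From mathcomp Require Import boolp classical_sets fsbigop freeg.

Set Implicit Arguments.
Unset Strict Implicit.
Unset Printing Implicit Defensive.

Import GRing.Theory.
Import VectorInternalTheory.

Local Open Scope classical_set_scope.
Local Open Scope ring_scope.

Section Gradings.
Variables (R : pzRingType) (V : lmodType R).

Definition is_submodule (U : set V) : Prop :=
  U 0 /\ forall a u v, U u -> U v -> U (a *: u + v).

Definition lin_span (S : set V) : set V :=
  [set v | exists s : seq (R * V),
     (forall p, p \in s -> S p.2) /\ v = \sum_(p <- s) p.1 *: p.2].

(* V is the (internal) direct sum of the submodules C i. *)
Definition is_direct_sum (C : int -> set V) : Prop :=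
  [/\ forall i, is_submodule (C i),
      forall v, exists (s : seq int) (c : int -> V),
        [/\ uniq s, forall i, C i (c i) & v = \sum_(i <- s) c i] &
      forall (s : seq int) (c : int -> V), uniq s -> (forall i, C i (c i)) ->
        \sum_(i <- s) c i = 0 -> forall i, i \in s -> c i = 0].

End Gradings.

(* Associative unital R-algebras that are free of finite rank as R-modules.
   A [vectType] over a ring is exactly such a module.  The multiplication is
   bundled here because [algType] excludes the zero algebra. *)
Record freeAlgebra (R : comNzRingType) := FreeAlgebra {
  fa_space :> vectType R;
  fa_one : fa_space;
  fa_mul : fa_space -> fa_space -> fa_space;
  fa_mulA : associative fa_mul;
  fa_mul1l : left_id fa_one fa_mul;
  fa_mul1r : right_id fa_one fa_mul;
  fa_mulDl : left_distributive fa_mul +%R;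
  fa_mulDr : right_distributive fa_mul +%R;
  fa_mulZl : forall a x y, fa_mul (a *: x) y = a *: fa_mul x y;
  fa_mulZr : forall a x y, fa_mul x (a *: y) = a *: fa_mul x y }.

Arguments fa_one {R f} : simpl never.
Arguments fa_mul {R f} x y : simpl never.

Section FreeAlgebraLemmas.
Variables (R : comNzRingType) (H : freeAlgebra R).
Implicit Types x y : H.

Lemma fa_mul0l y : fa_mul 0 y = 0 :> H.
Proof. by have := fa_mulZl 0 (0 : H) y; rewrite !scale0r. Qed.

Lemma fa_mul0r y : fa_mul y 0 = 0 :> H.
Proof. by have := fa_mulZr 0 y (0 : H); rewrite !scale0r. Qed.

Lemma fa_mul_suml I (r : seq I) (F : I -> H) y :
  fa_mul (\sum_(i <- r) F i) y = \sum_(i <- r) fa_mul (F i) y.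
Proof.
by apply: (big_morph (@fa_mul R H ^~ y)) => [? ?|]; rewrite (fa_mulDl, fa_mul0l).
Qed.

Lemma fa_mul_sumr I (r : seq I) (F : I -> H) y :
  fa_mul y (\sum_(i <- r) F i) = \sum_(i <- r) fa_mul y (F i).
Proof.
by apply: (big_morph (@fa_mul R H y)) => [? ?|]; rewrite (fa_mulDr, fa_mul0r).
Qed.

End FreeAlgebraLemmas.

Definition is_algebra_grading (R : comNzRingType) (H : freeAlgebra R)
    (G : int -> set H) : Prop :=
  is_direct_sum G /\
  forall i j x y, G i x -> G j y -> G (i + j) (fa_mul x y).

(* The scalar extension R ⊗_A H along e : A -> R: if (b_i) is an A-basis of H,
   then (1 ⊗ b_i) is an R-basis of R ⊗_A H, with the same structure constants.
   [tens_in h] is 1 ⊗ h. *)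

Section ScalarExtension.
Variables (A R : comNzRingType) (e : {rmorphism A -> R}) (H : freeAlgebra A).
Local Notation n := (dim H).
Local Notation T := 'rV[R]_n.

Definition tens_in (h : H) : T := map_mx e (v2r h).
Definition tens_basis (i : 'I_n) : T := delta_mx 0 i.
Definition tens_coord (x : T) (i : 'I_n) : R := x 0 i.

Definition tens_one : T := tens_in fa_one.
Definition tens_mul (x y : T) : T :=
  \sum_i \sum_j (tens_coord x i * tens_coord y j) *:
    tens_in (fa_mul (r2v (delta_mx 0 i)) (r2v (delta_mx 0 j))).

Lemma tens_coordD x y i :
  tens_coord (x + y) i = tens_coord x i + tens_coord y i.
Proof. by rewrite /tens_coord mxE. Qed.

Lemma tens_coordZ a x i : tens_coord (a *: x) i = a * tens_coord x i.
Proof. by rewrite /tens_coord mxE. Qed.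

Lemma tens_coord_in h i : tens_coord (tens_in h) i = e (v2r h 0 i).
Proof. by rewrite /tens_coord /tens_in mxE. Qed.

Lemma tens_in_basis i : tens_in (r2v (delta_mx 0 i)) = tens_basis i.
Proof.
rewrite /tens_in r2vK /tens_basis; apply/rowP => j.
by rewrite !mxE; case: eqP => //=; case: eqP => // _ _; rewrite ?rmorph1 ?rmorph0.
Qed.

Lemma tens_inD x y : tens_in (x + y) = tens_in x + tens_in y.
Proof. by apply/rowP => j; rewrite /tens_in linearD !mxE rmorphD. Qed.

Lemma tens_inZ a x : tens_in (a *: x) = e a *: tens_in x.
Proof. by apply/rowP => j; rewrite /tens_in linearZ !mxE rmorphM. Qed.

Lemma tens_in0 : tens_in 0 = 0.
Proof. by have := tens_inZ 0 0; rewrite rmorph0 !scale0r. Qed.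

Lemma tens_in_sum I (r : seq I) (F : I -> H) :
  tens_in (\sum_(i <- r) F i) = \sum_(i <- r) tens_in (F i).
Proof. exact: (big_morph tens_in tens_inD tens_in0). Qed.

Lemma tens_expand (x : T) : x = \sum_i tens_coord x i *: tens_basis i.
Proof. exact: row_sum_delta. Qed.

Lemma free_expand (h : H) : h = \sum_i v2r h 0 i *: r2v (delta_mx 0 i).
Proof.
rewrite -[LHS]v2rK [in LHS](row_sum_delta (v2r h)) linear_sum.
by apply: eq_bigr => i _; rewrite linearZ.
Qed.

Lemma tens_mulDl : left_distributive tens_mul +%R.
Proof.
move=> x y z; rewrite /tens_mul -big_split; apply: eq_bigr => i _.
rewrite -big_split; apply: eq_bigr => j _.
by rewrite tens_coordD mulrDl scalerDl.
Qed.

Lemma tens_mulDr : right_distributive tens_mul +%R.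
Proof.
move=> x y z; rewrite /tens_mul -big_split; apply: eq_bigr => i _.
rewrite -big_split; apply: eq_bigr => j _.
by rewrite tens_coordD mulrDr scalerDl.
Qed.

Lemma tens_mulZl a x y : tens_mul (a *: x) y = a *: tens_mul x y.
Proof.
rewrite /tens_mul scaler_sumr; apply: eq_bigr => i _.
rewrite scaler_sumr; apply: eq_bigr => j _.
by rewrite tens_coordZ scalerA mulrA.
Qed.

Lemma tens_mulZr a x y : tens_mul x (a *: y) = a *: tens_mul x y.
Proof.
rewrite /tens_mul scaler_sumr; apply: eq_bigr => i _.
rewrite scaler_sumr; apply: eq_bigr => j _.
by rewrite tens_coordZ scalerA mulrCA.
Qed.

Lemma tens_mul0l y : tens_mul 0 y = 0.
Proof. by have := tens_mulZl 0 0 y; rewrite !scale0r. Qed.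

Lemma tens_mul0r y : tens_mul y 0 = 0.
Proof. by have := tens_mulZr 0 y 0; rewrite !scale0r. Qed.

Lemma tens_inM x y : tens_in (fa_mul x y) = tens_mul (tens_in x) (tens_in y).
Proof.
rewrite [in LHS](free_expand x) [in LHS](free_expand y) fa_mul_suml tens_in_sum.
apply: eq_bigr => i _; rewrite fa_mul_sumr tens_in_sum; apply: eq_bigr => j _.
by rewrite fa_mulZl fa_mulZr !tens_inZ scalerA !tens_coord_in.
Qed.

Lemma tens_ind2 (P : T -> Prop) : P 0 -> (forall x y, P x -> P y -> P (x + y)) ->
  (forall a h, P (a *: tens_in h)) -> forall x, P x.
Proof.
move=> P0 PD Pin x; rewrite (tens_expand x).
by elim/big_ind: _ => // i _; rewrite -tens_in_basis; apply: Pin.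
Qed.

Lemma tens_mulA : associative tens_mul.
Proof.
move=> x y z; elim/tens_ind2: x => [|x1 x2 E1 E2|a x].
- by rewrite !tens_mul0l.
- by rewrite !tens_mulDl E1 E2.
rewrite !tens_mulZl; congr (_ *: _).
elim/tens_ind2: y => [|y1 y2 E1 E2|b y].
- by rewrite tens_mul0l !tens_mul0r tens_mul0l.
- by rewrite tens_mulDr !tens_mulDl tens_mulDr E1 E2.
rewrite tens_mulZr !tens_mulZl tens_mulZr; congr (_ *: _).
elim/tens_ind2: z => [|z1 z2 E1 E2|c z].
- by rewrite !tens_mul0r.
- by rewrite !tens_mulDr E1 E2.
by rewrite !tens_mulZr -!tens_inM fa_mulA.
Qed.

Lemma tens_mul1l : left_id tens_one tens_mul.
Proof.
move=> x; elim/tens_ind2: x => [|x1 x2 E1 E2|a x].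
- by rewrite tens_mul0r.
- by rewrite tens_mulDr E1 E2.
by rewrite tens_mulZr -tens_inM fa_mul1l.
Qed.

Lemma tens_mul1r : right_id tens_one tens_mul.
Proof.
move=> x; elim/tens_ind2: x => [|x1 x2 E1 E2|a x].
- by rewrite tens_mul0l.
- by rewrite tens_mulDl E1 E2.
by rewrite tens_mulZl -tens_inM fa_mul1r.
Qed.

Definition tens : freeAlgebra R :=
  FreeAlgebra tens_mulA tens_mul1l tens_mul1r tens_mulDl tens_mulDr
    tens_mulZl tens_mulZr.

Lemma tens_ind (P : tens -> Prop) : P 0 -> (forall x y, P x -> P y -> P (x + y)) ->
  (forall a h, P (a *: (tens_in h : tens))) -> forall x, P x.
Proof. exact: tens_ind2. Qed.

(* R ⊗ H_i, as a submodule of R ⊗ H. *)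
Definition tens_grading (G : int -> set H) (i : int) : set tens :=
  lin_span (tens_in @` G i).

End ScalarExtension.

(* H-modules that are free of finite rank n over R: up to isomorphism, R^n
   with an action of H through matrices.  Over a field these are the
   finite-dimensional modules. *)
Record umodule (R : comNzRingType) (H : freeAlgebra R) := UModule {
  mdim : nat;
  mact : {linear H -> 'M[R]_mdim};
  mact1 : mact fa_one = 1%:M;
  mactM : forall x y, mact (fa_mul x y) = mact x *m mact y }.

Record gmodule (R : comNzRingType) (H : freeAlgebra R) (G : int -> set H) :=
  GModule {
  gforget :> umodule H;
  gcomp : int -> set 'cV[R]_(mdim gforget);
  gcomp_sum : is_direct_sum gcomp;
  gcomp_act : forall i j h v,
    G i h -> gcomp j v -> gcomp (i + j) (mact gforget h *m v) }.

Arguments gforget {R H G}.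
Arguments gcomp {R H G}.

Section Modules.
Variables (R : comNzRingType) (H : freeAlgebra R) (G : int -> set H).
Implicit Types (V W : umodule H) (M N : gmodule G).

Definition is_umorphism V W (X : 'M[R]_(mdim W, mdim V)) : Prop :=
  forall h, X *m mact V h = mact W h *m X.

Definition is_gmorphism M N (X : 'M[R]_(mdim N, mdim M)) : Prop :=
  is_umorphism X /\ forall i v, gcomp M i v -> gcomp N i (X *m v).

Definition uiso V W : Prop :=
  exists (X : 'M[R]_(mdim W, mdim V)) (Y : 'M[R]_(mdim V, mdim W)),
  [/\ is_umorphism X, is_umorphism Y, X *m Y = 1%:M & Y *m X = 1%:M].

Definition giso M N : Prop :=
  exists (X : 'M[R]_(mdim N, mdim M)) (Y : 'M[R]_(mdim M, mdim N)),
  [/\ is_gmorphism X, is_gmorphism Y, X *m Y = 1%:M & Y *m X = 1%:M].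

Definition stable_submodule V (U : set 'cV[R]_(mdim V)) : Prop :=
  is_submodule U /\ forall h v, U v -> U (mact V h *m v).

Definition graded_submodule M (U : set 'cV[R]_(mdim M)) : Prop :=
  @stable_submodule M U /\
  forall v, U v -> exists (s : seq int) (c : int -> 'cV[R]_(mdim M)),
    (forall i, U (c i) /\ gcomp M i (c i)) /\ v = \sum_(i <- s) c i.

Definition usimple V : Prop :=
  (exists v : 'cV[R]_(mdim V), v != 0) /\
  forall U, @stable_submodule V U -> U = [set 0] \/ U = setT.

Definition gsimple M : Prop :=
  (exists v : 'cV[R]_(mdim M), v != 0) /\
  forall U, @graded_submodule M U -> U = [set 0] \/ U = setT.

(* There is a short exact sequence 0 -> M' -> M -> M'' -> 0. *)
Definition gexact (M' M M'' : gmodule G) : Prop :=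
  exists (X : 'M[R]_(mdim M, mdim M')) (Y : 'M[R]_(mdim M'', mdim M)),
  [/\ is_gmorphism X, is_gmorphism Y,
      forall v : 'cV_(mdim M'), X *m v = 0 -> v = 0,
      forall w : 'cV_(mdim M), Y *m w = 0 <-> exists v, w = X *m v &
      forall u, exists w : 'cV_(mdim M), u = Y *m w].

(* [gseries M s]: M has a graded composition series with factors s,
   listed from the top. *)
Inductive gseries : gmodule G -> seq (gmodule G) -> Prop :=
| GSeriesNil M : (forall v : 'cV[R]_(mdim M), v = 0) -> gseries M [::]
| GSeriesCons M' M S s :
    gexact M' M S -> gsimple S -> gseries M' s -> gseries M (S :: s).

(* The graded multiplicity [M : S]^gr; it does not depend on the series. *)
Definition gmult M S : nat :=
  get [set m | exists s, gseries M s /\ m = count (fun N => `[< giso N S >]) s].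

End Modules.

Section Shift.
Variables (R : comNzRingType) (H : freeAlgebra R) (G : int -> set H).
Variables (M : gmodule G) (j : int).

Definition shift_comp (i : int) : set 'cV[R]_(mdim M) := gcomp M (i - j).

Lemma shift_comp_sum : is_direct_sum shift_comp.
Proof.
have [sub dec ind] := gcomp_sum M; split=> [i|v|s c us Cc s0 i si].
- exact: sub.
- have [s [c [us Cc ->]]] := dec v.
  exists [seq i + j | i <- s], (fun i => c (i - j)).
  split=> [|i|]; first by rewrite map_inj_uniq //; apply: addIr.
  - exact: Cc.
  - by rewrite big_map; apply: eq_bigr => i _; rewrite addrK.
- have := ind [seq k - j | k <- s] (fun k => c (k + j)).
  move=> /(_ _ _ _ (i - j)); rewrite subrK; apply.
  + by rewrite map_inj_uniq //; apply: addIr.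
  + by move=> k; have := Cc (k + j); rewrite /shift_comp addrK.
  + by rewrite big_map -[RHS]s0; apply: eq_bigr => k _; rewrite subrK.
  + exact: (map_f (fun k => k - j)).
Qed.

Lemma shift_comp_act i k h v :
  G i h -> shift_comp k v -> shift_comp (i + k) (mact M h *m v).
Proof. by rewrite /shift_comp -addrA; apply: gcomp_act. Qed.

(* M<j> *)
Definition gshift : gmodule G := GModule shift_comp_sum shift_comp_act.

End Shift.

Section ZeroModule.
Variables (R : comNzRingType) (H : freeAlgebra R) (G : int -> set H).

Definition zero_act : {linear H -> 'M[R]_0} := \0.

Lemma zero_act1 : zero_act fa_one = 1%:M.
Proof. by rewrite [LHS]flatmx0 [RHS]flatmx0. Qed.

Lemma zero_actM x y : zero_act (fa_mul x y) = zero_act x *m zero_act y.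
Proof. by rewrite [LHS]flatmx0 [RHS]flatmx0. Qed.

Definition zero_umodule : umodule H := UModule zero_act1 zero_actM.

Lemma zero_comp_sum : is_direct_sum (fun i : int => [set: 'cV[R]_0]).
Proof.
split=> // [v|s c _ _ _ i _]; last exact: flatmx0.
by exists [::], (fun=> 0); split=> //; rewrite [v]flatmx0 [RHS]flatmx0.
Qed.

Definition zero_gmodule : gmodule G :=
  @GModule R H G zero_umodule _ zero_comp_sum (fun _ _ _ _ _ _ => I).

End ZeroModule.

Section Span.
Variables (R : pzRingType) (V : lmodType R) (S : set V).

Lemma lin_span_sub v : S v -> lin_span S v.
Proof.
move=> Sv; exists [:: (1, v)]; rewrite big_seq1 /= scale1r; split=> // p.
by rewrite inE => /eqP ->.
Qed.

Lemma lin_span0 : lin_span S 0.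
Proof. by exists [::]; rewrite big_nil. Qed.

Lemma lin_spanP a u v : lin_span S u -> lin_span S v -> lin_span S (a *: u + v).
Proof.
move=> [s [Ss ->]] [t [St ->]].
exists ([seq (a * p.1, p.2) | p <- s] ++ t); split=> [p|].
  by rewrite mem_cat => /orP[/mapP[q /Ss Sq ->]|/St].
rewrite big_cat big_map /= scaler_sumr; congr (_ + _).
by apply: eq_bigr => p _; rewrite scalerA.
Qed.

Lemma lin_span_submodule : is_submodule (lin_span S).
Proof. by split; [exact: lin_span0 | exact: lin_spanP]. Qed.

End Span.

Section SubmoduleLemmas.
Variables (R : pzRingType) (V : lmodType R) (U : set V).
Hypothesis subU : is_submodule U.

Lemma is_submoduleD u v : U u -> U v -> U (u + v).
Proof. by move=> Uu Uv; rewrite -[u]scale1r; apply: subU.2. Qed.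

Lemma is_submoduleZ a u : U u -> U (a *: u).
Proof. by move=> Uu; rewrite -[_ *: _]addr0; apply: subU.2 => //; apply: subU.1. Qed.

Lemma is_submodule_sum I (r : seq I) (F : I -> V) :
  (forall i, U (F i)) -> U (\sum_(i <- r) F i).
Proof.
move=> UF; elim/big_ind: _ => //; [exact: subU.1 | exact: is_submoduleD].
Qed.

End SubmoduleLemmas.

(* The homogeneous components of a direct sum decomposition of R^n are
   projected onto by matrices. *)
Lemma grading_projections (R : comNzRingType) n (C : int -> set 'cV[R]_n) :
  is_direct_sum C -> exists (s : seq int) (P : int -> 'M[R]_n),
    [/\ uniq s, forall i v, C i (P i *m v), \sum_(i <- s) P i = 1%:M &
        forall i j v, C j v -> P i *m v = if i == j then v else 0].
Proof.
move=> [sub dec ind].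
have /choice[s /choice[c Hsc]] : forall k : 'I_n, exists s : seq int,
    exists c : int -> 'cV[R]_n, [/\ uniq s, forall i, C i (c i) &
      delta_mx k 0 = \sum_(i <- s) c i].
  by move=> k; apply: dec.
pose d k i := if i \in s k then c k i else 0.
pose P i : 'M[R]_n := \matrix_(l, k) d k i l 0.
have Cd k i : C i (d k i).
  rewrite /d; case: ifP => _; last exact: (sub i).1.
  by have [_ + _] := Hsc k; apply.
have PE i (v : 'cV[R]_n) : P i *m v = \sum_k v k 0 *: d k i.
  apply/colP => l; rewrite mxE summxE; apply: eq_bigr => k _.
  by rewrite !mxE mulrC.
have CP i v : C i (P i *m v).
  by rewrite PE; apply: (is_submodule_sum (sub i)) => k;
     apply: (is_submoduleZ (sub i)).
have big_d k t : uniq t -> {subset s k <= t} ->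
    \sum_(i <- t) d k i = delta_mx k 0.
  move=> ut st; have [us _ ->] := Hsc k.
  rewrite /d -big_mkcond /= -big_filter; apply: perm_big.
  apply: uniq_perm; rewrite ?filter_uniq // => i; rewrite mem_filter.
  by case si: (i \in s k) => //=; apply: st.
pose t0 := flatten [seq s k | k <- enum 'I_n].
have st0 k : {subset s k <= t0}.
  by move=> i si; apply/flattenP; exists (s k) => //; apply: map_f; rewrite mem_enum.
have sumP t : uniq t -> {subset t0 <= t} -> \sum_(i <- t) P i = 1%:M.
  move=> ut t0t; apply/matrixP => l k; rewrite summxE mxE.
  under eq_bigr do rewrite mxE.
  have := big_d k t ut (fun i h => t0t _ (st0 _ _ h)).
  by move=> /colP/(_ l); rewrite summxE => ->; rewrite !mxE andbT.
exists (undup t0), P; split=> // [||i j v Cv].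
- exact: undup_uniq.
- by apply: sumP; [exact: undup_uniq | move=> i; rewrite mem_undup].
pose t := undup [:: i, j & t0].
have ut : uniq t by exact: undup_uniq.
have t0t : {subset t0 <= t}.
  by move=> k kt; rewrite mem_undup !inE kt !orbT.
have it : i \in t by rewrite mem_undup inE eqxx.
have jt : j \in t by rewrite mem_undup !inE eqxx orbT.
have /eqP : P i *m v - (if i == j then v else 0) = 0.
  apply: (ind t (fun k => P k *m v - (if k == j then v else 0))) => // [k|].
    rewrite -scaleN1r addrC; apply: (sub k).2 => //.
    by case: eqP => [->|_] //; exact: (sub k).1.
  rewrite sumrB -mulmx_suml sumP // mul1mx -big_mkcond /=.
  by rewrite -big_filter filter_pred1_uniq // big_seq1 subrr.
by rewrite subr_eq0 => /eqP.
Qed.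

(* For a graded module M over R ⊗_A H, free over R, and f : R -> R', the
   graded module R' ⊗_R M over R' ⊗_A H; here e' : A -> R' is f \o e. *)
Section ModuleExtension.
Variables (A R R' : comNzRingType) (H : freeAlgebra A) (G : int -> set H).
Variables (e : {rmorphism A -> R}) (e' : {rmorphism A -> R'}).
Variables (f : {rmorphism R -> R'}) (fe : forall a, f (e a) = e' a).
Variable M : gmodule (tens_grading (e := e) G).
Local Notation m := (mdim M).

Definition ext_act (x : tens e' H) : 'M[R']_m :=
  \sum_i tens_coord x i *: map_mx f (mact M (tens_basis R i)).

Lemma ext_act_linear : linear ext_act.
Proof.
move=> a x y; rewrite /ext_act scaler_sumr -big_split; apply: eq_bigr => i _ /=.
by rewrite tens_coordD tens_coordZ scalerDl scalerA.
Qed.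

HB.instance Definition _ := GRing.isLinear.Build R' (tens e' H) 'M[R']_m _
  ext_act ext_act_linear.

Lemma ext_act_in h : ext_act (tens_in e' h) = map_mx f (mact M (tens_in e h)).
Proof.
rewrite /ext_act [in RHS](tens_expand (tens_in e h)) linear_sum.
rewrite raddf_sum; apply: eq_bigr => i _.
by rewrite linearZ /= map_mxZ !tens_coord_in fe.
Qed.

Lemma ext_act1 : ext_act fa_one = 1%:M.
Proof. by rewrite ext_act_in (mact1 M) map_mx1. Qed.

Lemma ext_actM x y : ext_act (fa_mul x y) = ext_act x *m ext_act y.
Proof.
elim/tens_ind: x => [|x1 x2 E1 E2|a x].
- by rewrite fa_mul0l linear0 mul0mx.
- by rewrite fa_mulDl !linearD /= mulmxDl E1 E2.
rewrite fa_mulZl !linearZ /= -scalemxAl; congr (_ *: _).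
elim/tens_ind: y => [|y1 y2 E1 E2|b y].
- by rewrite fa_mul0r linear0 mulmx0.
- by rewrite fa_mulDr !linearD /= E1 E2.
rewrite fa_mulZr !linearZ /=; congr (_ *: _).
have <- : tens_in e' (fa_mul x y) =
    fa_mul (tens_in e' x : tens e' H) (tens_in e' y) by exact: tens_inM.
by rewrite !ext_act_in -map_mxM -(mactM M) tens_inM.
Qed.

Definition uext : umodule (tens e' H) := UModule ext_act1 ext_actM.

Definition ext_comp (i : int) : set 'cV[R']_m :=
  lin_span (map_mx f @` gcomp M i).

Lemma ext_comp_sum : is_direct_sum ext_comp.
Proof.
have [s [P [us CP sumP projP]]] := grading_projections (gcomp_sum M).
split=> [i|v|t c ut Cc c0 i it].
- exact: lin_span_submodule.
- exists s, (fun i => map_mx f (P i) *m v); split=> // [i|].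
  + have -> : map_mx f (P i) *m v =
        \sum_k v k 0 *: map_mx f (P i *m delta_mx k 0).
      rewrite [in LHS](_ : v = \sum_k v k 0 *: delta_mx k 0); last first.
        by rewrite [LHS]matrix_sum_delta; apply: eq_bigr => k _; rewrite big_ord1.
      rewrite mulmx_sumr; apply: eq_bigr => k _.
      by rewrite map_mxM map_delta_mx -scalemxAr.
    apply: (is_submodule_sum (lin_span_submodule _)) => k.
    apply: (is_submoduleZ (lin_span_submodule _)).
    by apply: lin_span_sub; exists (P i *m delta_mx k 0).
  + rewrite -mulmx_suml -raddf_sum.
    by rewrite sumP /= map_mx1 mul1mx.
have Pc k j v : ext_comp j v -> map_mx f (P k) *m v = if k == j then v else 0.
  move=> [r [Sr ->]]; rewrite mulmx_sumr.
  rewrite big_seq [in RHS]big_seq.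
  have Ep p : p \in r -> map_mx f (P k) *m (p.1 *: p.2) =
      if k == j then p.1 *: p.2 else 0.
    move=> /Sr[w Cw <-]; rewrite -scalemxAr -map_mxM (projP _ j) //.
    by case: eqP => // _; rewrite map_mx0 scaler0.
  case: eqP Ep => [_|_] Ep; first exact: eq_bigr.
  by rewrite big1.
have := congr1 (mulmx (map_mx f (P i))) c0; rewrite mulmx0 mulmx_sumr.
under eq_bigr do rewrite (Pc i _ _ (Cc _)) eq_sym.
by rewrite -big_mkcond -big_filter filter_pred1_uniq // big_seq1.
Qed.

Lemma ext_comp_act i j (x : tens e' H) v :
  tens_grading G i x -> ext_comp j v -> ext_comp (i + j) (ext_act x *m v).
Proof.
have sub := lin_span_submodule (map_mx f @` gcomp M (i + j)).
move=> [s [Ss ->]] [t [St ->]].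
rewrite [ext_act _]linear_sum /= mulmx_suml big_seq; elim/big_ind: _.
- exact: sub.1.
- exact: (is_submoduleD sub).
move=> p ps; rewrite [ext_act _]linearZ /= -scalemxAl; apply: (is_submoduleZ sub).
rewrite mulmx_sumr big_seq; elim/big_ind: _.
- exact: sub.1.
- exact: (is_submoduleD sub).
move=> q qt; rewrite -scalemxAr; apply: (is_submoduleZ sub).
have [h Gh <-] := Ss _ ps; have [w Cw <-] := St _ qt.
rewrite ext_act_in -map_mxM; apply: lin_span_sub.
exists (mact M (tens_in e h) *m w) => //.
by apply: gcomp_act Cw; apply: lin_span_sub; exists h.
Qed.

Definition gext : gmodule (tens_grading (e := e') G) :=
  @GModule _ _ _ uext ext_comp ext_comp_sum ext_comp_act.

End ModuleExtension.

(* The Grothendieck group: the free abelian group on graded modules modulo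
   [M] = [M'] + [M''] for short exact sequences 0 -> M' -> M -> M'' -> 0. *)
Section Grothendieck.
Variables (F : fieldType) (H : freeAlgebra F) (G : int -> set H).

HB.instance Definition _ := gen_eqMixin (gmodule G).
HB.instance Definition _ := gen_choiceMixin (gmodule G).

Definition ses_relation : set {freeg (gmodule G) / int} :=
  [set x | exists M' M M'', gexact M' M M'' /\ x = << M >> - << M' >> - << M'' >>].

(* The subgroup generated by [ses_relation]. *)
Definition ses_subgroup : {pred {freeg (gmodule G) / int}} :=
  fun x => `[< forall P : set {freeg (gmodule G) / int},
    P 0 -> (forall y z, P y -> P z -> P (y - z)) ->
    ses_relation `<=` P -> P x >].

Lemma ses_subgroup_zmod : zmod_closed ses_subgroup.
Proof.
split=> [|x y /asboolP Sx /asboolP Sy]; first by apply/asboolP => P.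
apply/asboolP => P P0 PB PS.
by apply: (PB); [exact: (Sx P P0 PB PS) | exact: (Sy P P0 PB PS)].
Qed.

HB.instance Definition _ := GRing.isZmodClosed.Build
  {freeg (gmodule G) / int} ses_subgroup ses_subgroup_zmod.

Definition R0 : zmodType := Quotient.quot ses_subgroup.

Definition gclass (M : gmodule G) : R0 :=
  \pi_(Quotient.quot ses_subgroup)%qT << M >>.

Definition R0plus : set R0 := range gclass.

Definition gclass_plus (M : gmodule G) : R0plus :=
  SigSub (mem_set (imageT gclass M)).

Definition gclass_rep (x : R0plus) : gmodule G :=
  projT1 (cid2 (set_mem (svalP x))).

Definition gclass_mult (x : R0plus) (S : gmodule G) : nat :=
  gmult (gclass_rep x) S.

End Grothendieck.

Arguments R0 {F H} G.
Arguments R0plus {F H} G.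

Definition split_algebra (F : fieldType) (H : freeAlgebra F) : Prop :=
  forall V : umodule H, usimple V ->
  forall X : 'M[F]_(mdim V), is_umorphism (V := V) (W := V) X -> exists c, X = c%:M.

(* An enumeration of Irr(H), each simple module with a fixed grading. *)
Definition is_graded_irr (F : fieldType) (H : freeAlgebra F) (G : int -> set H)
    n (M : 'I_n -> gmodule G) : Prop :=
  [/\ forall i, usimple (M i),
      forall i j, uiso (M i) (M j) -> i = j &
      forall V : umodule H, usimple V -> exists i, uiso V (M i)].

Definition is_fraction_field (A : comNzRingType) (K : fieldType)
    (f : {rmorphism A -> K}) : Prop :=
  forall x, exists a b, f b != 0 /\ x = f a / f b.

Definition integrally_closed (A : comNzRingType) (K : fieldType)
    (f : {rmorphism A -> K}) : Prop :=
  forall x, integralOver f x -> exists a, x = f a.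

(* A0 is the base ring over which H is defined; K, L are A0-algebras via eK, eL.
   The decomposition map of theta : A -> L, where A is an A0-algebra with field
   of fractions K, compares modules over KH = K ⊗_A0 H and LH = L ⊗_A0 H; note
   that K ⊗_A (A ⊗_A0 H) = K ⊗_A0 H, and likewise for L. *)
Section DecompositionMap.
Variables (A0 A : comNzRingType) (K L : fieldType).
Variables (H : freeAlgebra A0) (G : int -> set H).
Variables (eA : {rmorphism A0 -> A}) (eK : {rmorphism A0 -> K}).
Variables (eL : {rmorphism A0 -> L}).
Variables (iota : {rmorphism A -> K}) (theta : {rmorphism A -> L}).
Hypothesis iotaE : forall a, iota (eA a) = eK a.
Hypothesis thetaE : forall a, theta (eA a) = eL a.

(* A valuation ring O with A ⊆ O ⊆ K and J(O) ∩ A = Ker theta, its residue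
   field k, and the embedding of L into k.  The kernel of the surjection from
   the local ring O onto the field k is necessarily J(O). *)
Record valuation_ring := ValuationRing {
  vr_ring : comNzRingType;
  vr_in : {rmorphism vr_ring -> K};
  vr_in_inj : injective vr_in;
  vr_valuation : forall x : K, x != 0 ->
    (exists o, x = vr_in o) \/ (exists o, x^-1 = vr_in o);
  vr_base : {rmorphism A -> vr_ring};
  vr_baseE : forall a, vr_in (vr_base a) = iota a;
  vr_residue : fieldType;
  vr_res : {rmorphism vr_ring -> vr_residue};
  vr_res_surj : forall z, exists o, z = vr_res o;
  vr_ker : forall a, vr_res (vr_base a) = 0 <-> theta a = 0;
  vr_emb : {rmorphism L -> vr_residue};
  vr_embE : forall a, vr_emb (theta a) = vr_res (vr_base a) }.

Section ForValuationRing.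
Variable O : valuation_ring.
Let eO : {rmorphism A0 -> vr_ring O} := vr_base O \o eA.
Let ek : {rmorphism A0 -> vr_residue O} := vr_emb O \o eL.

Definition lattice := gmodule (tens_grading (e := eO) G).

Lemma vr_inE a : vr_in O (eO a) = eK a.
Proof. by rewrite /= vr_baseE iotaE. Qed.

Lemma vr_resE a : vr_res O (eO a) = ek a.
Proof. by rewrite /= -vr_embE thetaE. Qed.

Lemma vr_embLE a : vr_emb O (eL a) = ek a.
Proof. by []. Qed.

(* K ⊗_O V, k ⊗_O V and k ⊗_L W. *)
Definition generic_fibre (V : lattice) : gmodule (tens_grading (e := eK) G) :=
  gext vr_inE V.

Definition special_fibre (V : lattice) : gmodule (tens_grading (e := ek) G) :=
  gext vr_resE V.

Definition residue_ext (W : gmodule (tens_grading (e := eL) G)) :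
    gmodule (tens_grading (e := ek) G) :=
  gext vr_embLE W.

End ForValuationRing.

Local Notation KHmod := (gmodule (tens_grading (e := eK) G)).
Local Notation LHmod := (gmodule (tens_grading (e := eL) G)).
Local Notation R0K := (R0plus (tens_grading (e := eK) G)).
Local Notation R0L := (R0plus (tens_grading (e := eL) G)).

Definition decomp_rel (x : R0K) (y : R0L) : Prop :=
  exists (O : valuation_ring) (V : lattice O) (W : LHmod),
    [/\ x = gclass_plus (generic_fibre V), y = gclass_plus W &
        gclass (special_fibre V) = gclass (residue_ext O W)].

(* [K ⊗_O V] is mapped to [W], where [k ⊗_L W] = [k ⊗_O V]; the default value
   is never used when A is integrally closed and LH is split. *)
Definition decomp_map (x : R0K) : R0L :=
  xget (gclass_plus (zero_gmodule _)) [set y | decomp_rel x y].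

End DecompositionMap.

Definition laurent_q : {fraction {poly int}} := tofrac 'X.

(* The matrix of a graded decomposition map d : R_0^+(KH) -> R_0^+(LH), where N
   and M enumerate Irr(KH) and Irr(LH).  The Laurent polynomials Z[q, q^-1] are
   seen inside the field Q(q); the sums have finite support. *)
Definition decomp_matrix (K L : fieldType) (KH : freeAlgebra K)
    (LH : freeAlgebra L) (GK : int -> set KH) (GL : int -> set LH)
    (d : R0plus GK -> R0plus GL) m n
    (N : 'I_m -> gmodule GK) (M : 'I_n -> gmodule GL) :
    'M[{fraction {poly int}}]_(m, n) :=
  \matrix_(i, j) \sum_(k \in [set: int])
    laurent_q ^ k *+ gclass_mult (d (gclass_plus (N i))) (gshift (M j) k).

(* Main.v *)
From HB Require Import structures.
From mathcomp Require Import all_boot order ssralg ssrnum ssrint zmodp poly matrix.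
From mathcomp Require Import mxalgebra mxpoly vector fraction generic_quotient.
From mathcomp Require Import ring_quotient boolp classical_sets fsbigop freeg zify.
Require Import Defs.

(** The maps are compared through characteristic polynomials. For a graded module
    [M], an element [h] of degree 0 and a degree [i], let [gchar M h i] be
    det(1 - X h) on the component [M_i]. It is multiplicative on short exact
    sequences, so it depends on the class of [M] only ([gclass_gchar]). If [M] is
    a module over [KH] and [h] comes from [H], its coefficients lie in [A]:
    a graded lattice over a valuation ring [O] between [A] and [K] puts them in
    [O] ([lattice_exists]), and since [A] is integrally closed it is the
    intersection of these rings ([valuation_avoiding], [gchar_integral]).
    Computing with the same lattice over [O], [K] and the residue field shows that
    a decomposition map applies [theta] to these coefficients
    ([decomp_map_gchar]). As [phi (theta a) = theta' a], the map of [theta'] and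
    the composite map send a class to two classes with the same [gchar].

    Over a split algebra [gchar] determines the class ([gclass_eq_gchar]), in any
    characteristic. By density there are, for a simple graded module [S] and
    finitely many others, an [h] of degree 0 and an [i] such that [h] has rank one
    and nonzero trace on [S_i] and is zero on the [i]-th components of the others,
    even of the shifts of [S] ([detection]). Then [gchar] at [h] and [i] is a power
    of 1 - bX, with [b] nonzero, whose exponent is the multiplicity of [S]. Clearing
    denominators, [h] can be taken in the image of [H] ([rational_degree0]). Hence
    the equality of maps. For the matrices, the composition factors of [d_theta]
    of a simple module are replaced by those of their images under the second map;
    by the previous argument this list has the multiplicities of [d_theta'] of the
    module ([laurent_row_gmult]), and its Laurent polynomials are the entries of
    the product.

    A decomposition map is chosen from a relation, which must be shown to be total
    ([decomp_rel_exists]). Zorn's lemma gives a valuation ring with the required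
    centre ([maximal_pair], [valuation_ring_exists]). A finitely generated torsion
    free module over it is free, which gives lattices. Finally the class of a
    graded [kH]-module comes from [LH] ([gclass_residue]): a simple one is a
    quotient of the extension of a shifted regular module, hence of the extension
    of a simple [LH]-module, and that extension is still simple by density. *)

Set Implicit Arguments.
Unset Strict Implicit.
Unset Printing Implicit Defensive.

Import GRing.Theory.
Import VectorInternalTheory.

Local Open Scope classical_set_scope.
Local Open Scope ring_scope.

(** * Matrices and reversed characteristic polynomials *)

Lemma mulmx_delta_ext (R : comNzRingType) m n (A B : 'M[R]_(m, n)) :
  (forall j, A *m delta_mx j 0 = B *m delta_mx j 0 :> 'cV_m) -> A = B.
Proof.
move=> AB; apply/matrixP => i j.
by have /colP/(_ i) := AB j; rewrite -!colE !mxE.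
Qed.

Lemma mulmx_cV_ext (R : comNzRingType) m n (A B : 'M[R]_(m, n)) :
  (forall v : 'cV_n, A *m v = B *m v) -> A = B.
Proof. by move=> AB; apply: mulmx_delta_ext => j; apply: AB. Qed.

Lemma mulmx_colE (R : comNzRingType) m n (A : 'M[R]_(m, n)) (v : 'cV_n) :
  A *m v = \sum_j v j 0 *: col j A.
Proof.
apply/colP => i; rewrite mxE summxE; apply: eq_bigr => j _.
by rewrite !mxE mulrC.
Qed.

(** The maps [X] and [Y] of a short exact sequence, with a retraction [XL] of [X]
    and a section [YR] of [Y] adapted to each other; having all four as matrices
    turns arguments on exact sequences into computations. *)
Definition is_splitting (R : comNzRingType) a m b (X : 'M[R]_(m, a)) XL
    (Y : 'M[R]_(b, m)) YR :=
  [/\ XL *m X = 1%:M, Y *m YR = 1%:M & X *m XL + YR *m Y = 1%:M].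

Section Splitting.
Variables (R : comNzRingType) (a m b : nat).
Variables (X : 'M[R]_(m, a)) (XL : 'M[R]_(a, m)) (Y : 'M[R]_(b, m)) (YR : 'M[R]_(m, b)).
Hypothesis S : is_splitting X XL Y YR.

Lemma splitting0 : Y *m X = 0.
Proof.
have [XLX YYR E] := S; apply: (@addIr _ (Y *m X)); rewrite add0r -{3}[Y]mulmx1 -E.
by rewrite mulmxDr mulmxDl -!mulmxA XLX mulmx1 !mulmxA YYR mul1mx.
Qed.

Lemma splitting_row_col : row_mx X YR *m col_mx XL Y = 1%:M.
Proof. by have [_ _ E] := S; rewrite mul_row_col. Qed.

Lemma splitting_col_row : col_mx XL Y *m row_mx X YR = 1%:M.
Proof.
have [XLX YYR E] := S; rewrite mul_col_row XLX splitting0 YYR.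
suff -> : XL *m YR = 0 by rewrite -scalar_mx_block.
apply: (@addIr _ (XL *m YR)); rewrite add0r -{3}[XL]mulmx1 -E mulmxDr.
by rewrite mulmxDl !mulmxA XLX mul1mx -!mulmxA YYR mulmx1.
Qed.

End Splitting.

Lemma splitting_dim (F : fieldType) a m b (X : 'M[F]_(m, a)) XL
    (Y : 'M[F]_(b, m)) YR : is_splitting X XL Y YR -> (a + b)%N = m.
Proof.
move=> S; apply/eqP; rewrite eqn_leq (mulmx1_min (splitting_row_col S)).
by rewrite (mulmx1_min (splitting_col_row S)).
Qed.

(** Both sides are the determinant of the block matrix with identity diagonal blocks
    and off-diagonal blocks [A] and [B], reduced to triangular form on the right
    and on the left. *)
Lemma det_sylvester (R : comNzRingType) m n (A : 'M[R]_(m, n)) (B : 'M[R]_(n, m)) :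
  \det (1%:M - A *m B) = \det (1%:M - B *m A).
Proof.
have E1 : block_mx 1%:M A B 1%:M *m block_mx 1%:M 0 (- B) 1%:M =
          block_mx (1%:M - A *m B) A 0 1%:M.
  by rewrite mulmx_block !mulmx1 !mul1mx !mulmx0 mulmxN !add0r subrr.
have E2 : block_mx 1%:M 0 (- B) 1%:M *m block_mx 1%:M A B 1%:M =
          block_mx 1%:M A 0 (1%:M - B *m A).
  by rewrite mulmx_block !mulmx1 !mul1mx !mul0mx !addr0 addNr mulNmx addrC.
have := congr1 determinant E1; rewrite det_mulmx det_lblock det_ublock !det1.
rewrite !mulr1 => <-; have := congr1 determinant E2.
by rewrite det_mulmx det_lblock det_ublock !det1 !mul1r => <-.
Qed.

(** The characteristic polynomial with reversed coefficients. Extending an operator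
    by zero does not change it, so an operator on a direct summand can be replaced by
    its composite with the projection, without bookkeeping of dimensions. *)
Definition rchar (R : comNzRingType) n (T : 'M[R]_n) : {poly R} :=
  \det (1%:M - 'X *: map_mx polyC T).

Section ReversedCharPoly.
Variable R : comNzRingType.

Lemma rchar_mulC m n (A : 'M[R]_(m, n)) (B : 'M[R]_(n, m)) :
  rchar (A *m B) = rchar (B *m A).
Proof. by rewrite /rchar !map_mxM !scalemxAl det_sylvester -!scalemxAl -scalemxAr. Qed.

Lemma rchar_ublock m n (A : 'M[R]_m) (B : 'M[R]_(m, n)) (D : 'M[R]_n) :
  rchar (block_mx A B 0 D) = rchar A * rchar D.
Proof.
rewrite /rchar map_block_mx map_mx0 scale_block_mx scalar_mx_block opp_block_mx.
by rewrite add_block_mx scaler0 oppr0 addr0 det_ublock.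
Qed.

Lemma rchar_map (S : comNzRingType) (f : {rmorphism R -> S}) n (T : 'M[R]_n) :
  rchar (map_mx f T) = map_poly f (rchar T).
Proof.
rewrite /rchar -det_map_mx; congr (\det _); apply/matrixP => i j.
by rewrite !mxE rmorphB rmorphM /= map_polyX map_polyC rmorphMn /= rmorph1.
Qed.

Lemma rchar0 n : rchar (0 : 'M[R]_n) = 1.
Proof. by rewrite /rchar map_mx0 scaler0 subr0 det1. Qed.

Lemma rchar1 (a : R) : rchar (a%:M : 'M_1) = 1 - a *: 'X.
Proof.
rewrite /rchar det_mx11 !mxE eqxx !mulr1n -mul_polyC; congr (_ - _).
by rewrite mulrC.
Qed.

Lemma rchar_coef0 n (T : 'M[R]_n) : (rchar T)`_0 = 1.
Proof.
rewrite -horner_coef0 -[LHS]/(horner_eval 0 _) /rchar -det_map_mx -[RHS](det1 R n).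
congr (\det _); apply/matrixP => i j; rewrite !mxE.
rewrite -[LHS]/(_.[0]).
by rewrite hornerD hornerN hornerM hornerX mul0r subr0 hornerMn hornerC.
Qed.

Lemma rchar_neq0 n (T : 'M[R]_n) : rchar T != 0.
Proof.
apply/eqP => T0; have := rchar_coef0 T; rewrite T0 coef0 => /eqP.
by rewrite eq_sym oner_eq0.
Qed.

(** [X] and [Y] are mutually inverse, but [m] and [n] need not be syntactically equal. *)
Lemma rchar_conj m n (T : 'M[R]_m) (T' : 'M[R]_n) (X : 'M[R]_(m, n)) Y :
  X *m Y = 1%:M -> Y *m X = 1%:M -> T *m X = X *m T' -> rchar T = rchar T'.
Proof.
move=> XY YX TX; have -> : T' = Y *m (T *m X) by rewrite TX mulmxA YX mul1mx.
by rewrite rchar_mulC -mulmxA XY mulmx1.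
Qed.

Lemma rchar_split m a b (T : 'M[R]_m) (T' : 'M[R]_a) (T'' : 'M[R]_b)
    (X : 'M[R]_(m, a)) XL (Y : 'M[R]_(b, m)) YR :
  is_splitting X XL Y YR -> T *m X = X *m T' -> Y *m T = T'' *m Y ->
  rchar T = rchar T' * rchar T''.
Proof.
move=> S TX YT; rewrite -(rchar_ublock T' (XL *m T *m YR)).
apply: (rchar_conj (splitting_row_col S) (splitting_col_row S)).
have [_ YYR E] := S; rewrite mul_mx_row mul_row_block mulmx0 addr0 TX; congr row_mx.
rewrite -{1}[T]mul1mx -E !mulmxDl -!mulmxA; congr (_ + _).
by rewrite [Y *m _]mulmxA YT -mulmxA YYR mulmx1.
Qed.

End ReversedCharPoly.

(** The exponent is the degree. *)
Lemma pow_rchar1_inj (F : fieldType) (b : F) m n :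
  b != 0 -> (1 - b *: 'X) ^+ m = (1 - b *: 'X) ^+ n -> m = n.
Proof.
move=> b0; have sz k : size ((1 - b *: 'X : {poly F}) ^+ k) = k.+1.
  have sz1 : size (1 - b *: 'X : {poly F}) = 2.
    by rewrite addrC size_polyDl ?size_polyN size_scale ?size_polyX // size_poly1.
  elim: k => [|k IH]; first by rewrite size_poly1.
  rewrite exprS size_mul ?sz1 ?IH //.
  - by rewrite -size_poly_eq0 sz1.
  - by rewrite -size_poly_eq0 IH.
by move=> E; have := sz m; rewrite E sz => -[].
Qed.

(** * Gradings as families of projections *)

Section Projections.
Variables (R : comNzRingType) (H : freeAlgebra R) (G : int -> set H).
Implicit Types M N : gmodule G.

(** The homogeneous projections of a graded module, and a finite set of degrees that
    contains its support. *)
Definition gsupp_proj M : seq int * (int -> 'M[R]_(mdim M)) :=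
  let: exist s sP := cid (grading_projections (gcomp_sum M)) in
  (s, projT1 (cid sP)).
Definition gsupp M := (gsupp_proj M).1.
Definition gproj M := (gsupp_proj M).2.

Lemma gproj_spec M :
  [/\ uniq (gsupp M), forall i v, gcomp M i (gproj M i *m v),
      \sum_(i <- gsupp M) gproj M i = 1%:M &
      forall i j v, gcomp M j v -> gproj M i *m v = if i == j then v else 0].
Proof.
by rewrite /gproj /gsupp /gsupp_proj; case: cid => s sP; case: (cid sP).
Qed.

Lemma gsupp_uniq M : uniq (gsupp M). Proof. by case: (gproj_spec M). Qed.

Lemma gproj_comp M i v : gcomp M i (gproj M i *m v).
Proof. by case: (gproj_spec M). Qed.

Lemma gproj_sum M : \sum_(i <- gsupp M) gproj M i = 1%:M.
Proof. by case: (gproj_spec M). Qed.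

Lemma gprojE M i j v : gcomp M j v -> gproj M i *m v = if i == j then v else 0.
Proof. by case: (gproj_spec M) => _ _ _; apply. Qed.

Lemma gcompP M i v : gcomp M i v <-> gproj M i *m v = v.
Proof. by split=> [/gprojE->|<-]; [rewrite eqxx | apply: gproj_comp]. Qed.

Lemma gprojM M i j : gproj M i *m gproj M j = if i == j then gproj M i else 0.
Proof.
apply: mulmx_cV_ext => v; rewrite -mulmxA (gprojE _ (gproj_comp j v)).
by case: eqP => [->|_]; rewrite ?mul0mx.
Qed.

Lemma gproj_ext M n (A B : 'M[R]_(n, mdim M)) :
  (forall k, A *m gproj M k = B *m gproj M k) -> A = B.
Proof.
move=> AB; rewrite -[A]mulmx1 -[B]mulmx1 -(gproj_sum M) !mulmx_sumr.
exact: eq_bigr.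
Qed.

Lemma gproj_extl M n (A B : 'M[R]_(mdim M, n)) :
  (forall k, gproj M k *m A = gproj M k *m B) -> A = B.
Proof.
move=> AB; rewrite -[A]mul1mx -[B]mul1mx -(gproj_sum M) !mulmx_suml.
exact: eq_bigr.
Qed.

(** In terms of projections: an element of degree [i] shifts degrees by [i]. *)
Lemma gproj_act M i j h :
  G i h -> mact M h *m gproj M j = gproj M (i + j) *m mact M h.
Proof.
move=> Gh; apply: gproj_ext => k; apply: mulmx_cV_ext => v.
rewrite -[_ *m _ *m gproj M k]mulmxA gprojM -!mulmxA.
have := gproj_comp k v; set u := gproj M k *m v => Mu.
rewrite (gprojE _ (gcomp_act Gh Mu)) (inj_eq (addrI i)).
by case: eqP => [->|_]; rewrite ?mul0mx ?mulmx0.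
Qed.

Lemma gproj_decomp M (v : 'cV_(mdim M)) : v = \sum_(i <- gsupp M) gproj M i *m v.
Proof. by rewrite -mulmx_suml gproj_sum mul1mx. Qed.

Lemma gproj_out M i : i \notin gsupp M -> gproj M i = 0.
Proof.
move=> iM; rewrite -[LHS]mulmx1 -(gproj_sum M) mulmx_sumr big1_seq // => j /= jM.
by rewrite gprojM; case: eqP jM iM => // -> ->.
Qed.

Lemma gmorphismP M N (X : 'M[R]_(mdim N, mdim M)) :
  is_gmorphism X <->
  is_umorphism X /\ forall i, X *m gproj M i = gproj N i *m X.
Proof.
split=> -[XH XP]; split=> // i; last first.
  by move=> v /gcompP Mv; apply/gcompP; rewrite mulmxA -XP -mulmxA Mv.
apply: gproj_ext => k; apply: mulmx_cV_ext => v.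
rewrite -!mulmxA (mulmxA (gproj M i)) gprojM.
rewrite (gprojE _ (XP _ _ (gproj_comp k v))).
by case: eqP => [->|_]; rewrite ?mul0mx ?mulmx0.
Qed.

Lemma is_gmorphism1 M : is_gmorphism (1%:M : 'M[R]_(mdim M)).
Proof. by apply/gmorphismP; split=> [h|i]; rewrite mul1mx mulmx1. Qed.

Lemma is_gmorphism_comp M N N' (X : 'M[R]_(mdim N, mdim M))
    (Y : 'M[R]_(mdim N', mdim N)) :
  is_gmorphism X -> is_gmorphism Y ->
  is_gmorphism (Y *m X : 'M[R]_(mdim N', mdim M)).
Proof.
move=> [XH XP] [YH YP]; split=> [h|i v Mv]; last by rewrite -mulmxA; auto.
by rewrite -mulmxA XH !mulmxA YH.
Qed.

Lemma is_umorphism_inv (V W : umodule H) (X : 'M[R]_(mdim W, mdim V)) Y :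
  is_umorphism X -> X *m Y = 1%:M -> Y *m X = 1%:M ->
  is_umorphism (Y : 'M[R]_(mdim V, mdim W)).
Proof.
move=> XH XY YX h.
by rewrite -[LHS]mulmx1 -XY mulmxA -(mulmxA Y) -XH mulmxA YX mul1mx.
Qed.

Lemma is_gmorphism_inv M N (X : 'M[R]_(mdim N, mdim M)) Y :
  is_gmorphism X -> X *m Y = 1%:M -> Y *m X = 1%:M ->
  is_gmorphism (Y : 'M[R]_(mdim M, mdim N)).
Proof.
move=> /gmorphismP[XH XP] XY YX; apply/gmorphismP; split.
  exact: is_umorphism_inv XH XY YX.
by move=> i; rewrite -[LHS]mulmx1 -XY mulmxA -(mulmxA Y) -XP mulmxA YX mul1mx.
Qed.

Lemma giso_refl M : giso M M.
Proof.
by exists 1%:M, 1%:M; rewrite mulmx1; split=> //; apply: is_gmorphism1.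
Qed.

Lemma giso_sym M N : giso M N -> giso N M.
Proof. by move=> [X [Y [? ? ? ?]]]; exists Y, X. Qed.

Lemma giso_trans M N N' : giso M N -> giso N N' -> giso M N'.
Proof.
move=> [X [Y [mX mY XY YX]]] [X' [Y' [mX' mY' XY' YX']]].
exists (X' *m X), (Y *m Y'); split.
- exact: is_gmorphism_comp.
- exact: is_gmorphism_comp.
- by rewrite -mulmxA (mulmxA X) XY mul1mx.
- by rewrite -mulmxA (mulmxA Y') YX' mul1mx.
Qed.

Lemma giso_uiso M N : giso M N -> uiso M N.
Proof. by move=> [X [Y [[? _] [? _] ? ?]]]; exists X, Y. Qed.

End Projections.

(** Gradings given by orthogonal idempotents. Sub-, quotient and direct sum gradings and
    lattices are built this way, since their idempotents are computed by matrix products. *)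
Section FromProjections.
Variables (R : comNzRingType) (H : freeAlgebra R) (G : int -> set H).
Variables (V : umodule H) (s : seq int) (P : int -> 'M[R]_(mdim V)).
Hypotheses (us : uniq s) (sumP : \sum_(i <- s) P i = 1%:M).
Hypothesis orthP : forall i j, P i *m P j = if i == j then P i else 0.
Hypothesis actP : forall i j h,
  G i h -> mact V h *m P j = P (i + j) *m mact V h.

Definition proj_comp i : set 'cV[R]_(mdim V) := [set v | P i *m v = v].

Lemma proj_comp_in i v : proj_comp i (P i *m v).
Proof. by rewrite /proj_comp /= mulmxA orthP eqxx. Qed.

Lemma proj_compE i j v : proj_comp j v -> P i *m v = if i == j then v else 0.
Proof.
by move=> <-; rewrite mulmxA orthP; case: eqP => [->|_]; rewrite ?mul0mx.
Qed.

Lemma proj_comp_sum : is_direct_sum proj_comp.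
Proof.
split=> [i|v|t c ut Cc c0 i it].
- split=> [|a u v]; first exact: mulmx0.
  by rewrite /proj_comp /= => Pu Pv; rewrite mulmxDr -scalemxAr Pu Pv.
- exists s, (fun i => P i *m v); split=> // [i|]; first exact: proj_comp_in.
  by rewrite -mulmx_suml sumP mul1mx.
have := congr1 (mulmx (P i)) c0; rewrite mulmx0 mulmx_sumr.
under eq_bigr do rewrite (proj_compE _ (Cc _)) eq_sym.
by rewrite -big_mkcond -big_filter filter_pred1_uniq // big_seq1.
Qed.

Lemma proj_comp_act i j h v :
  G i h -> proj_comp j v -> proj_comp (i + j) (mact V h *m v).
Proof. by move=> Gh Cv; rewrite /proj_comp /= mulmxA -actP // -mulmxA Cv. Qed.

Definition gmodule_of_proj : gmodule G :=
  GModule proj_comp_sum proj_comp_act.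

Lemma gproj_of_proj i : gproj gmodule_of_proj i = P i.
Proof.
apply: mulmx_cV_ext => v.
have -> : v = \sum_(j <- s) P j *m v by rewrite -mulmx_suml sumP mul1mx.
rewrite !mulmx_sumr; apply: eq_bigr => j _.
have Mj : gcomp gmodule_of_proj j (P j *m v) by apply: proj_comp_in.
by rewrite (gprojE _ Mj) (proj_compE _ (proj_comp_in j v)).
Qed.

End FromProjections.

Section GradedAlgebra.
Variables (R : comNzRingType) (H : freeAlgebra R) (G : int -> set H).

(** Being spanned by homogeneous elements passes to scalar extensions at once. *)
Definition graded_span : Prop :=
  (forall i, is_submodule (G i)) /\
  forall h, exists s : seq (int * H),
    (forall p, p \in s -> G p.1 p.2) /\ h = \sum_(p <- s) p.2.

Lemma graded_span_of : is_algebra_grading G -> graded_span.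
Proof.
move=> [[sub dec _] _]; split=> // h; have [s [c [_ Gc ->]]] := dec h.
exists [seq (i, c i) | i <- s]; rewrite big_map; split=> // p.
by move=> /mapP[i _ ->].
Qed.

Hypothesis gG : graded_span.

(** [e0] is the degree 0 component of [e]: the others move [M_i] to another component,
    which the projection kills. *)
Lemma degree0_part (e : H) : exists2 e0, G 0 e0 &
  forall (M : gmodule G) i,
    gproj M i *m mact M e *m gproj M i = mact M e0 *m gproj M i.
Proof.
have [s [Gs ->]] := gG.2 e; exists (\sum_(p <- s | p.1 == 0) p.2).
  rewrite big_seq_cond; elim/big_ind: _ => [|x y Gx Gy|p].
  - exact: (gG.1 0).1.
  - exact: (is_submoduleD (gG.1 0)).
  - by move=> /andP[/Gs Gp /eqP <-].
move=> M i; rewrite (linear_sum (mact M)) [in RHS](linear_sum (mact M)) /=.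
rewrite mulmx_sumr !mulmx_suml.
rewrite [RHS]big_mkcond big_seq [RHS]big_seq; apply: eq_bigr => p /Gs Gp.
rewrite -mulmxA (gproj_act _ _ Gp) mulmxA gprojM.
case: (altP (p.1 =P 0)) Gp => [->|p0] Gp.
  by rewrite add0r eqxx; have := gproj_act M i Gp; rewrite add0r.
rewrite ifN ?mul0mx //; apply: contra p0 => /eqP ii.
by apply/eqP/(@addIr _ i); rewrite add0r.
Qed.

End GradedAlgebra.

(** * Submodules, quotients and composition series *)

Section SubQuotient.
Variables (R : comNzRingType) (H : freeAlgebra R) (G : int -> set H).
Variable M : gmodule G.

Section Sub.
Variables (a : nat) (X : 'M[R]_(mdim M, a)) (XL : 'M[R]_(a, mdim M)).
Hypothesis XLX : XL *m X = 1%:M.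
Hypothesis actX : forall h, mact M h *m X = X *m (XL *m (mact M h *m X)).
Hypothesis projX : forall i, gproj M i *m X = X *m (XL *m (gproj M i *m X)).

Definition sub_act : {linear H -> 'M[R]_a} :=
  (mulmx XL) \o (mulmxr X) \o (mact M).

Lemma sub_act1 : sub_act fa_one = 1%:M.
Proof. by rewrite /sub_act /= (mact1 M) mul1mx. Qed.

Lemma sub_actM x y : sub_act (fa_mul x y) = sub_act x *m sub_act y.
Proof.
by rewrite /sub_act /= (mactM M) -mulmxA [in LHS](actX y) !mulmxA.
Qed.

Definition sub_umodule : umodule H := UModule sub_act1 sub_actM.

Definition sub_proj i : 'M[R]_(mdim sub_umodule) := XL *m (gproj M i *m X).

Lemma sub_proj_sum : \sum_(i <- gsupp M) sub_proj i = 1%:M.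
Proof. by rewrite /sub_proj -mulmx_sumr -mulmx_suml gproj_sum mul1mx. Qed.

Lemma sub_proj_orth i j :
  sub_proj i *m sub_proj j = if i == j then sub_proj i else 0.
Proof.
rewrite /sub_proj -!mulmxA -projX (mulmxA (gproj M i)) gprojM.
by case: eqP => // _; rewrite mul0mx mulmx0.
Qed.

Lemma sub_proj_act i j h : G i h ->
  mact sub_umodule h *m sub_proj j = sub_proj (i + j) *m mact sub_umodule h.
Proof.
move=> Gh; rewrite /sub_proj /= /sub_act /= -!mulmxA -projX -actX.
by rewrite (mulmxA (mact M h)) (gproj_act _ _ Gh) !mulmxA.
Qed.

Definition sub_gmodule : gmodule G :=
  gmodule_of_proj (gsupp_uniq M) sub_proj_sum sub_proj_orth sub_proj_act.

Lemma sub_gmorphism : is_gmorphism (X : 'M[R]_(mdim M, mdim sub_gmodule)).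
Proof.
apply/gmorphismP; split=> [h|i]; first by rewrite actX.
by rewrite gproj_of_proj -projX.
Qed.

End Sub.

Section Quot.
Variables (b : nat) (Y : 'M[R]_(b, mdim M)) (YR : 'M[R]_(mdim M, b)).
Hypothesis YYR : Y *m YR = 1%:M.
Hypothesis actY : forall h, Y *m mact M h = Y *m mact M h *m YR *m Y.
Hypothesis projY : forall i, Y *m gproj M i = Y *m gproj M i *m YR *m Y.

Definition quot_act : {linear H -> 'M[R]_b} :=
  (mulmxr YR) \o (mulmx Y) \o (mact M).

Lemma quot_act1 : quot_act fa_one = 1%:M.
Proof. by rewrite /quot_act /= (mact1 M) mulmx1. Qed.

Lemma quot_actM x y : quot_act (fa_mul x y) = quot_act x *m quot_act y.
Proof. by rewrite /quot_act /= (mactM M) !mulmxA -actY. Qed.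

Definition quot_umodule : umodule H := UModule quot_act1 quot_actM.

Definition quot_proj i : 'M[R]_(mdim quot_umodule) := Y *m gproj M i *m YR.

Lemma quot_proj_sum : \sum_(i <- gsupp M) quot_proj i = 1%:M.
Proof. by rewrite /quot_proj -mulmx_suml -mulmx_sumr gproj_sum mulmx1. Qed.

Lemma quot_proj_orth i j :
  quot_proj i *m quot_proj j = if i == j then quot_proj i else 0.
Proof.
rewrite /quot_proj !mulmxA -projY -(mulmxA Y _ (gproj M j)) gprojM.
by case: eqP => // _; rewrite mulmx0 mul0mx.
Qed.

Lemma quot_proj_act i j h : G i h ->
  mact quot_umodule h *m quot_proj j = quot_proj (i + j) *m mact quot_umodule h.
Proof.
move=> Gh; rewrite /quot_proj /= /quot_act /= !mulmxA -projY -actY.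
by rewrite -(mulmxA Y _ (gproj M j)) (gproj_act _ _ Gh) !mulmxA.
Qed.

Definition quot_gmodule : gmodule G :=
  gmodule_of_proj (gsupp_uniq M) quot_proj_sum quot_proj_orth quot_proj_act.

Lemma quot_gmorphism : is_gmorphism (Y : 'M[R]_(mdim quot_gmodule, mdim M)).
Proof.
apply/gmorphismP; split=> [h|i]; first exact: actY.
by rewrite gproj_of_proj; apply: projY.
Qed.

End Quot.
End SubQuotient.

Section FieldModules.
Variables (F : fieldType) (H : freeAlgebra F) (G : int -> set H).
Implicit Types M N : gmodule G.

(** Among the matrices with all rows in [U] one of maximal rank spans [U]. *)
Lemma subspace_splitting n (U : set 'cV[F]_n) : is_submodule U ->
  exists a b (X : 'M[F]_(n, a)) XL (Y : 'M[F]_(b, n)) YR,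
    is_splitting X XL Y YR /\ forall v, U v <-> exists w, v = X *m w.
Proof.
move=> subU.
(* Row spaces are used, hence the transposes. *)
pose P r := `[< exists B : 'M[F]_n, \rank B = r /\
                  forall v : 'cV_n, (v^T <= B)%MS -> U v >].
have exP : exists r, P r.
  exists 0; apply/asboolP; exists 0; rewrite mxrank0; split=> // v.
  by move=> /submx0null /(congr1 trmx); rewrite trmxK trmx0 => ->; apply: subU.1.
have leP r : P r -> (r <= n)%N by move=> /asboolP[B [<- _]]; apply: rank_leq_row.
case: (ex_maxnP exP leP) => r /asboolP[B [rB UB]] maxr.
have UE v : U v <-> (v^T <= B)%MS.
  split=> [Uv|]; last exact: UB.
  have PB : P (\rank (B + <<v^T>>)%MS).
    apply/asboolP; exists (B + <<v^T>>)%MS; split=> // w.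
    move=> /sub_addsmxP[[x y] /= E].
    have -> : w = 1 *: (x *m B)^T + (y *m <<v^T>>%MS)^T.
      by rewrite scale1r -[LHS]trmxK E linearD.
    apply: subU.2; first by apply: UB; rewrite trmxK submxMl.
    have /sub_rVP[c ->] : (y *m <<v^T>>%MS <= v^T)%MS.
      by rewrite -(genmxE v^T) submxMl.
    by rewrite linearZ /= trmxK; apply: (is_submoduleZ subU).
  have /eqP E : \rank B == \rank (B + <<v^T>>)%MS.
    by rewrite eqn_leq mxrankS ?addsmxSl // rB maxr.
  have := mxrank_leqif_sup (addsmxSl B <<v^T>>%MS) => -[_]; rewrite E eqxx.
  by move=> /esym; rewrite addsmx_sub genmxE => /andP[].
pose Z := col_mx (row_base B) (row_base (B^C)%MS).
have fullZ : row_full Z.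
  rewrite -sub1mx /Z -addsmxE (adds_eqmx (eq_row_base B) (eq_row_base (B^C)%MS)).
  by rewrite sub1mx addsmx_compl_full.
have freeZ : row_free Z.
  rewrite /row_free (eqP fullZ) mxrank_compl subnKC //; exact: rank_leq_col.
pose W := pinvmx Z.
have ZW : Z *m W = 1%:M by apply: mulmxVp.
have WZ : W *m Z = 1%:M by apply: mulVpmx.
exists (\rank B), (\rank (B^C)%MS), (row_base B)^T, (lsubmx W)^T, (rsubmx W)^T,
  (row_base (B^C)%MS)^T; split; first split.
- rewrite -trmx_mul; have := congr1 ulsubmx ZW.
  rewrite -[W]hsubmxK mul_col_row block_mxKul hsubmxK => ->.
  by rewrite scalar_mx_block block_mxKul trmx1.
- rewrite -trmx_mul; have := congr1 drsubmx ZW.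
  rewrite -[W]hsubmxK mul_col_row block_mxKdr hsubmxK => ->.
  by rewrite scalar_mx_block block_mxKdr trmx1.
- rewrite -!trmx_mul -linearD /= -[RHS]trmx1 -WZ; congr trmx.
  by rewrite -[W in RHS]hsubmxK mul_row_col.
move=> v; rewrite UE -(eq_row_base B); split=> [/submxP[w E]|[w ->]].
  by exists w^T; rewrite -trmx_mul -E trmxK.
by rewrite trmx_mul trmxK submxMl.
Qed.

Lemma graded_submodule_proj M U : graded_submodule (M := M) U ->
  forall i v, U v -> U (gproj M i *m v).
Proof.
move=> [[subU _] gU] i v /gU[s [c [Uc ->]]]; rewrite mulmx_sumr.
apply: (is_submodule_sum subU) => k; rewrite (gprojE _ (Uc k).2).
by case: eqP => _; [exact: (Uc k).1 | exact: subU.1].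
Qed.

Lemma graded_submoduleI M (U : set 'cV_(mdim M)) :
  stable_submodule (V := M) U -> (forall i v, U v -> U (gproj M i *m v)) ->
  graded_submodule (M := M) U.
Proof.
move=> sU gU; split=> // v Uv; exists (gsupp M), (fun i => gproj M i *m v).
split=> [i|]; last exact: gproj_decomp.
by split; [exact: gU | exact: gproj_comp].
Qed.

Lemma gexactI (M' M M'' : gmodule G) (X : 'M_(mdim M, mdim M')) XL
    (Y : 'M_(mdim M'', mdim M)) YR :
  is_gmorphism X -> is_gmorphism Y -> is_splitting X XL Y YR -> gexact M' M M''.
Proof.
move=> mX mY S; have YX := splitting0 S; have [XLX YYR E] := S.
exists X, Y; split=> // [v Xv|w|u].
- by rewrite -[v]mul1mx -XLX -mulmxA Xv mulmx0.
- split=> [Yw|[v ->]]; last by rewrite mulmxA YX mul0mx.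
  exists (XL *m w); rewrite mulmxA -[LHS]mul1mx -E mulmxDl -(mulmxA YR) Yw.
  by rewrite mulmx0 addr0.
- by exists (YR *m u); rewrite mulmxA YYR mul1mx.
Qed.

Lemma gexact_splitting (M' M M'' : gmodule G) : gexact M' M M'' ->
  exists (X : 'M_(mdim M, mdim M')) XL (Y : 'M_(mdim M'', mdim M)) YR,
    [/\ is_gmorphism X, is_gmorphism Y & is_splitting X XL Y YR].
Proof.
move=> [X [Y [mX mY injX exY surjY]]].
have /choice[r rP] : forall k, exists w : 'cV_(mdim M), delta_mx k 0 = Y *m w.
  by move=> k; apply: surjY.
pose YR : 'M_(mdim M, mdim M'') := \matrix_(i, k) r k i 0.
have YYR : Y *m YR = 1%:M.
  apply/matrixP => i k; have /colP/(_ i) := rP k; rewrite !mxE andbT => ->.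
  by apply: eq_bigr => l _; rewrite !mxE.
have /choice[q qP] : forall k, exists v, col k (1%:M - YR *m Y) = X *m v.
  move=> k; apply/exY; rewrite colE mulmxA mulmxBr mulmx1 mulmxA YYR mul1mx.
  by rewrite subrr mul0mx.
pose XL : 'M_(mdim M', mdim M) := \matrix_(i, k) q k i 0.
have XXL : X *m XL = 1%:M - YR *m Y.
  apply/matrixP => i k; have /colP/(_ i) := qP k; rewrite mxE => ->.
  by rewrite !mxE; apply: eq_bigr => l _; rewrite !mxE.
exists X, XL, Y, YR; split=> //; split=> //; last by rewrite XXL subrK.
apply: mulmx_cV_ext => v; apply/eqP; rewrite -subr_eq0; apply/eqP/injX.
rewrite mulmxBr mul1mx !mulmxA XXL mulmxBl mul1mx mulmxBl.
have -> : YR *m Y *m X *m v = 0.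
  by rewrite -!mulmxA (_ : Y *m _ = 0) ?mulmx0 //; apply/exY; exists v.
by rewrite subr0 subrr.
Qed.

Lemma gexact_dim (M' M M'' : gmodule G) :
  gexact M' M M'' -> (mdim M' + mdim M'')%N = mdim M.
Proof.
by move=> /gexact_splitting[X [XL [Y [YR [_ _ S]]]]]; apply: splitting_dim S.
Qed.

(** The submodule and the quotient are realised on bases given by
    [subspace_splitting]. *)
Lemma graded_submodule_exact M (U : set 'cV_(mdim M)) :
  graded_submodule (M := M) U ->
  exists (M' M'' : gmodule G) (X : 'M_(mdim M, mdim M')) XL
      (Y : 'M_(mdim M'', mdim M)) YR,
    [/\ is_gmorphism X, is_gmorphism Y, is_splitting X XL Y YR &
        forall v, U v <-> exists w, v = X *m w].
Proof.
move=> gU; have [[subU actU] _] := gU; have projU := graded_submodule_proj gU.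
have [a [b [X [XL [Y [YR [S UX]]]]]]] := subspace_splitting subU.
have YX := splitting0 S; have [XLX YYR E] := S.
have stab (T : 'M_(mdim M)) : (forall v, U v -> U (T *m v)) ->
    T *m X = X *m (XL *m (T *m X)).
  move=> TU; apply: mulmx_cV_ext => w; rewrite -!mulmxA.
  have /UX[z ->] : U (T *m (X *m w)) by apply/TU/UX; exists w.
  by rewrite (mulmxA XL) XLX mul1mx.
have costab (T : 'M_(mdim M)) : (forall v, U v -> U (T *m v)) ->
    Y *m T = Y *m T *m YR *m Y.
  move=> /stab TX; rewrite -[LHS]mulmx1 -E mulmxDr -!mulmxA (mulmxA T X) TX.
  by rewrite !mulmxA YX !mul0mx add0r.
have actX h := stab _ (actU h); have projX i := stab _ (projU i).
have actY h := costab _ (actU h); have projY i := costab _ (projU i).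
exists (sub_gmodule XLX actX projX), (quot_gmodule YYR actY projY), X, XL, Y, YR.
by split=> //; [apply: sub_gmorphism | apply: quot_gmorphism].
Qed.

Lemma kernel_graded_submodule M N (Y : 'M_(mdim N, mdim M)) :
  is_gmorphism Y -> graded_submodule (M := M) [set v | Y *m v = 0].
Proof.
move=> /gmorphismP[YH YP]; apply: graded_submoduleI.
  split=> [|h v /= Yv]; last by rewrite mulmxA YH -mulmxA Yv mulmx0.
  split=> [|a u v /= Yu Yv]; first exact: mulmx0.
  by rewrite mulmxDr -scalemxAr Yu Yv scaler0 addr0.
by move=> i v /= Yv; rewrite mulmxA YP -mulmxA Yv mulmx0.
Qed.

Lemma surjective_gexact M N (Y : 'M_(mdim N, mdim M)) :
  is_gmorphism Y -> (forall u : 'cV_(mdim N), exists w, u = Y *m w) ->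
  exists M', gexact M' M N.
Proof.
move=> mY surjY.
have [M' [M'' [X [XL [_ [_ [mX _ [XLX _ _] XU]]]]]]] :=
  graded_submodule_exact (kernel_graded_submodule mY).
exists M', X, Y; split=> // v Xv.
by rewrite -[v]mul1mx -XLX -mulmxA Xv mulmx0.
Qed.

Definition gzero M := forall v : 'cV[F]_(mdim M), v = 0.

Lemma not_gzero M : ~ gzero M -> exists v : 'cV[F]_(mdim M), v != 0.
Proof. by move=> /existsNP[v /eqP]; exists v. Qed.

Lemma gzero_dim M : mdim M = 0%N -> gzero M.
Proof. by move=> M0 v; apply/colP => i; have := ltn_ord i; rewrite {2}M0. Qed.

(** A nonzero quotient of least dimension is simple; induction applies to the kernel. *)
Lemma gseries_exists M : exists s, gseries M s.
Proof.
have [n] := ubnP (mdim M); elim: n M => // n IH M /ltnSE leMn.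
have [M0|M0] := pselect (gzero M); first by exists [::]; constructor.
pose P d := `[< exists N (Y : 'M_(mdim N, mdim M)), [/\ mdim N = d, ~ gzero N,
    is_gmorphism Y & forall u : 'cV_(mdim N), exists w, u = Y *m w] >].
have exP : exists d, P d.
  exists (mdim M); apply/asboolP; exists M, 1%:M; split=> //.
    exact: is_gmorphism1.
  by move=> u; exists u; rewrite mul1mx.
case: (ex_minnP exP) => d /asboolP[S [Y [dS S0 mY surjY]]] mind.
have simpleS : gsimple S.
  split=> [|U gU]; first exact: not_gzero.
  have [S' [S'' [X [XL [Z [ZR [mX mZ Sp UX]]]]]]] := graded_submodule_exact gU.
  have [XLX ZZR E] := Sp.
  have [S''0|S''0] := pselect (gzero S'').
    right; apply/seteqP; split=> // v _; apply/UX; exists (XL *m v).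
    by rewrite mulmxA -[LHS]mul1mx -E mulmxDl -(mulmxA ZR) [Z *m v]S''0 mulmx0 addr0.
  have le_d : (d <= mdim S'')%N.
    apply: mind; apply/asboolP; exists S'', (Z *m Y); split=> //.
      exact: is_gmorphism_comp.
    move=> u; have [w E'] := surjY (ZR *m u); exists w.
    by rewrite -mulmxA -E' mulmxA ZZR mul1mx.
  have S'0 : mdim S' = 0%N.
    have := splitting_dim Sp; move: le_d; rewrite -dS; lia.
  left; apply/seteqP; split=> v /=; first by move=> /UX[w ->]; rewrite [w]gzero_dim // mulmx0.
  by move=> ->; exact: gU.1.1.1.
have [M' ex] := surjective_gexact mY surjY.
have [|s Ms] := IH M'.
  apply: leq_trans leMn; rewrite -(gexact_dim ex) -{1}[mdim M']addn0 ltn_add2l.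
  by rewrite lt0n; apply/eqP => /gzero_dim.
by exists (S :: s); apply: GSeriesCons Ms.
Qed.

Lemma bijective_mx n m (X : 'M[F]_(n, m)) :
  (forall v : 'cV_m, X *m v = 0 -> v = 0) -> (forall u : 'cV_n, exists w, u = X *m w) ->
  exists Y, X *m Y = 1%:M /\ Y *m X = 1%:M.
Proof.
move=> injX surjX.
have /choice[r rP] : forall k, exists w : 'cV_m, delta_mx k 0 = X *m w.
  by move=> k; apply: surjX.
pose Y : 'M_(m, n) := \matrix_(i, k) r k i 0.
have XY : X *m Y = 1%:M.
  apply/matrixP => i k; have /colP/(_ i) := rP k; rewrite !mxE andbT => ->.
  by apply: eq_bigr => l _; rewrite !mxE.
exists Y; split=> //; apply: mulmx_cV_ext => v.
apply/eqP; rewrite -subr_eq0; apply/eqP/injX.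
by rewrite mulmxBr mul1mx !mulmxA XY mul1mx subrr.
Qed.

Lemma schur (V W : umodule H) (X : 'M_(mdim W, mdim V)) :
  usimple V -> usimple W -> is_umorphism X -> X <> 0 ->
  exists Y, X *m Y = 1%:M /\ Y *m X = 1%:M.
Proof.
move=> [_ sV] [_ sW] mX X0; apply: bijective_mx.
  have [|K|K] := sV [set v | X *m v = 0].
  - split=> [|h v /= Xv]; last by rewrite mulmxA mX -mulmxA Xv mulmx0.
    split=> [|a u v /= Xu Xv]; first exact: mulmx0.
    by rewrite mulmxDr -scalemxAr Xu Xv scaler0 addr0.
  - by move=> v Xv; have : [set v | X *m v = 0] v by []; rewrite K.
  - case: X0; apply: mulmx_cV_ext => v; rewrite mul0mx.
    by have : [set v | X *m v = 0] v by rewrite K.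
have [|K|K] := sW [set u | exists v, u = X *m v].
- split=> [|h _ [v ->]]; last by exists (mact V h *m v); rewrite !mulmxA mX.
  split=> [|a _ _ [u ->] [v ->]]; first by exists 0; rewrite mulmx0.
  by exists (a *: u + v); rewrite mulmxDr -scalemxAr.
- case: X0; apply: mulmx_cV_ext => v; rewrite mul0mx.
  have : [set u | exists v, u = X *m v] (X *m v) by exists v.
  by rewrite K.
- by move=> u; have : [set u | exists v, u = X *m v] u by rewrite K.
Qed.

Lemma gsupp_bound M :
  exists N : nat, forall i, i \in gsupp M -> ((- N%:Z <= i) && (i < N%:Z))%R.
Proof.
elim: (gsupp M) => [|i s [N NP]]; first by exists 0%N.
exists (maxn N `|i|.+1)%N => j; rewrite inE => /orP[/eqP ->|/NP]; lia.
Qed.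

Lemma usimple_gsimple M : usimple M -> gsimple M.
Proof. by move=> [? sM]; split=> // U [gU _]; apply: sM. Qed.

Import Order.TTheory Num.Theory.

(** For an ungraded submodule [U], the top homogeneous components of the elements of
    [U] span a graded submodule [L]. It is nonzero when [U] is, so it is everything;
    then any vector can be reduced modulo [U], one degree after the other, to zero. *)
Lemma gsimple_usimple M : graded_span G -> gsimple M -> usimple M.
Proof.
move=> gG [M0 sM]; split=> // U sU; have [subU actU] := sU.
have [U0|] := pselect (forall v, U v -> v = 0).
  left; apply/seteqP; split=> v /=; first exact: U0.
  by move=> ->; apply: subU.1.
move=> /existsNP[u0 /not_implyP[Uu0 /eqP u00]]; right.
pose Lead i w := exists u, [/\ U u, w = gproj M i *m u &
  forall j, i < j -> gproj M j *m u = 0].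
have Lead_sub i : is_submodule (Lead i).
  split=> [|a _ _ [u [Uu -> tu]] [v [Uv -> tv]]].
    by exists 0; rewrite mulmx0; split=> // [|j _]; [exact: subU.1 | rewrite mulmx0].
  exists (a *: u + v); split=> [||j ij].
  - exact: subU.2.
  - by rewrite mulmxDr -scalemxAr.
  - by rewrite mulmxDr -scalemxAr tu // tv // scaler0 addr0.
pose L := [set v | forall i, Lead i (gproj M i *m v)].
have [] : L = [set 0] \/ L = setT.
- apply: sM; apply: graded_submoduleI.
    split=> [|h v Lv i].
      split=> [i|a u v Lu Lv i]; first by rewrite mulmx0; exact: (Lead_sub i).1.
      by rewrite mulmxDr -scalemxAr; apply: (Lead_sub i).2.
    have [s [Gs ->]] := gG.2 h; rewrite linear_sum mulmx_suml mulmx_sumr /=.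
    rewrite big_seq; elim/big_ind: _ => [|x y|p ps].
    - exact: (Lead_sub i).1.
    - exact: (is_submoduleD (Lead_sub i)).
    - have Gp := Gs _ ps; have E k : gproj M k *m mact M p.2 =
          mact M p.2 *m gproj M (k - p.1).
        by rewrite (gproj_act _ _ Gp) addrC subrK.
      rewrite mulmxA E -mulmxA; have [u [Uu -> tu]] := Lv (i - p.1).
      exists (mact M p.2 *m u); split=> [||j ij].
      + exact: actU.
      + by rewrite !mulmxA E.
      + by rewrite mulmxA E -mulmxA tu ?mulmx0 // ltrD2r.
  move=> i v Lv j; rewrite mulmxA gprojM; case: eqP => // _.
  by rewrite mul0mx; exact: (Lead_sub j).1.
(* If L were 0, every element of U would vanish: its components do, from the top. *)
- move=> L0; case/eqP: u00; have [N NP] := gsupp_bound M.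
  have key n u : U u -> (forall j, (- N%:Z) + n%:Z <= j -> gproj M j *m u = 0) ->
      u = 0.
    elim: n u => [|n IH] u Uu tu.
      rewrite (gproj_decomp u) big1_seq // => i /= /NP/andP[Ni _].
      by apply: tu; rewrite addr0.
    apply: IH => // j; rewrite le_eqVlt => /orP[/eqP <-|nj]; last first.
      apply: tu; lia.
    set i := _ + _; have : L (gproj M i *m u).
      move=> k; rewrite mulmxA gprojM; case: eqP => [->|_].
        exists u; split=> // l il; apply: tu; move: il; rewrite /i; lia.
      by rewrite mul0mx; exact: (Lead_sub k).1.
    by rewrite L0.
  apply: (key (N + N)%N) => // j; rewrite PoszD addKr => Nj.
  rewrite gproj_out ?mul0mx //; apply/negP => /NP/andP[_].
  by rewrite ltNge Nj.
- move=> LT; have [N NP] := gsupp_bound M.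
  have key n v : (forall j, (- N%:Z) + n%:Z <= j -> gproj M j *m v = 0) -> U v.
    elim: n v => [|n IH] v tv.
      rewrite (_ : v = 0); first exact: subU.1.
      rewrite (gproj_decomp v) big1_seq // => i /= /NP/andP[Ni _].
      by apply: tv; rewrite addr0.
    pose i := - N%:Z + n%:Z; have : L v by rewrite LT.
    move=> /(_ i)[u [Uu iv tu]]; rewrite -[v](subrK u) addrC -[u]scale1r.
    apply: subU.2 => //; rewrite scale1r; apply: IH => j.
    rewrite mulmxBr le_eqVlt => /orP[/eqP <-|ij]; first by rewrite iv subrr.
    rewrite tu // tv ?subrr //.
    lia.
  apply/seteqP; split=> // v _; apply: (key (N + N)%N) => j.
  rewrite PoszD addKr => Nj; rewrite gproj_out ?mul0mx //.
  by apply/negP => /NP/andP[_]; rewrite ltNge Nj.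
Qed.

End FieldModules.

(** * Graded characters, and the elements that detect a simple module *)

Section GradedChar.
Variables (R : comNzRingType) (H : freeAlgebra R) (G : int -> set H).
Implicit Types M N : gmodule G.

(** For [h] of degree 0, the determinant of 1 - X h on the component of degree [i]. *)
Definition gchar M h i : {poly R} := rchar (mact M h *m gproj M i).

Lemma gproj_unique M i (A : 'M_(mdim M)) :
  (forall k v, gcomp M k v -> A *m v = if i == k then v else 0) -> gproj M i = A.
Proof.
move=> AP; apply: gproj_ext => k; apply: mulmx_cV_ext => v.
rewrite -!mulmxA; have Mv := gproj_comp k v.
by rewrite (AP _ _ Mv) (gprojE _ Mv).
Qed.

Lemma gproj_shift M j i : gproj (gshift M j) i = gproj M (i - j).
Proof.
apply: gproj_unique => k v Mv; rewrite (gprojE (M := M) (i - j) (j := k - j) Mv).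
by rewrite (inj_eq (addIr (- j))).
Qed.

Lemma gchar_shift M j h i : gchar (gshift M j) h i = gchar M h (i - j).
Proof. by rewrite /gchar gproj_shift. Qed.

Lemma gchar_giso M N h i : giso M N -> gchar M h i = gchar N h i.
Proof.
move=> [X [Y [_ /gmorphismP[YH YP] XY YX]]].
by apply: (rchar_conj YX XY); rewrite -mulmxA -YP !mulmxA YH.
Qed.

Lemma is_umorphism_span M N (X : 'M_(mdim N, mdim M)) : graded_span G ->
  (forall c h, G c h -> X *m mact M h = mact N h *m X) -> is_umorphism X.
Proof.
move=> gG XG h; have [s [Gs ->]] := gG.2 h.
rewrite (linear_sum (mact M)) (linear_sum (mact N)) mulmx_sumr mulmx_suml.
by rewrite big_seq [RHS]big_seq; apply: eq_bigr => p /Gs /XG.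
Qed.

Lemma gshift_gsimple M j : gsimple M -> gsimple (gshift M j).
Proof.
move=> [M0 sM]; split=> // U [sU gU]; apply: sM; split=> // v /gU[s [c [Uc ->]]].
exists [seq i - j | i <- s], (fun i => c (i + j)); split=> [i|].
  by have [Ui Ci] := Uc (i + j); split=> //; move: Ci; rewrite /= /shift_comp addrK.
by rewrite big_map; apply: eq_bigr => i _; rewrite subrK.
Qed.

End GradedChar.

Section GradedCharField.
Variables (F : fieldType) (H : freeAlgebra F) (G : int -> set H).
Implicit Types M N : gmodule G.

Lemma gchar_exact (M' M M'' : gmodule G) h i :
  gexact M' M M'' -> gchar M h i = gchar M' h i * gchar M'' h i.
Proof.
move=> /gexact_splitting[X [XL [Y [YR [mX mY S]]]]].
move: mX mY => /gmorphismP[XH XP] /gmorphismP[YH YP].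
apply: (rchar_split S); first by rewrite -mulmxA -XP !mulmxA XH.
by rewrite mulmxA YH -!mulmxA YP.
Qed.

Lemma gseries_gsimple M s : gseries M s -> forall S, S \in s -> gsimple S.
Proof.
elim=> // M' M1 S s1 _ sS _ IH N; rewrite inE => /orP[/eqP ->|] //.
exact: IH.
Qed.

Lemma gchar_gzero M h i : gzero M -> gchar M h i = 1.
Proof.
move=> M0; rewrite /gchar (_ : mact M h *m gproj M i = 0) ?rchar0 //.
by apply: mulmx_cV_ext => v; rewrite mul0mx; apply: M0.
Qed.

Lemma gchar_gseries M s h i :
  gseries M s -> gchar M h i = \prod_(S <- s) gchar S h i.
Proof.
elim=> [M0 M00|M' M1 S s1 ex _ _ IH]; first by rewrite big_nil gchar_gzero.
by rewrite big_cons (gchar_exact _ _ ex) IH mulrC.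
Qed.

End GradedCharField.

Section Density.
Variables (F : fieldType) (H : freeAlgebra F).
Implicit Types V W : umodule H.

Definition left_ideal (J : set H) :=
  is_submodule J /\ forall h j, J j -> J (fa_mul h j).

Definition transitive_at (J : set H) W (s : 'cV_(mdim W)) :=
  forall w, exists2 j, J j & mact W j *m s = w.

Definition annihilator (J : set H) V (l : seq 'I_(mdim V)) : set H :=
  [set j | J j /\ forall k, k \in l -> mact V j *m delta_mx k 0 = 0 :> 'cV_(mdim V)].

Lemma annihilator_left_ideal J V l : left_ideal J -> left_ideal (@annihilator J V l).
Proof.
move=> [subJ mulJ]; split=> [|h j [Jj jl]]; last first.
  by split=> [|k kl]; [exact: mulJ | rewrite (mactM V) -mulmxA jl ?mulmx0].
split=> [|a u v [Ju ul] [Jv vl]]; first split=> [|k kl]; first exact: subJ.1.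
  by rewrite linear0 mul0mx.
split=> [|k kl]; first exact: subJ.2.
by rewrite linearP mulmxDl -scalemxAl ul // vl // scaler0 addr0.
Qed.

Lemma simple_transitive J W s : usimple W -> left_ideal J ->
  (exists2 j, J j & mact W j *m s != 0) -> @transitive_at J W s.
Proof.
move=> [_ sW] [subJ mulJ] [j0 Jj0 j0s].
have [|E|E] := sW [set w | exists2 j, J j & mact W j *m s = w].
- split=> [|h _ [j Jj <-]]; last first.
    by exists (fa_mul h j); [exact: mulJ | rewrite (mactM W) mulmxA].
  split=> [|a _ _ [u Ju <-] [v Jv <-]].
    by exists 0; [exact: subJ.1 | rewrite linear0 mul0mx].
  exists (a *: u + v); first exact: subJ.2.
  by rewrite linearP mulmxDl -scalemxAl.
- have : [set w | exists2 j, J j & mact W j *m s = w] (mact W j0 *m s).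
    by exists j0.
  by rewrite E /= => /eqP; rewrite (negbTE j0s).
- by move=> w; have : [set w | exists2 j, J j & mact W j *m s = w] w by rewrite E.
Qed.

(** The map j n |-> j s is well defined on [J n] = [V]. *)
Lemma transitive_hom J V W (n : 'cV_(mdim V)) (s : 'cV_(mdim W)) :
  left_ideal J -> transitive_at J n ->
  (forall j, J j -> mact V j *m n = 0 -> mact W j *m s = 0) ->
  exists2 X : 'M_(mdim W, mdim V), is_umorphism X &
    forall j, J j -> mact W j *m s = X *m (mact V j *m n).
Proof.
move=> [subJ mulJ] tJ annJ.
have /choice[g gP] : forall k, exists j, J j /\ mact V j *m n = delta_mx k 0.
  by move=> k; have [j Jj E] := tJ (delta_mx k 0); exists j.
pose X : 'M_(mdim W, mdim V) := \matrix_(i, k) (mact W (g k) *m s) i 0.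
have XE j : J j -> mact W j *m s = X *m (mact V j *m n).
  move=> Jj; pose u := mact V j *m n; pose j' := \sum_k u k 0 *: g k.
  have Jj' : J j'.
    apply: (is_submodule_sum subJ) => k; apply: (is_submoduleZ subJ).
    by case: (gP k).
  have E : mact V j' *m n = u.
    rewrite linear_sum mulmx_suml [u in RHS]matrix_sum_delta.
    apply: eq_bigr => k _ /=; rewrite big_ord1 linearZ /= -scalemxAl.
    by case: (gP k) => _ ->.
  have := annJ (- 1 *: j' + j) (subJ.2 _ _ _ Jj' Jj).
  rewrite !linearP !mulmxDl -!scalemxAl E scaleN1r addNr => /(_ erefl)/eqP.
  rewrite scaleN1r addrC subr_eq0 => /eqP ->.
  rewrite linear_sum mulmx_suml mulmx_colE; apply: eq_bigr => k _ /=.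
  rewrite linearZ /= -scalemxAl; congr (_ *: _); apply/colP => i.
  by rewrite !mxE.
exists X => // h; apply: mulmx_cV_ext => v.
have [j Jj <-] := tJ v; rewrite -[RHS]mulmxA -XE // [RHS]mulmxA -(mactM W).
by rewrite XE ?(mactM V) ?mulmxA //; apply: mulJ.
Qed.

(** One basis vector [n] of [V] after the other: were no element of the annihilator
    of the earlier ones that kills [n] to move [s], then [transitive_hom] would
    give a nonzero morphism from [V] to [W]. *)
Lemma avoid_nonisomorphic J V W :
  usimple V -> usimple W -> ~ uiso V W -> left_ideal J ->
  (forall s : 'cV_(mdim W), s != 0 -> transitive_at J s) ->
  forall l (s : 'cV_(mdim W)), s != 0 -> transitive_at (@annihilator J V l) s.
Proof.
move=> sV sW VW idJ tJ; elim=> [|k l IH] s s0.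
  by move=> w; have [j Jj E] := tJ s s0 w; exists j.
apply: simple_transitive => //; first exact: annihilator_left_ideal.
apply: contrapT => no.
have kill j : @annihilator J V l j -> mact V j *m delta_mx k 0 = 0 :> 'cV_(mdim V) ->
    mact W j *m s = 0.
  move=> [Jj jl] jk; apply/eqP/negPn/negP => js; case: no; exists j => //.
  by split=> // i; rewrite inE => /orP[/eqP ->|/jl].
have idJl := annihilator_left_ideal l idJ.
have [[j Jj jk]|none] := pselect (exists2 j, @annihilator J V l j &
    mact V j *m delta_mx k 0 != 0 :> 'cV_(mdim V)).
  have [|X mX XE] := transitive_hom idJl _ kill.
    by apply: simple_transitive => //; exists j.
  apply: VW; have [|Y [XY YX]] := schur sV sW mX.
    move=> X0; have [j' Jj' E] := IH s s0 s.
    by case/eqP: s0; rewrite -E XE // X0 mul0mx.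
  by exists X, Y; split=> //; apply: is_umorphism_inv mX _ _.
have [j Jj E] := IH s s0 s; case/eqP: s0; rewrite -E; apply: kill => //.
by apply/eqP/negPn/negP => jk; apply: none; exists j.
Qed.

Definition scalar_endos W :=
  forall X : 'M[F]_(mdim W), is_umorphism (V := W) (W := W) X -> exists c, X = c%:M.

(** An element of [J] can be prescribed on the basis vectors in turn. If those that kill
    the earlier basis vectors and the next one, [n], all killed a vector [s] independent
    of them, the morphism j n |-> j s would be a scalar [c], and s - c n would be
    killed by the elements that kill the earlier vectors. *)
Lemma burnside J W : usimple W -> scalar_endos W -> left_ideal J ->
  (forall s : 'cV_(mdim W), s != 0 -> transitive_at J s) ->
  forall T, exists2 j, J j & mact W j = T.
Proof.
move=> sW scW idJ tJ T.
have nz n (s : 'cV[F]_n) k : s k 0 != 0 -> s != 0.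
  by apply: contra => /eqP ->; rewrite mxE.
have key l (s : 'cV_(mdim W)) : (exists2 k, k \notin l & s k 0 != 0) ->
    transitive_at (@annihilator J W l) s.
  elim: l s => [|k l IH] s [k' k'l sk'].
    by move=> w; have [j Jj E] := tJ s (nz _ _ _ sk') w; exists j.
  move: k'l; rewrite inE negb_or => /andP[k'k k'l].
  have [kl|kl] := boolP (k \in l).
    move=> w; have [|j [Jj jl] E] := IH s _ w; first by exists k'.
    by exists j => //; split=> // i; rewrite inE => /orP[/eqP ->|]; apply: jl.
  apply: simple_transitive => //; first exact: annihilator_left_ideal.
  apply: contrapT => no.
  have kill j : @annihilator J W l j ->
      mact W j *m delta_mx k 0 = 0 :> 'cV_(mdim W) -> mact W j *m s = 0.
    move=> [Jj jl] jk; apply/eqP/negPn/negP => js; case: no; exists j => //.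
    by split=> // i; rewrite inE => /orP[/eqP ->|/jl].
  have [|X mX XE] := transitive_hom (annihilator_left_ideal l idJ) _ kill.
    by apply: IH; exists k; rewrite // mxE !eqxx oner_eq0.
  have [c Xc] := scW X mX.
  have [|j Jj E] := IH (- c *: delta_mx k 0 + s) _ s.
    exists k' => //; rewrite !mxE eqxx andbT (negbTE k'k).
    by rewrite mulr0 add0r.
  case/eqP: (nz _ _ _ sk'); rewrite -E mulmxDr -scalemxAr XE // Xc.
  by rewrite mul_scalar_mx scaleNr addNr.
have /choice[g gP] : forall k, exists j, J j /\ forall i,
    mact W j *m delta_mx i 0 = if i == k then col k T else 0 :> 'cV_(mdim W).
  move=> k; have [|j [Jj jl] E] :=
      key [seq i <- enum 'I_(mdim W) | i != k] (delta_mx k 0) _ (col k T).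
    by exists k; rewrite ?mem_filter ?eqxx // mxE !eqxx oner_eq0.
  exists j; split=> // i; case: (altP (i =P k)) => [->|ik] //.
  by apply: jl; rewrite mem_filter ik mem_enum.
exists (\sum_k g k).
  by apply: (is_submodule_sum idJ.1) => k; case: (gP k).
apply/matrixP => i k; have E : (mact W (\sum_k g k) *m delta_mx k 0) = col k T.
  rewrite linear_sum mulmx_suml (bigD1 k) //= big1 => [|l lk].
    by case: (gP k) => _ ->; rewrite eqxx addr0.
  by case: (gP l) => _ ->; rewrite eq_sym (negbTE lk).
by move/colP/(_ i): E; rewrite -colE !mxE.
Qed.

Variable G : int -> set H.

(** The common annihilator of the modules in [s] is still transitive on [W], so
    Burnside applies to it. *)
Lemma density (W : gmodule G) (s : seq (gmodule G)) :
  usimple W -> scalar_endos W ->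
  (forall V : gmodule G, V \in s -> usimple V /\ ~ uiso V W) ->
  forall T, exists2 e, mact W e = T & forall V : gmodule G, V \in s -> mact V e = 0.
Proof.
move=> sW scW sP T.
suff [J [idJ tJ Js]] : exists J, [/\ left_ideal J,
    forall s : 'cV_(mdim W), s != 0 -> transitive_at J s &
    forall (V : gmodule G) j, V \in s -> J j -> mact V j = 0].
  have [e Je E] := burnside sW scW idJ tJ T.
  by exists e => // V Vs; apply: Js.
elim: s sP => [_|V s IH sP].
  exists setT; split=> // u u0; apply: simple_transitive => //.
  by exists fa_one; rewrite // (mact1 W) mul1mx.
have [|J [idJ tJ Js]] := IH; first by move=> U Us; apply: sP; rewrite inE Us orbT.
have [sV VW] : usimple V /\ ~ uiso V W by apply: sP; rewrite inE eqxx.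
exists (@annihilator J V (enum 'I_(mdim V))); split.
- exact: annihilator_left_ideal.
- exact: avoid_nonisomorphic.
move=> U j; rewrite inE => /orP[/eqP ->|Us] [Jj jl]; last exact: Js.
apply: mulmx_cV_ext => v; rewrite mul0mx mulmx_colE big1 // => k _.
by rewrite colE jl ?mem_enum ?scaler0.
Qed.

End Density.

Section Detection.
Variables (F : fieldType) (H : freeAlgebra F) (G : int -> set H).
Hypothesis gG : graded_span G.
Implicit Types M N S : gmodule G.

(** A nonzero homogeneous component of an ungraded isomorphism is a morphism, and an
    isomorphism by the lemma of Schur. *)
Lemma uiso_giso_shift N S :
  gsimple N -> gsimple S -> uiso N S -> exists j, giso N (gshift S j).
Proof.
move=> sN sS [X [Y [mX mY XY YX]]].
have [] := pselect (exists i j, gproj S i *m X *m gproj N j <> 0); last first.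
  move=> /forallNP no; case: sN => -[v /eqP v0] _; case: v0.
  rewrite -[v]mul1mx -YX (_ : X = 0) ?mulmx0 ?mul0mx //.
  apply: gproj_ext => j; apply: gproj_extl => i; rewrite mul0mx mulmx0 mulmxA.
  by have /forallNP/(_ j)/contrapT := no i.
move=> [i [j ij]]; pose d := i - j.
pose Z : 'M_(mdim S, mdim N) := \sum_(k <- gsupp N) gproj S (k + d) *m X *m gproj N k.
have ZP k : Z *m gproj N k = gproj S (k + d) *m X *m gproj N k.
  transitivity (\sum_(l <- gsupp N) gproj S (k + d) *m X *m gproj N k *m gproj N l).
    rewrite mulmx_suml; apply: eq_bigr => l _.
    by rewrite -!mulmxA !gprojM eq_sym; case: eqP => [->|_]; rewrite ?mulmx0.
  by rewrite -mulmx_sumr gproj_sum mulmx1.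
have mZ : is_umorphism Z.
  apply: is_umorphism_span => // c h Gh; apply: gproj_ext => k.
  rewrite -[LHS]mulmxA (gproj_act _ _ Gh) [LHS]mulmxA ZP -[LHS]mulmxA.
  rewrite -(gproj_act _ _ Gh) mulmxA -[_ *m X *m mact N h]mulmxA mX.
  by rewrite -[RHS]mulmxA ZP !mulmxA (gproj_act _ _ Gh) !addrA.
have Z0 : Z <> 0.
  by move=> Z0; apply: ij; have := ZP j; rewrite Z0 mul0mx /d addrC subrK => <-.
have [W [ZW WZ]] := schur (gsimple_usimple gG sN) (gsimple_usimple gG sS) mZ Z0.
exists (- d).
have gZ : is_gmorphism (Z : 'M_(mdim (gshift S (- d)), mdim N)).
  split=> [|k v /gcompP Nv]; first exact: mZ.
  rewrite /= /shift_comp opprK -Nv mulmxA ZP -!mulmxA; exact: gproj_comp.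
by exists Z, W; split=> //; apply: is_gmorphism_inv gZ _ _.
Qed.

Variable Delta : set H.
Hypothesis DeltaP : forall x, G 0 x -> exists2 b, b != 0 & Delta (b *: x).

Lemma rchar1_neq1 (b : F) : b != 0 -> 1 - b *: 'X != 1 :> {poly F}.
Proof.
move=> b0; apply/eqP => E; have := @pow_rchar1_inj _ _ 1 0 b0.
by rewrite expr0 expr1 => /(_ E).
Qed.

(** Choose [h] to act on [S] as a projection onto a line in degree [i], and as zero on
    the modules in [t] not isomorphic to [S] as ungraded modules. On a nontrivial shift
    of [S] the line has another degree, so the component of degree [i] does not see it.
    The
    scalar [b] is the denominator that brings [h] into [Delta], such as the image of an
    algebra over a subring. *)
Lemma detection S (t : seq (gmodule G)) :
  gsimple S -> scalar_endos S -> (forall N, N \in t -> gsimple N) ->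
  exists h i b, [/\ Delta h, b != 0 & forall N, N \in t ->
    gchar N h i = if `[< giso N S >] then 1 - b *: 'X else 1].
Proof.
move=> sS scS st.
have uS := gsimple_usimple gG sS.
have [[v0 v00] _] := uS.
have [d vd] : exists d, gproj S d *m v0 != 0.
  apply: contrapT => /forallNP Pv; case/eqP: v00.
  by rewrite (gproj_decomp v0) big1 // => i _; apply/eqP/negPn/negP/Pv.
have [v Pv vnz] : exists2 v : 'cV_(mdim S), gproj S d *m v = v & v != 0.
  by exists (gproj S d *m v0); rewrite // mulmxA gprojM eqxx.
have [k vk] : exists k, v k 0 != 0 :> F.
  apply: contrapT => /forallNP vk; case/eqP: vnz.
  by apply/colP => i; rewrite [RHS]mxE; apply/eqP/negPn/negP/vk.
(* T below is the projection onto the line of v. *)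
pose phi : 'rV_(mdim S) := (v k 0)^-1 *: delta_mx 0 k.
have phiv : phi *m v = 1%:M.
  rewrite /phi -scalemxAl -rowE; apply/matrixP => a b; rewrite !mxE.
  by rewrite (ord1 a) (ord1 b) mulVf // ?eqxx.
pose T := v *m (phi *m gproj S d).
have [N|e eS eN] := density (s := [seq N : gmodule G <- t | ~~ `[< uiso N S >]]) uS scS _ T.
  rewrite mem_filter => /andP[/asboolPn ? /st /(gsimple_usimple gG) ?]; split=> //.
have [e0 Ge0 e0E] := degree0_part gG e.
have [b b0 Db] := DeltaP Ge0; exists (b *: e0), d, b; split=> // N Nt.
have gcharE (M : gmodule G) i :
    gchar M (b *: e0) i = rchar (b *: (gproj M i *m mact M e *m gproj M i)).
  by rewrite /gchar linearZ /= -scalemxAl e0E.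
have gcharS j : gchar S (b *: e0) (d - j) = if j == 0 then 1 - b *: 'X else 1.
  rewrite gcharE eS /T; case: (altP (j =P 0)) => [->|j0].
    rewrite subr0 !mulmxA Pv -[v *m _ *m _ *m _]mulmxA gprojM eqxx -mulmxA scalemxAr.
    by rewrite rchar_mulC -scalemxAl -mulmxA Pv phiv scale_scalar_mx mulr1 rchar1.
  rewrite -!mulmxA gprojM ifN ?mulmx0 ?scaler0 ?rchar0 //.
  by apply: contra j0 => /eqP/(congr1 (+%R^~ (j - d)))/eqP; rewrite addrACA addrC; lia.
have [NS|NS] := pselect (uiso N S); last first.
  rewrite gcharE eN ?mulmx0 ?mul0mx ?scaler0 ?rchar0; last first.
    by rewrite mem_filter Nt andbT; apply/asboolPn.
  by case: asboolP => // /giso_uiso.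
have [j Nj] := uiso_giso_shift (st _ Nt) sS NS.
have gN : gchar N (b *: e0) d = if j == 0 then 1 - b *: 'X else 1.
  by rewrite (gchar_giso _ _ Nj) gchar_shift gcharS.
rewrite gN; case: asboolP => [NS'|NS'].
  have := gcharS 0; rewrite subr0 eqxx -(gchar_giso _ _ NS') gN.
  by case: eqP => // _ /esym/eqP; rewrite (negbTE (rchar1_neq1 b0)).
case: eqP Nj => // -> Nj; case: NS'; apply: giso_trans Nj _.
exists 1%:M, 1%:M; rewrite mulmx1; split=> //; apply/gmorphismP;
  by split=> l; rewrite ?gproj_shift ?subr0 mulmx1 mul1mx.
Qed.

(** Both products, at the elements that detect [S], are powers of 1 - bX. *)
Lemma count_gchar (s s' : seq (gmodule G)) S :
  (forall N, N \in s -> gsimple N) -> (forall N, N \in s' -> gsimple N) ->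
  (forall h i, Delta h ->
    \prod_(N <- s) gchar N h i = \prod_(N <- s') gchar N h i) ->
  gsimple S -> scalar_endos S ->
  count (fun N => `[< giso N S >]) s = count (fun N => `[< giso N S >]) s'.
Proof.
move=> ss ss' ess' sS scS.
have [|h [i [b [Dh b0 hE]]]] := @detection S (s ++ s') sS scS.
  by move=> N; rewrite mem_cat => /orP[/ss|/ss'].
have prodE (u : seq (gmodule G)) : {subset u <= s ++ s'} ->
    \prod_(N <- u) gchar N h i = (1 - b *: 'X) ^+ count (fun N => `[< giso N S >]) u.
  move=> us; rewrite big_seq; under eq_bigr => N /us Nu do rewrite hE //.
  by rewrite -big_seq -big_mkcond /= big_const_seq iter_mulr_1.
apply: (pow_rchar1_inj b0); rewrite -!prodE.
- exact: ess'.
- by move=> N Ns; rewrite mem_cat Ns orbT.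
- by move=> N Ns; rewrite mem_cat Ns.
Qed.

End Detection.

(** * Classes in the Grothendieck group and graded characters *)

Section GrothendieckGroup.
Variables (F : fieldType) (H : freeAlgebra F) (G : int -> set H).
Implicit Types M N S : gmodule G.

Lemma gclass_exact M' M M'' : @gexact _ _ G M' M M'' -> gclass M = gclass M' + gclass M''.
Proof.
move=> ex; rewrite /gclass -[RHS]raddfD /=; apply/eqP; rewrite -Quotient.idealrBE.
by apply/asboolP => P _ _; apply; exists M', M, M''; rewrite opprD addrA.
Qed.

Lemma zero_gmodule_mx n (A B : 'M[F]_(mdim (zero_gmodule G), n)) : A = B.
Proof. by apply/matrixP => -[]. Qed.

Lemma zero_gmodule_mxr n (A B : 'M[F]_(n, mdim (zero_gmodule G))) : A = B.
Proof. by apply/matrixP => i -[]. Qed.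

Lemma gclass_zero : gclass (zero_gmodule G) = 0.
Proof.
apply: (@addrI _ (gclass (zero_gmodule G))); rewrite addr0; apply/esym/gclass_exact.
apply: (@gexactI _ _ _ (zero_gmodule G) (zero_gmodule G) (zero_gmodule G) 0 0 0 0); do ?by apply/gmorphismP; split=> ?; apply: zero_gmodule_mx.
by split; apply: zero_gmodule_mx.
Qed.

Lemma gclass_giso M N : giso M N -> gclass M = gclass N.
Proof.
move=> [X [Y [mX mY XY YX]]]; rewrite -[RHS]add0r -gclass_zero; apply: gclass_exact.
apply: (@gexactI _ _ _ (zero_gmodule G) M N 0 0 X Y) => //.
  by apply/gmorphismP; split=> ?; apply: zero_gmodule_mxr.
by split=> //; [apply: zero_gmodule_mx | rewrite mul0mx add0r].
Qed.

Lemma gclass_gseries M s : gseries M s -> gclass M = \sum_(S <- s) gclass S.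
Proof.
elim=> [N N0|M' N S t ex _ _ IH]; last by rewrite big_cons (gclass_exact ex) IH addrC.
have N0mx n (A B : 'M[F]_(mdim N, n)) : A = B.
  by apply: mulmx_cV_ext => v; rewrite [LHS]N0 [RHS]N0.
rewrite big_nil -gclass_zero; apply: gclass_giso; exists 0, 0; split.
- by apply/gmorphismP; split=> ?; apply: zero_gmodule_mx.
- by apply/gmorphismP; split=> ?; apply: N0mx.
- exact: zero_gmodule_mx.
- exact: N0mx.
Qed.

Lemma freeg_sum_perm (s t : seq (gmodule G)) :
  \sum_(M <- s) << M >> = \sum_(M <- t) << M >> :> {freeg (gmodule G) / int} ->
  perm_eq s t.
Proof.
move=> E; have cE u M : coeff M (\sum_(N <- u) << N >> : {freeg (gmodule G) / int}) =
    (count_mem M u)%:Z.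
  rewrite raddf_sum /=; elim: u => [|N u IH]; first by rewrite big_nil.
  by rewrite big_cons IH coeffU mul1r /= PoszD eq_sym natz.
apply/allP => M _; apply/eqP.
by have := congr1 (coeff M) E; rewrite !cE => -[].
Qed.

(** The relation is tested on formal differences of finite sums of modules for which the
    products of [gchar] agree; as [gchar] is only a nonzero polynomial, the products
    are compared without dividing. *)
Lemma gclass_gchar M N h i : gclass M = gclass N -> gchar M h i = gchar N h i.
Proof.
move=> /eqP; rewrite -Quotient.idealrBE => /asboolP rel.
pose P (x : {freeg (gmodule G) / int}) := exists s t : seq (gmodule G),
  x = \sum_(M <- s) << M >> - \sum_(M <- t) << M >> /\
  \prod_(M <- s) gchar M h i = \prod_(M <- t) gchar M h i.
have [] := rel P.
- by exists [::], [::]; rewrite !big_nil subr0.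
- move=> _ _ [s [t [-> E]]] [s' [t' [-> E']]]; exists (s ++ t'), (t ++ s').
  by rewrite !big_cat /= E E'; split=> //; rewrite opprB addrACA -opprD.
- move=> _ [M' [M0 [M'' [ex ->]]]]; exists [:: M0], [:: M'; M''].
  by rewrite !big_cons !big_nil !addr0 !mulr1 opprD addrA (gchar_exact _ _ ex).
move=> s [t [E st]]; have MNst : perm_eq (M :: t) (N :: s).
  apply: freeg_sum_perm; rewrite !big_cons; apply/eqP.
  by rewrite -subr_eq0 opprD addrACA E -opprB addNr.
have : \prod_(S <- M :: t) gchar S h i = \prod_(S <- N :: s) gchar S h i.
  exact: perm_big.
rewrite !big_cons st; apply: mulIf.
elim: (t) => [|S u IH]; first by rewrite big_nil oner_neq0.
by rewrite big_cons mulf_neq0 // rchar_neq0.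
Qed.

Lemma gclass_sum_count (s t : seq (gmodule G)) :
  (forall S, S \in s ++ t ->
    count (fun N => `[< giso N S >]) s = count (fun N => `[< giso N S >]) t) ->
  \sum_(S <- s) gclass S = \sum_(S <- t) gclass S.
Proof.
elim: s t => [|S s IH] t E.
  case: t E => [|S t] E; first by rewrite !big_nil.
  have := E S; rewrite inE eqxx /= => /(_ isT).
  by rewrite (asboolT (giso_refl S)).
have /hasP[N Nt /asboolP NS] : has (fun N => `[< giso N S >]) t.
  rewrite has_count -E ?inE ?eqxx //= (asboolT (giso_refl S)).
  by [].
rewrite (perm_big _ (perm_to_rem Nt)) !big_cons (gclass_giso NS); congr (_ + _).
apply: IH => T Tt; have := E T; have /permP tE := perm_to_rem Nt.
rewrite tE /= (_ : `[< giso N T >] = `[< giso S T >]).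
  move=> /(_ _)/addnI; apply; rewrite inE mem_cat; move: Tt.
  rewrite mem_cat => /orP[->|/mem_rem ->]; by rewrite ?orbT.
by apply/asbool_equiv_eq; split; apply: giso_trans => //; exact: giso_sym.
Qed.

Section Split.
Hypothesis gG : graded_span G.
Hypothesis split : split_algebra H.
Variable Delta : set H.
Hypothesis DeltaP : forall x, G 0 x -> exists2 b, b != 0 & Delta (b *: x).

Lemma gsimple_scalar S : gsimple S -> scalar_endos S.
Proof. by move=> /(gsimple_usimple gG) sS X; apply: split. Qed.

(** Passing to composition factors, equal products give equal multiplicities. *)
Lemma gclass_sum_gchar (s t : seq (gmodule G)) :
  (forall h i, Delta h ->
    \prod_(M <- s) gchar M h i = \prod_(M <- t) gchar M h i) ->
  \sum_(M <- s) gclass M = \sum_(M <- t) gclass M.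
Proof.
have refine (u : seq (gmodule G)) : exists v, [/\ forall S, S \in v -> gsimple S,
    \sum_(M <- u) gclass M = \sum_(S <- v) gclass S &
    forall h i, \prod_(M <- u) gchar M h i = \prod_(S <- v) gchar S h i].
  elim: u => [|M u [v [sv Ev hv]]]; first by exists [::]; split=> *; rewrite ?big_nil.
  have [w Mw] := gseries_exists M; exists (w ++ v); split=> [S|| h i].
  - by rewrite mem_cat => /orP[/(gseries_gsimple Mw)|/sv].
  - by rewrite big_cons big_cat Ev (gclass_gseries Mw).
  - by rewrite big_cons big_cat hv (gchar_gseries _ _ Mw).
have [s' [ss -> sE]] := refine s; have [t' [st -> tE]] := refine t => E.
apply: gclass_sum_count => S SS.
have sS : gsimple S by move: SS; rewrite mem_cat => /orP[/ss|/st].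
apply: (count_gchar gG DeltaP) => //; last exact: gsimple_scalar.
by move=> h i Dh; rewrite -sE -tE E.
Qed.

Lemma gclass_eq_gchar M N :
  (forall h i, Delta h -> gchar M h i = gchar N h i) -> gclass M = gclass N.
Proof.
move=> E; have := @gclass_sum_gchar [:: M] [:: N]; rewrite !big_seq1; apply.
by move=> h i Dh; rewrite !big_seq1 E.
Qed.

Lemma gmult_gseries M s S : gseries M s -> gsimple S ->
  gmult M S = count (fun N => `[< giso N S >]) s.
Proof.
move=> Ms sS; rewrite /gmult; set A := [set m | _].
have : A (get A) by apply: getPex; exists (count (fun N => `[< giso N S >]) s), s.
move=> [t [Mt ->]]; apply: (count_gchar gG DeltaP) => //.
- exact: gseries_gsimple Mt.
- exact: gseries_gsimple Ms.
- by move=> h i _; rewrite -(gchar_gseries _ _ Mt) -(gchar_gseries _ _ Ms).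
- exact: gsimple_scalar.
Qed.

End Split.
End GrothendieckGroup.

(** * Maximal pairs of a subring and an ideal of a field *)

Section Chevalley.
Variable K : fieldType.
Implicit Types R I : set K.

Definition subring_set R :=
  [/\ R 1, forall x y, R x -> R y -> R (x - y) & forall x y, R x -> R y -> R (x * y)].

Definition ideal_set R I :=
  [/\ forall x, I x -> R x, I 0, forall x y, I x -> I y -> I (x - y) &
      forall r x, R r -> I x -> I (r * x)].

(** Ordered by inclusion, the maximal pairs are the valuation rings of [K] with their
    maximal ideals. Keeping the ideal in the pair reduces the conditions on unions of
    chains to finitely many elements at a time. *)
Definition ring_ideal_pair (p : set K * set K) :=
  [/\ subring_set p.1, ideal_set p.1 p.2 & ~ p.2 1].

Lemma subring_set0 R : subring_set R -> R 0.
Proof. by move=> [R1 RB _]; rewrite -(subrr 1); apply: RB. Qed.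

Lemma subring_setD R x y : subring_set R -> R x -> R y -> R (x + y).
Proof.
move=> sR Rx Ry; have [_ RB _] := sR.
by rewrite -[y]opprK -[- y]add0r; apply: (RB) => //; apply: RB => //; exact: subring_set0.
Qed.

Lemma ideal_setD R I x y : ideal_set R I -> I x -> I y -> I (x + y).
Proof.
move=> [_ I0 IB _] Ix Iy.
by rewrite -[y]opprK -[- y]add0r; apply: (IB) => //; apply: IB.
Qed.

Lemma subring_set_sum R T (r : seq T) (f : T -> K) :
  subring_set R -> (forall t, R (f t)) -> R (\sum_(t <- r) f t).
Proof.
move=> sR Rf; elim/big_ind: _ => // [|x y]; first exact: subring_set0.
exact: subring_setD.
Qed.

Lemma ideal_set_sum R I T (r : seq T) (f : T -> K) :
  ideal_set R I -> (forall t, I (f t)) -> I (\sum_(t <- r) f t).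
Proof.
move=> iI If; elim/big_ind: _ => // [|x y]; first by case: iI.
exact: (ideal_setD iI).
Qed.

(** For a ring [S] this is S[x]; for an ideal, the ideal that it generates in the ring
    extended by [x]. *)
Definition adjoin (S : set K) x : set K :=
  [set y | exists p : {poly K}, (forall i, S p`_i) /\ y = p.[x]].

Lemma adjoin_sub (S : set K) x : S 0 -> S `<=` adjoin S x.
Proof.
move=> S0 y Sy; exists y%:P; rewrite hornerC; split=> // i.
by rewrite coefC; case: eqP.
Qed.

Lemma adjoin_pair R I x : ring_ideal_pair (R, I) ->
  ~ adjoin I x 1 -> ring_ideal_pair (adjoin R x, adjoin I x).
Proof.
move=> [/= sR iI _] I1; have [R1 RB RM] := sR; have [IR I0 IB IM] := iI.
split=> //=; split.
- exact: (adjoin_sub x (subring_set0 sR) R1).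
- move=> _ _ [p [Rp ->]] [q [Rq ->]]; exists (p - q); rewrite !hornerE.
  by split=> // i; rewrite coefB; apply: RB.
- move=> _ _ [p [Rp ->]] [q [Rq ->]]; exists (p * q); rewrite hornerM.
  by split=> // i; rewrite coefM; apply: subring_set_sum => // j; apply: RM.
- by move=> _ [p [Ip ->]]; exists p; split=> // i; exact: IR.
- exact: (adjoin_sub x I0 I0).
- move=> _ _ [p [Ip ->]] [q [Iq ->]]; exists (p - q); rewrite !hornerE.
  by split=> // i; rewrite coefB; apply: IB.
- move=> _ _ [p [Rp ->]] [q [Iq ->]]; exists (p * q); rewrite hornerM.
  split=> // i; rewrite coefM; refine (ideal_set_sum _ iI _) => j; exact: IM.
Qed.

Lemma adjoin_gen R x : subring_set R -> adjoin R x x.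
Proof.
move=> sR; exists 'X; rewrite hornerX; split=> // i; rewrite coefX.
by case: (i == 1)%N; [case: sR | exact: subring_set0].
Qed.

Definition pair_le (p q : set K * set K) := p.1 `<=` q.1 /\ p.2 `<=` q.2.

Lemma maximal_pair p0 : ring_ideal_pair p0 -> exists p,
  [/\ ring_ideal_pair p, pair_le p0 p &
      forall q, ring_ideal_pair q -> pair_le p q -> pair_le q p].
Proof.
move=> ok0; pose T := {p | ring_ideal_pair p /\ pair_le p0 p}.
pose le (s t : T) := `[< pair_le (sval s) (sval t) >].
have t0 : T by exists p0; split=> //; split.
have [|||[p [okp p0p]] maxp] := @ZL_preorder T t0 le.
- by move=> t; apply/asboolP; split.
- move=> r s t /asboolP[rs1 rs2] /asboolP[st1 st2]; apply/asboolP.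
  by split; [apply: subset_trans rs1 st1 | apply: subset_trans rs2 st2].
- move=> A totA.
  have [[t1 At1]|A0] := pselect (exists t, A t); last first.
    exists (exist _ p0 (conj ok0 (conj (@subset_refl _ _) (@subset_refl _ _)))).
    by move=> s As; case: A0; exists s.
  pose R := [set x | exists2 t, A t & (sval t).1 x].
  pose I := [set x | exists2 t, A t & (sval t).2 x].
  have join s t : A s -> A t -> exists2 u, A u & pair_le (sval s) (sval u) /\
      pair_le (sval t) (sval u).
    move=> As At; have [/asboolP st|/asboolP ts] := totA _ _ As At.
      by exists t => //; split=> //; split.
    by exists s => //; split=> //; split.
  have ok (t : T) : ring_ideal_pair (sval t) := proj1 (proj2_sig t).
  have okRI : ring_ideal_pair (R, I).
    split; first split.
    - by exists t1 => //; have [[]] := ok t1.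
    - move=> x y [s As sx] [t At ty]; have [u Au [su tu]] := join s t As At.
      exists u => //; have [[_ RB _] _ _] := ok u; apply: RB; [exact: su.1 | exact: tu.1].
    - move=> x y [s As sx] [t At ty]; have [u Au [su tu]] := join s t As At.
      exists u => //; have [[_ _ RM] _ _] := ok u; apply: RM; [exact: su.1 | exact: tu.1].
    - split.
      + by move=> x [s As sx]; exists s => //; have [_ [IR _ _ _] _] := ok s; apply: IR.
      + by exists t1 => //; have [_ [_ I0 _ _] _] := ok t1.
      + move=> x y [s As sx] [t At ty]; have [u Au [su tu]] := join s t As At.
        exists u => //; have [_ [_ _ IB _] _] := ok u; apply: IB; [exact: su.2 | exact: tu.2].
      + move=> x y [s As sx] [t At ty]; have [u Au [su tu]] := join s t As At.
        exists u => //; have [_ [_ _ _ IM] _] := ok u; apply: IM; [exact: su.1 | exact: tu.2].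
    - by move=> [s _ s1]; have [_ _] := ok s.
  have p0RI : pair_le p0 (R, I).
    case: (t1) At1 => t [okt [le1 le2]] At; split=> x /=.
      by move=> /le1 tx; exists (exist _ t (conj okt (conj le1 le2))).
    by move=> /le2 tx; exists (exist _ t (conj okt (conj le1 le2))).
  exists (exist _ (R, I) (conj okRI p0RI)) => s As; apply/asboolP.
  by split=> x sx; exists s.
exists p; split=> // q okq pq.
have p0q : pair_le p0 q.
  by split; [apply: subset_trans p0p.1 pq.1 | apply: subset_trans p0p.2 pq.2].
have := maxp (exist _ q (conj okq p0q)); rewrite /le /= => mq.
by apply/asboolP/mq/asboolP.
Qed.

Section MaximalPair.
Variables R I : set K.
Hypothesis okRI : ring_ideal_pair (R, I).
Hypothesis maxRI : forall q, ring_ideal_pair q -> pair_le (R, I) q -> pair_le q (R, I).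

Let sR : subring_set R. Proof. by case: okRI. Qed.
Let iI : ideal_set R I. Proof. by case: okRI. Qed.
Let I1 : ~ I 1. Proof. by case: okRI. Qed.
Let R1 : R 1. Proof. by case: sR. Qed.
Let RB x y : R x -> R y -> R (x - y). Proof. by case: sR => _ + _; apply. Qed.
Let RM x y : R x -> R y -> R (x * y). Proof. by case: sR => _ _; apply. Qed.
Let IR x : I x -> R x. Proof. by case: iI => + _ _ _; apply. Qed.
Let I0 : I 0. Proof. by case: iI. Qed.
Let IB x y : I x -> I y -> I (x - y). Proof. by case: iI => _ _ + _; apply. Qed.
Let IM r x : R r -> I x -> I (r * x). Proof. by case: iI => _ _ _; apply. Qed.
Let RD x y : R x -> R y -> R (x + y). Proof. exact: subring_setD. Qed.
Let ID x y : I x -> I y -> I (x + y). Proof. exact: (ideal_setD iI). Qed.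

(** Otherwise the pair could be enlarged by [x]. *)
Lemma not_in_maximal x : ~ R x -> adjoin I x 1.
Proof.
move=> Rx; apply: contrapT => nI; apply: Rx.
have [] := maxRI (adjoin_pair okRI nI); last by move=> + _; apply; exact: adjoin_gen.
by split=> /=; apply: adjoin_sub => //; exact: subring_set0.
Qed.

Let RX x n : R x -> R (x ^+ n).
Proof. by move=> Rx; elim: n => [|n IH]; rewrite ?expr0 ?exprS //; apply: RM. Qed.

Let one_subX_in a n : I a -> I (1 - (1 - a) ^+ n).
Proof.
move=> Ia; elim: n => [|n IH]; first by rewrite expr0 subrr.
rewrite exprS mulrBl mul1r opprB addrCA [a * _]mulrC; apply: ID => //.
by apply: IM => //; apply: RX; apply: RB => //; apply: IR.
Qed.

(** If the inverse were not in [R], 1 would be a polynomial in it with coefficients in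
    [I]; multiplying by a power of [1 - a] puts 1 in [I]. *)
Lemma one_sub_unit a : I a -> 1 - a != 0 /\ R (1 - a)^-1.
Proof.
move=> Ia; have a1 : 1 - a != 0.
  by apply/eqP => E; apply: I1; rewrite -[1](subrK a) E add0r.
split=> //; apply: contrapT => /not_in_maximal[p [Ip p1]].
pose n := size p; apply: I1; rewrite -[1](subrK ((1 - a) ^+ n)).
apply: ID; first exact: one_subX_in.
have -> : (1 - a) ^+ n = p.[(1 - a)^-1] * (1 - a) ^+ n by rewrite -p1 mul1r.
rewrite horner_coef mulr_suml.
refine (ideal_set_sum _ iI _) => i; rewrite -mulrA mulrC [X in X * _]mulrC; apply: IM => //.
rewrite exprVn -expfB_cond; last by rewrite (negbTE a1) add0n ltnW.
by apply: RX; apply: RB => //; apply: IR.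
Qed.

(** The longer relation is shortened by the other one, in which the constant
    term can be removed because 1 - q(0) is a unit. *)
Lemma no_two_relations N x (p q : {poly K}) : x != 0 ->
  (size p + size q <= N)%N -> (forall i, I p`_i) -> (forall i, I q`_i) ->
  1 = p.[x] -> 1 = q.[x^-1] -> False.
Proof.
elim: N x p q => [|N IH] x p q x0 szN.
  move: szN; rewrite leqn0 addn_eq0 size_poly_eq0 => /andP[/eqP -> _] _ _.
  by rewrite horner0 => /eqP; rewrite oner_eq0.
wlog szqp : x p q x0 szN / (size q <= size p)%N.
  move=> W Ip Iq p1 q1; have [le|/ltnW le] := leqP (size q) (size p).
    exact: (W x p q).
  by apply: (W x^-1 q p); rewrite ?invr_eq0 ?invrK // addnC.
move=> Ip Iq p1 q1.
(* Rewrite 1 = q(1/x) as 1 = c(1/x)/x, with c over I and shorter than q. *)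
have [u0 Ru] := one_sub_unit (Iq 0%N).
pose c := (1 - q`_0)^-1 *: drop_poly 1 q.
have Ic i : I c`_i by rewrite coefZ coef_drop_poly; apply: IM.
have szc : (size c <= (size q).-1)%N.
  by apply: leq_trans (size_scale_leq _ _) _; rewrite size_drop_poly subn1.
have cE : 1 = c.[x^-1] * x^-1.
  apply: (mulfI u0); rewrite hornerZ mulrA mulVKf // mulr1.
  rewrite {1}q1 -{1}(poly_take_drop 1 q) hornerD hornerM hornerXn expr1 addrC.
  rewrite (_ : take_poly 1 q = (q`_0)%:P) ?hornerC ?addKr //.
  by apply/polyP => i; rewrite coef_take_poly coefC; case: i.
case szp : (size p) => [|n].
  by move: szp p1 => /eqP; rewrite size_poly_eq0 => /eqP ->; rewrite horner0 => /eqP;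
     rewrite oner_eq0.
have szcn : (size c <= n)%N by apply: leq_trans szc _; move: szqp; rewrite szp; lia.
(* Times x^n, the relation expresses x^n by lower powers of x. *)
pose r := \poly_(i < n) c`_(n - i.+1).
have rE : r.[x] = x ^+ n.
  rewrite horner_poly (reindex_inj rev_ord_inj) /= -[RHS]mulr1 cE.
  rewrite (horner_coef_wide _ szcn) !mulr_suml mulr_sumr; apply: eq_bigr => i _.
  rewrite -subSn // subSS subKn ?(ltnW (ltn_ord i)) //.
  rewrite -[_ / x]mulrA [RHS]mulrCA; congr (_ * _); rewrite -exprSr exprVn -expfB_cond //.
  by rewrite (negbTE x0) add0n.
pose p' := take_poly n p + p`_n *: r.
have Ip' i : I p'`_i.
  rewrite coefD coefZ coef_take_poly coef_poly; apply: ID; first by case: ifP.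
  apply: IM; first exact: IR.
  by case: ifP.
apply: (IH x p' q x0 _ Ip' Iq _ q1); last first.
  rewrite hornerD hornerZ rE p1 -{1}(poly_take_drop n p) hornerD hornerM hornerXn.
  congr (_ + _ * _); have szd : (size (drop_poly n p) <= 1)%N.
    by rewrite size_drop_poly szp; lia.
  by rewrite (size1_polyC szd) hornerC coef_drop_poly add0n.
rewrite -ltnS (leq_trans _ szN) // -addSn leq_add2r szp ltnS.
rewrite (leq_trans (size_polyD _ _)) // geq_max size_take_poly.
by rewrite (leq_trans (size_scale_leq _ _)) ?size_poly.
Qed.

Lemma maximal_valuation x : x != 0 -> R x \/ R x^-1.
Proof.
move=> x0; apply: contrapT => /not_orP[/not_in_maximal[p [Ip p1]]].
move=> /not_in_maximal[q [Iq q1]].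
exact: (no_two_relations x0 (leqnn _) Ip Iq p1 q1).
Qed.

(** Otherwise [I + R u] would be a larger proper ideal. *)
Lemma maximal_unit u : R u -> ~ I u -> R u^-1.
Proof.
move=> Ru Iu; pose J := [set y | exists i r, [/\ I i, R r & y = i + r * u]].
have subIJ : I `<=` J.
  by move=> i Ii; exists i, 0; rewrite mul0r addr0; split=> //; exact: subring_set0.
have J1 : J 1.
  apply: contrapT => nJ1; apply: Iu.
  have okRJ : ring_ideal_pair (R, J).
    split=> //; split=> /=.
    - by move=> _ [i [r [Ii Rr ->]]]; apply: RD; [exact: IR | exact: RM].
    - exact: subIJ.
    - move=> _ _ [i [r [Ii Rr ->]]] [i' [r' [Ii' Rr' ->]]].
      exists (i - i'), (r - r'); split; [exact: IB | exact: RB |].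
      by rewrite mulrBl opprD addrACA.
    - move=> s _ Rs [i [r [Ii Rr ->]]]; exists (s * i), (s * r).
      by split; [exact: IM | exact: RM | rewrite mulrDr mulrA].
  have [] := maxRI okRJ; first by split.
  by move=> _; apply; exists 0, 1; rewrite mul1r add0r; split.
have [i [r [Ii Rr E]]] := J1.
have [u0 Rinv] := one_sub_unit Ii.
have ru : r * u = 1 - i by rewrite E addrC addKr.
suff -> : u^-1 = r * (1 - i)^-1 by apply: RM.
have nz : r != 0 /\ u != 0.
  by split; apply: contra u0 => /eqP z; rewrite -ru z ?mulr0 ?mul0r.
by rewrite -ru invfM mulrA divff ?mul1r; case: nz.
Qed.

End MaximalPair.

End Chevalley.

(** * Valuation rings and their residue fields *)

(** The structure of a ring morphism has to be attached to a constant: this one turns the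
    equations for a locally defined function into a morphism. The same is done
    for linear maps below. *)
Section RingOfFunction.
Variables (R S : comNzRingType) (f : R -> S).
Hypotheses (f1 : f 1 = 1) (fB : forall x y, f (x - y) = f x - f y).
Hypothesis (fM : forall x y, f (x * y) = f x * f y).

Definition rmorphism_fun := f.

HB.instance Definition _ := GRing.isZmodMorphism.Build R S rmorphism_fun fB.
HB.instance Definition _ :=
  GRing.isMonoidMorphism.Build R S rmorphism_fun (conj f1 fM).

Lemma rmorphism_exists : exists g : {rmorphism R -> S}, g =1 f.
Proof. by exists rmorphism_fun. Qed.

End RingOfFunction.

Lemma rmorphism_lift (R S T : comNzRingType) (g : {rmorphism R -> T})
    (f : {rmorphism S -> T}) :
  injective f -> (forall x, exists y, g x = f y) ->
  exists h : {rmorphism R -> S}, forall x, f (h x) = g x.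
Proof.
move=> injf /choice[h hE].
have [||| h' h'E] := @rmorphism_exists R S h.
- by apply: injf; rewrite -hE !rmorph1.
- by move=> x y; apply: injf; rewrite rmorphB -!hE rmorphB.
- by move=> x y; apply: injf; rewrite rmorphM -!hE rmorphM.
by exists h' => x; rewrite h'E hE.
Qed.

Lemma fraction_field_lift (A : comNzRingType) (L k : fieldType)
    (theta : {rmorphism A -> L}) (g : {rmorphism A -> k}) :
  is_fraction_field theta -> (forall a, g a = 0 <-> theta a = 0) ->
  exists h : {rmorphism L -> k}, forall a, h (theta a) = g a.
Proof.
move=> frac kerE.
have /choice[n /choice[d nd]] : forall x, exists a, exists b,
  theta b != 0 /\ x = theta a / theta b by exact: frac.
have g_eq a b : theta a = theta b -> g a = g b.
  move=> E; apply/eqP; rewrite -subr_eq0 -rmorphB; apply/eqP/kerE.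
  by rewrite rmorphB E subrr.
have d0 x : theta (d x) != 0 by case: (nd x).
have gd0 b : theta b != 0 -> g b != 0 by apply: contra => /eqP/kerE ->.
have hE x a b : theta b != 0 -> x = theta a / theta b ->
    g (n x) / g (d x) = g a / g b.
  move=> b0 xE; apply/eqP; rewrite eqr_div ?gd0 // -!rmorphM; apply/eqP/g_eq.
  have [_ E] := nd x; move/eqP: (etrans (esym E) xE).
  by rewrite eqr_div // => /eqP; rewrite !rmorphM.
pose h x := g (n x) / g (d x).
have [||| h' h'E] := @rmorphism_exists L k h.
- by rewrite /h (hE 1 1 1) ?rmorph1 ?oner_neq0 // divr1.
- move=> x y; have [_ xE] := nd x; have [_ yE] := nd y.
  rewrite /h (hE (x - y) (n x * d y - n y * d x) (d x * d y)).
  + by rewrite !rmorphB !rmorphM -[in RHS]mulNr addf_div ?gd0 // mulNr.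
  + by rewrite rmorphM mulf_neq0.
  + by rewrite rmorphB !rmorphM {1}xE {1}yE -[in LHS]mulNr addf_div ?d0 // mulNr.
- move=> x y; have [_ xE] := nd x; have [_ yE] := nd y.
  rewrite /h (hE (x * y) (n x * n y) (d x * d y)) ?rmorphM ?mulf_neq0 //.
  + by rewrite mulf_div.
  + by rewrite {1}xE {1}yE mulf_div.
exists h' => a; rewrite h'E /h (hE (theta a) a 1) ?rmorph1 ?divr1 //.
exact: oner_neq0.
Qed.

Section Place.
Local Open Scope quotient_scope.
Local Open Scope ring_scope.
Variables (K : fieldType) (R I : set K).
Hypothesis okRI : ring_ideal_pair (R, I).
Hypothesis unitR : forall u, R u -> ~ I u -> R u^-1.

Definition place_pred : {pred K} := fun x => `[< R x >].

Lemma place_subring : subring_closed place_pred.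
Proof.
have [[R1 RB RM] _ _] := okRI; split; first exact/asboolP.
  by move=> x y /asboolP Rx /asboolP Ry; apply/asboolP; apply: RB.
by move=> x y /asboolP Rx /asboolP Ry; apply/asboolP; apply: RM.
Qed.

HB.instance Definition _ := GRing.isSubringClosed.Build K place_pred place_subring.

Definition place_ring := {x : K | place_pred x}.
HB.instance Definition _ := SubChoice.on place_ring.
HB.instance Definition _ := [SubChoice_isSubComNzRing of place_ring by <:].

Definition place_ideal : {pred place_ring} := fun x => `[< I (val x) >].

Lemma place_idealr : idealr_closed place_ideal.
Proof.
have [_ iI I1] := okRI; have [_ I0 IB IM] := iI; split.
- by apply/asboolP; rewrite rmorph0.
- by apply/asboolP; rewrite rmorph1.
move=> a u v /asboolP Iu /asboolP Iv; apply/asboolP; rewrite rmorphD rmorphM.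
apply: (ideal_setD iI) => //; apply: IM => //.
exact/asboolP/(valP a).
Qed.

HB.instance Definition _ := isIdealr.Build place_ring place_ideal place_idealr.

Definition place_residue := {ideal_quot place_ideal}.
HB.instance Definition _ := GRing.ComNzRing.on place_residue.

Definition place_inv (x : place_residue) : place_residue :=
  if pselect (exists y, y * x = 1) is left e then projT1 (cid e) else 0.

Lemma place_mulVf x : x != 0 -> place_inv x * x = 1.
Proof.
rewrite /place_inv; case: pselect => [e _|ne x0]; first by case: cid.
case: ne; move: x0; rewrite -[x](@reprK _ place_residue); set u := repr x => u0.
have Iu : ~ I (val u).
  move=> Iu; case/eqP: u0; apply/eqP; rewrite -[0](rmorph0 \pi_place_residue).
  by rewrite -Quotient.idealrBE subr0; apply/asboolP.
have Ru : R (val u) by apply/asboolP/(valP u).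
have nz : val u != 0.
  by apply/eqP => u00; case: Iu; rewrite u00; case: okRI => _ [].
pose v : place_ring := exist place_pred (val u)^-1 (asboolT (unitR Ru Iu)).
exists (\pi v); rewrite -rmorphM -[RHS](rmorph1 \pi_place_residue); congr (\pi _).
by apply: val_inj; rewrite /= mulVf.
Qed.

Lemma place_inv0 : place_inv 0 = 0.
Proof.
rewrite /place_inv; case: pselect => // e; case: cid => y /= /eqP.
by rewrite mulr0 eq_sym oner_eq0.
Qed.

HB.instance Definition _ :=
  GRing.ComNzRing_isField.Build place_residue place_mulVf place_inv0.

(** The quotient of [R] by [I] is a field because the elements outside [I] are units. *)
Lemma place_exists : exists (O : comNzRingType) (f : {rmorphism O -> K})
    (k : fieldType) (res : {rmorphism O -> k}),
  [/\ injective f, forall x, R x <-> exists o, x = f o,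
      forall z, exists o, z = res o & forall o, res o = 0 <-> I (f o)].
Proof.
exists place_ring, (val : {rmorphism place_ring -> K}), place_residue, \pi_place_residue.
split=> [|x|z|o].
- exact: val_inj.
- split=> [Rx|[o ->]]; last by apply/asboolP/(valP o).
  by exists (exist place_pred x (asboolT Rx)).
- by exists (repr z); apply/esym/reprK.
- have pi0 : \pi_place_residue 0 = 0 := rmorph0 \pi_place_residue.
  split=> [o0|Io].
    have /eqP := etrans o0 (esym pi0).
    by rewrite -Quotient.idealrBE subr0 => /asboolP.
  apply: etrans pi0; apply/eqP; rewrite -Quotient.idealrBE subr0.
  exact/asboolP.
Qed.

End Place.

Section Dominating.
Variable K : fieldType.

Lemma dominating_place (R0 I0 : set K) : ring_ideal_pair (R0, I0) ->
  exists (O : comNzRingType) (f : {rmorphism O -> K})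
      (k : fieldType) (res : {rmorphism O -> k}),
  [/\ injective f,
      forall x, x != 0 -> (exists o, x = f o) \/ (exists o, x^-1 = f o),
      forall x, R0 x -> exists o, x = f o,
      forall z, exists o, z = res o & forall o, I0 (f o) -> res o = 0].
Proof.
move=> /maximal_pair[[R I] [okRI [/= le1 le2] maxRI]].
have [O [f [k [res [injf fR surj resI]]]]] := place_exists okRI (maximal_unit okRI maxRI).
exists O, f, k, res; split=> // [x x0|x /le1/fR|o /le2/resI] //.
by have [/fR|/fR] := maximal_valuation okRI maxRI x0; [left | right].
Qed.

Variables (A : comNzRingType) (iota : {rmorphism A -> K}).

(** Start from the localisation of [A] at the kernel of [theta], with its maximal ideal. *)
Lemma valuation_ring_exists (L : fieldType) (theta : {rmorphism A -> L}) :
  injective iota -> is_fraction_field theta ->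
  exists O : valuation_ring iota theta, True.
Proof.
move=> inj_iota frac.
pose fracs (P : A -> Prop) := [set x | exists a b, [/\ P a, theta b != 0 & x = iota a / iota b]].
have nz b : theta b != 0 -> iota b != 0.
  apply: contra => /eqP b0; apply/eqP; rewrite -[b](_ : 0 = b) ?rmorph0 //.
  by apply: inj_iota; rewrite b0 rmorph0.
pose R := fracs (fun=> True); pose I := fracs (fun a => theta a = 0).
have fracM (P Q S : A -> Prop) : (forall a b, P a -> Q b -> S (a * b)) ->
    forall x y, fracs P x -> fracs Q y -> fracs S (x * y).
  move=> PQ _ _ [a [b [Pa b0 ->]]] [c [d [Qc d0 ->]]].
  exists (a * c), (b * d); split; first exact: PQ.
    by rewrite rmorphM mulf_neq0.
  by rewrite !rmorphM mulf_div.
have fracB (P : A -> Prop) : (forall a b c d, P a -> P b -> P (a * c - b * d)) ->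
    forall x y, fracs P x -> fracs P y -> fracs P (x - y).
  move=> PB _ _ [a [b [Pa b0 ->]]] [c [d [Pc d0 ->]]].
  exists (a * d - c * b), (b * d); split; first exact: PB.
    by rewrite rmorphM mulf_neq0.
  by rewrite rmorphB !rmorphM -[in LHS]mulNr addf_div ?nz // mulNr.
have ok : ring_ideal_pair (R, I).
  split=> /=; first split.
  - by exists 1, 1; split; rewrite // !rmorph1 ?divr1 ?oner_neq0.
  - exact: fracB.
  - exact: fracM.
  - split.
    + by move=> _ [a [b [_ b0 ->]]]; exists a, b.
    + by exists 0, 1; split; rewrite ?rmorph0 ?rmorph1 ?mul0r ?oner_neq0.
    + by apply: fracB => a b c d a0 b0; rewrite rmorphB !rmorphM a0 b0 !mul0r subrr.
    + by apply: fracM => a b _ b0; rewrite rmorphM b0 mulr0.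
  - move=> [a [b [a0 b0 E]]]; case/eqP: (b0); rewrite -a0; congr (theta _).
    by apply: inj_iota; rewrite -[LHS]mul1r E divfK // nz.
have [O [f [k [res [injf val RO surj resI]]]]] := dominating_place ok.
have [|base baseE] := rmorphism_lift (g := iota) injf.
  by move=> a; apply: RO; exists a, 1; split; rewrite // rmorph1 ?oner_neq0 ?divr1.
have ker a : res (base a) = 0 <-> theta a = 0.
  split=> [ra|ta]; last first.
    by apply: resI; rewrite baseE; exists a, 1; split; rewrite // rmorph1 ?oner_neq0 ?divr1.
  apply/eqP/negPn/negP => ta.
  have [|o oE] := RO (iota a)^-1.
    by exists 1, a; split; rewrite // rmorph1 mul1r.
  have : base a * o = 1 by apply: injf; rewrite rmorphM baseE -oE divff ?nz ?rmorph1.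
  move=> /(congr1 res); rewrite rmorphM ra mul0r rmorph1 => /esym/eqP.
  by rewrite oner_eq0.
have [emb embE] := fraction_field_lift (g := res \o base) frac ker.
by exists (ValuationRing injf val baseE surj ker embE).
Qed.

(** If [x] is not integral, 1/x generates a proper ideal of A[1/x]: a relation
    1 = p(1/x)/x is an integral equation for [x]. A valuation ring in which 1/x
    lies in the maximal ideal does not contain [x]. *)
Lemma valuation_avoiding x : ~ integralOver iota x ->
  exists (O : comNzRingType) (f : {rmorphism O -> K}) (base : {rmorphism A -> O}),
  [/\ injective f,
      forall x, x != 0 -> (exists o, x = f o) \/ (exists o, x^-1 = f o),
      forall a, f (base a) = iota a & ~ exists o, x = f o].
Proof.
move=> nx; have x0 : x != 0.
  apply/eqP => x0; apply: nx; rewrite x0; exists 'X; first exact: monicX.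
  by rewrite map_polyX rootX.
have sR0 : subring_set (range iota).
  split; first by exists 1; rewrite ?rmorph1.
    by move=> _ _ [a _ <-] [b _ <-]; exists (a - b); rewrite ?rmorphB.
  by move=> _ _ [a _ <-] [b _ <-]; exists (a * b); rewrite ?rmorphM.
have okR0 : ring_ideal_pair (range iota, [set 0]).
  split=> //=; last by move=> /eqP; rewrite oner_eq0.
  split=> //= [_ ->|_ _ -> ->|r y _ ->]; rewrite ?subr0 ?mulr0 //.
  by exists 0; rewrite ?rmorph0.
have n1 : ~ adjoin [set 0] x^-1 1.
  move=> [p [p0 E]]; have p00 : p = 0 by apply/polyP => i; rewrite coef0; exact: p0.
  by move/eqP: E; rewrite p00 horner0 oner_eq0.
have [/= sR _ _] := adjoin_pair okR0 n1; set R := adjoin _ _ in sR.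
have [R1 RB RM] := sR.
pose I := [set y | exists2 r, R r & y = x^-1 * r].
have Rx : R x^-1 := adjoin_gen x^-1 sR0.
have ok : ring_ideal_pair (R, I).
  split=> //=; first split.
  - by move=> _ [r Rr ->]; apply: RM.
  - by exists 0; rewrite ?mulr0 //; apply: subring_set0.
  - by move=> _ _ [r Rr ->] [s Rs ->]; exists (r - s); rewrite ?mulrBr //; apply: RB.
  - by move=> r _ Rr [s Rs ->]; exists (r * s); rewrite 1?mulrCA //; apply: RM.
  move=> [_ [p [Rp ->]] E]; apply: nx.
  have /choice[c cE] : forall i, exists a, iota a = p`_i.
    by move=> i; have [a _ <-] := Rp i; exists a.
  pose n := size p; pose q := \poly_(i < n) c (n - i.+1)%N.
  exists ('X^n - q).
    rewrite monicE lead_coefDl ?lead_coefXn // size_polyN size_polyXn ltnS.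
    exact: size_poly.
  rewrite rmorphB /= map_polyXn /root hornerD hornerN hornerXn subr_eq0; apply/eqP.
  rewrite -[LHS]mulr1 E horner_coef !mulr_sumr.
  have -> : map_poly iota q = \poly_(i < n) p`_(n - i.+1).
    apply/polyP => i; rewrite coef_map !coef_poly; case: ifP => _; last exact: rmorph0.
    exact: cE.
  rewrite horner_poly [RHS](reindex_inj rev_ord_inj) /=; apply: eq_bigr => i _.
  rewrite -subSn // subSS subKn ?(ltnW (ltn_ord i)) //.
  rewrite expfB_cond; last by rewrite (negbTE x0) add0n.
  by rewrite exprS invfM -exprVn [RHS]mulrCA; congr (_ * _); rewrite mulrCA.
have [O [f [k [res [injf val RO surj resI]]]]] := dominating_place ok.
have [|base baseE] := rmorphism_lift (g := iota) injf.
  move=> a; apply: RO; apply: (adjoin_sub _ (subring_set0 sR0)).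
  by exists a.
exists O, f, base; split=> // -[o oE].
have [o' o'E] := RO _ Rx.
have : o * o' = 1 by apply: injf; rewrite rmorphM -oE -o'E divff ?rmorph1.
move=> /(congr1 res); rewrite rmorphM (resI o') ?mulr0 ?rmorph1.
  by move=> /esym/eqP; rewrite oner_eq0.
by rewrite -o'E; exists 1; rewrite ?mulr1.
Qed.

End Dominating.

(** * Lattices over valuation rings *)

Section ExtensionProjections.
Variables (A R R' : comNzRingType) (H : freeAlgebra A) (G : int -> set H).
Variables (e : {rmorphism A -> R}) (e' : {rmorphism A -> R'}).
Variables (f : {rmorphism R -> R'}) (fe : forall a, f (e a) = e' a).

Lemma gproj_gext (M : gmodule (tens_grading (e := e) G)) i :
  gproj (gext fe M) i = map_mx f (gproj M i).
Proof.
apply: gproj_unique => k v [s [Ss ->]]; rewrite mulmx_sumr.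
transitivity (\sum_(p <- s) if i == k then p.1 *: p.2 else 0); last first.
  by case: eqP => // _; rewrite big1.
rewrite big_seq [RHS]big_seq; apply: eq_bigr => p /Ss[w Mw <-].
rewrite -scalemxAr -map_mxM (gprojE _ Mw).
by case: eqP => // _; rewrite map_mx0 scaler0.
Qed.

Lemma gchar_gext (M : gmodule (tens_grading (e := e) G)) h i :
  gchar (gext fe M) (tens_in e' h) i = map_poly f (gchar M (tens_in e h) i).
Proof. by rewrite /gchar gproj_gext /= (ext_act_in fe) -map_mxM rchar_map. Qed.

Lemma map_tens_in (h : H) : map_mx f (tens_in e h) = tens_in e' h.
Proof. by apply/rowP => k; rewrite !mxE fe. Qed.

Lemma map_tens_basis i : map_mx f (tens_basis R (H := H) i) = tens_basis R' i.
Proof. exact: map_delta_mx. Qed.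

Lemma map_tens_mul (x y : tens e H) :
  map_mx f (fa_mul x y) = fa_mul (map_mx f x : tens e' H) (map_mx f y).
Proof.
rewrite [fa_mul x y]/(tens_mul e x y) [fa_mul _ _ in RHS]/(tens_mul e' _ _) /tens_mul.
rewrite raddf_sum; apply: eq_bigr => i _ /=; rewrite raddf_sum; apply: eq_bigr => j _ /=.
by rewrite map_mxZ map_tens_in /tens_coord !mxE rmorphM.
Qed.

Lemma map_tens_one : map_mx f (fa_one : tens e H) = (fa_one : tens e' H).
Proof. exact: map_tens_in. Qed.

Lemma map_tens_grading i x :
  tens_grading (e := e) G i x -> tens_grading (e := e') G i (map_mx f x).
Proof.
move=> [s [Ss ->]]; rewrite raddf_sum big_seq.
have sub := lin_span_submodule (tens_in e' (H := H) @` G i).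
elim/big_ind: _ => [||p /Ss[h Gh <-]].
- exact: sub.1.
- exact: (is_submoduleD sub).
rewrite /= map_mxZ map_tens_in; apply: (is_submoduleZ sub).
by apply: lin_span_sub; exists h.
Qed.

End ExtensionProjections.

Section ValuationSpan.
Variables (O : comNzRingType) (K : fieldType) (f : {rmorphism O -> K}).
Hypothesis valf : forall x, x != 0 -> (exists o, x = f o) \/ (exists o, x^-1 = f o).

Definition int_span m (T : finType) (g : T -> 'cV[K]_m) : set 'cV[K]_m :=
  [set v | exists o : T -> O, v = \sum_t f (o t) *: g t].

Section SpanClosure.
Variables (m : nat) (T : finType) (g : T -> 'cV[K]_m).

Lemma int_span_gen t : int_span g (g t).
Proof.
exists (fun s => (s == t)%:R); rewrite (bigD1 t) //= eqxx rmorph1 scale1r.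
by rewrite big1 ?addr0 // => s /negbTE ->; rewrite rmorph0 scale0r.
Qed.

Lemma int_span0 : int_span g 0.
Proof. by exists (fun=> 0); rewrite big1 // => t _; rewrite rmorph0 scale0r. Qed.

Lemma int_spanD u v : int_span g u -> int_span g v -> int_span g (u + v).
Proof.
move=> [a ->] [b ->]; exists (fun t => a t + b t); rewrite -big_split.
by apply: eq_bigr => t _; rewrite rmorphD scalerDl.
Qed.

Lemma int_spanZ o v : int_span g v -> int_span g (f o *: v).
Proof.
move=> [a ->]; exists (fun t => o * a t); rewrite scaler_sumr.
by apply: eq_bigr => t _; rewrite rmorphM scalerA.
Qed.

Lemma int_span_sum I (r : seq I) (P : pred I) (F : I -> 'cV[K]_m) :
  (forall i, P i -> int_span g (F i)) -> int_span g (\sum_(i <- r | P i) F i).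
Proof.
move=> gF; elim/big_ind: _ => [|x y|//]; first exact: int_span0.
exact: int_spanD.
Qed.

Lemma int_span_sub (S : finType) (h : S -> 'cV[K]_m) :
  (forall s, int_span g (h s)) -> int_span h `<=` int_span g.
Proof.
by move=> hg v [o ->]; apply: int_span_sum => s _; apply: int_spanZ.
Qed.

Lemma int_span_stable (A : 'M[K]_m) :
  (forall t, int_span g (A *m g t)) -> forall v, int_span g v -> int_span g (A *m v).
Proof.
move=> Ag v [o ->]; rewrite mulmx_sumr; apply: int_span_sum => t _.
by rewrite -scalemxAr; apply: int_spanZ.
Qed.

End SpanClosure.

(** Any two scalars are comparable for divisibility in [O]. *)
Lemma dominant_coef n (c : 'cV[K]_n) : c != 0 ->
  exists2 j, c j 0 != 0 & forall i, exists o, c i 0 = f o * c j 0.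
Proof.
move=> c0; have [j0 cj0] : exists j, c j 0 != 0 :> K.
  apply: contrapT => /forallNP cj; case/eqP: c0; apply/colP => i.
  by rewrite mxE; apply/eqP/negPn/negP/cj.
suff [j cj jP] : exists2 j, c j 0 != 0 &
    forall i, i \in enum 'I_n -> exists o, c i 0 = f o * c j 0.
  by exists j => // i; apply: jP; rewrite mem_enum.
elim: (enum _) => [|i l [j cj jP]]; first by exists j0.
have [ci|ci] := eqVneq (c i 0) 0.
  exists j => // k; rewrite inE => /orP[/eqP ->|/jP //].
  by exists 0; rewrite rmorph0 mul0r.
have [|[o oE]|[o oE]] := valf (x := c i 0 / c j 0).
- by rewrite mulf_neq0 ?invr_eq0.
- exists j => // k; rewrite inE => /orP[/eqP ->|/jP //].
  by exists o; rewrite -oE divfK.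
exists i => // k; rewrite inE => /orP[/eqP ->|/jP[o' ->]].
  by exists 1; rewrite rmorph1 mul1r.
by exists (o' * o); rewrite rmorphM -mulrA -oE invf_div divfK.
Qed.

(** In a linear relation divide by a dominant coefficient: its generator is an
    [O]-combination of the others and can be dropped. *)
Lemma int_span_basis m (T : finType) (g : T -> 'cV[K]_m) :
  exists r (q : 'I_r -> 'cV[K]_m), int_span q = int_span g /\
    forall c : 'cV[K]_r, \sum_j c j 0 *: q j = 0 -> c = 0.
Proof.
have -> : int_span g = int_span (fun j : 'I_#|T| => g (enum_val j)).
  apply/seteqP; split; apply: int_span_sub => t.
    by rewrite -[t in g t]enum_rankK; apply: int_span_gen (enum_rank t).
  exact: int_span_gen.
move: (fun j => g (enum_val j)) => {g}; move: #|T| => n {T}.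
elim: n => [|n IH] q.
  by exists 0%N, q; split=> // c _; apply/colP => -[].
have [indep|] := pselect (forall c : 'cV[K]_n.+1, \sum_j c j 0 *: q j = 0 -> c = 0).
  by exists n.+1, q.
move=> /existsNP[c /not_implyP[cq /eqP/dominant_coef[j cj /choice[o oE]]]].
have [r [q' [q'E indep]]] := IH (q \o fintype.lift j); exists r, q'; split=> //.
rewrite {}q'E; apply/seteqP; split; apply: int_span_sub => k.
  exact: int_span_gen.
case: (unliftP j k) => [k' ->|->]; first exact: (int_span_gen (q \o fintype.lift j)).
exists (fun i => - o (fintype.lift j i)); move: cq; rewrite (bigD1_ord j) //= => cq.
apply: (scalerI cj); move/eqP: cq; rewrite addr_eq0 => /eqP ->.
rewrite scaler_sumr -sumrN; apply: eq_bigr => i _.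
by rewrite rmorphN scaleNr scalerN scalerA [c j 0 * _]mulrC -oE.
Qed.

(** Generators of the vector space yield a basis of the [O]-lattice they span, in which
    every operator that preserves the lattice has a matrix over [O]. *)
Lemma lattice_basis m (T : finType) (g : T -> 'cV[K]_m) :
  (forall phi : 'rV[K]_m, (forall t, phi *m g t = 0) -> phi = 0) ->
  exists r (Q : 'M[K]_(m, r)) QL, [/\ Q *m QL = 1%:M, QL *m Q = 1%:M &
    forall A : 'M[K]_m, (forall t, int_span g (A *m g t)) ->
      exists E : 'M[O]_r, A *m Q = Q *m map_mx f E].
Proof.
move=> spang; have [r [q [qE indep]]] := int_span_basis g.
pose Q : 'M[K]_(m, r) := \matrix_(i, j) q j i 0.
have colQ j : col j Q = q j by apply/colP => i; rewrite !mxE.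
have QE (c : 'cV[K]_r) : Q *m c = \sum_j c j 0 *: q j.
  by rewrite mulmx_colE; apply: eq_bigr => j _; rewrite colQ.
have freeQ : row_free Q.
  apply: inj_row_free => phi phiQ; apply: spang => t.
  have : int_span q (g t) by rewrite qE; apply: int_span_gen.
  move=> [o ->]; rewrite mulmx_sumr big1 // => j _.
  by rewrite -scalemxAr -colQ colE mulmxA phiQ mul0mx scaler0.
have fullQ : row_full Q.
  rewrite /row_full -mxrank_tr; apply: inj_row_free => c cQ.
  rewrite -[c]trmxK (indep c^T) ?trmx0 // -QE -[Q]trmxK -trmx_mul cQ.
  exact: trmx0.
exists r, Q, (pinvmx Q); split; [exact: mulmxVp | exact: mulVpmx |].
move=> A Ag; have /choice[o oE] : forall j, exists o : 'I_r -> O,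
    A *m q j = \sum_i f (o i) *: q i.
  move=> j; have : int_span g (A *m q j).
    by apply: int_span_stable => //; rewrite -qE; apply: int_span_gen.
  by rewrite -qE.
exists (\matrix_(i, j) o j i); apply/matrixP => i j.
have /colP/(_ i) := oE j; rewrite -colQ colE mulmxA -colE mxE => ->.
rewrite summxE mxE; apply: eq_bigr => k _; rewrite !mxE mulrC //.
Qed.

End ValuationSpan.

Section LinearOfFunction.
Variables (R : comNzRingType) (U V : lmodType R) (f : U -> V).
Hypothesis linf : linear f.
Definition linear_fun := f.
HB.instance Definition _ := GRing.isLinear.Build R U V _ linear_fun linf.
Lemma linear_exists : exists g : {linear U -> V}, g =1 f.
Proof. by exists linear_fun. Qed.
End LinearOfFunction.

Section Lattice.
Variables (A O : comNzRingType) (K : fieldType) (H : freeAlgebra A) (G : int -> set H).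
Variables (eO : {rmorphism A -> O}) (eK : {rmorphism A -> K}) (f : {rmorphism O -> K}).
Hypothesis fe : forall a, f (eO a) = eK a.
Hypothesis injf : injective f.
Hypothesis valf : forall x, x != 0 -> (exists o, x = f o) \/ (exists o, x^-1 = f o).
Hypothesis gG : graded_span G.
Variable V : gmodule (tens_grading (e := eK) G).
Local Notation n := (dim H).
Local Notation m := (mdim V).
Local Notation act := (mact V).

Local Notation T := ('I_n * 'I_(size (gsupp V)) * 'I_m)%type.

(** The generators [b_j v], where [b_j] runs over the basis of [H] and [v] over the
    homogeneous components of the basis vectors. Starting from homogeneous [v] makes
    the lattice stable under the projections as well as under [H]. *)
Definition lattice_gen (t : T) : 'cV[K]_m :=
  act (tens_basis K t.1.1) *m gproj V (nth 0 (gsupp V) t.1.2) *m delta_mx t.2 0.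

Lemma tens_in_expand h : tens_in eK h = \sum_j eK (v2r h 0 j) *: tens_basis K j :> tens eK H.
Proof.
by rewrite [LHS]tens_expand; apply: eq_bigr => j _; rewrite tens_coord_in.
Qed.

Lemma lattice_gen_in h (i : 'I_(size (gsupp V))) (c : 'I_m) :
  int_span f lattice_gen
    (act (tens_in eK h) *m gproj V (nth 0 (gsupp V) i) *m delta_mx c 0).
Proof.
rewrite tens_in_expand linear_sum !mulmx_suml /=; apply: int_span_sum => j _.
rewrite linearZ /= -!scalemxAl -fe; apply: int_spanZ.
exact: (int_span_gen f lattice_gen (j, i, c)).
Qed.

Lemma lattice_gen_full (phi : 'rV[K]_m) :
  (forall t, phi *m lattice_gen t = 0) -> phi = 0.
Proof.
move=> phi0; rewrite -[phi]mulmx1 -(mact1 V) -[fa_one]/(tens_in eK fa_one).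
rewrite tens_in_expand linear_sum mulmx_sumr big1 // => j _.
rewrite linearZ /= -scalemxAr (_ : phi *m _ = 0) ?scaler0 //.
apply: gproj_ext => i; rewrite mul0mx.
have [iV|/gproj_out ->] := boolP (i \in gsupp V); last by rewrite mulmx0.
apply: mulmx_cV_ext => v; rewrite mul0mx mulmx_colE big1 // => c _.
have si : (index i (gsupp V) < size (gsupp V))%N by rewrite index_mem.
have := phi0 (j, Ordinal si, c); rewrite /lattice_gen /= nth_index //.
by rewrite colE !mulmxA => ->; rewrite scaler0.
Qed.

Lemma lattice_gen_act k t :
  int_span f lattice_gen (act (tens_basis K k : tens eK H) *m lattice_gen t).
Proof.
case: t => [[j i] c]; rewrite /lattice_gen /= !mulmxA -(mactM V).
rewrite -!(tens_in_basis eK) -[fa_mul _ _]/(tens_mul eK _ _) -tens_inM.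
exact: lattice_gen_in.
Qed.

Lemma lattice_gen_proj d t : int_span f lattice_gen (gproj V d *m lattice_gen t).
Proof.
case: t => [[j i] c]; rewrite /lattice_gen /= -(tens_in_basis eK).
have [s [Gs ->]] := gG.2 (r2v (delta_mx 0 j)).
rewrite tens_in_sum linear_sum /= !mulmx_suml mulmx_sumr big_seq.
apply: int_span_sum => p /Gs Gp; set P := gproj V (nth _ _ _).
(* A component p.2 of b_j moves v to the single degree p.1 + i. *)
have Gp' : tens_grading (e := eK) G p.1 (tens_in eK p.2).
  by apply: lin_span_sub; exists p.2.
rewrite {1}/P (gproj_act _ _ Gp') !mulmxA gprojM.
case: eqP => [->|_]; last by rewrite !mul0mx; apply: int_span0.
by rewrite -(gproj_act _ _ Gp'); apply: lattice_gen_in.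
Qed.

(** The action and the projections, written in a basis of the lattice spanned by the
    [lattice_gen], have entries in [O]. *)
Lemma lattice_exists :
  exists W : gmodule (tens_grading (e := eO) G), giso (gext fe W) V.
Proof.
have [r [Q [QL [QQL QLQ QE]]]] := lattice_basis valf lattice_gen_full.
have injQ (X Y : 'M[O]_r) : Q *m map_mx f X = Q *m map_mx f Y -> X = Y.
  move=> /(congr1 (mulmx QL)); rewrite !mulmxA QLQ !mul1mx => /matrixP E.
  by apply/matrixP => i j; apply: injf; have := E i j; rewrite !mxE.
have /choice[E EP] : forall k, exists E : 'M[O]_r,
    act (tens_basis K k : tens eK H) *m Q = Q *m map_mx f E.
  by move=> k; apply: QE => t; apply: lattice_gen_act.
have /choice[P PP] : forall d, exists P : 'M[O]_r, gproj V d *m Q = Q *m map_mx f P.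
  by move=> d; apply: QE => t; apply: lattice_gen_proj.
have [|a aE] := @linear_exists O (tens eO H) 'M[O]_r
    (fun x => \sum_k tens_coord x k *: E k).
  move=> c x y; rewrite scaler_sumr -big_split; apply: eq_bigr => i _ /=.
  by rewrite tens_coordD tens_coordZ scalerDl scalerA.
have actE (x : tens eO H) : act (map_mx f x) *m Q = Q *m map_mx f (a x).
  rewrite aE raddf_sum mulmx_sumr [map_mx f x]tens_expand linear_sum mulmx_suml.
  apply: eq_bigr => k _; rewrite linearZ /= -scalemxAl EP map_mxZ -scalemxAr.
  by rewrite /tens_coord mxE.
have a1 : a fa_one = 1%:M.
  by apply: injQ; rewrite -actE (map_tens_one H fe) (mact1 V) map_mx1 mul1mx mulmx1.
have aM x y : a (fa_mul x y) = a x *m a y.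
  apply: injQ; rewrite -actE (map_tens_mul fe) (mactM V) -mulmxA actE mulmxA actE.
  by rewrite map_mxM mulmxA.
pose U := UModule a1 aM.
have sumP : \sum_(i <- gsupp V) P i = 1%:M.
  apply: injQ; rewrite raddf_sum mulmx_sumr map_mx1 mulmx1 -[RHS]mul1mx.
  by rewrite -(gproj_sum V) mulmx_suml; apply: eq_bigr => i _; rewrite PP.
have orthP i j : P i *m P j = if i == j then P i else 0.
  apply: injQ; rewrite map_mxM mulmxA -PP -mulmxA -PP mulmxA gprojM.
  by case: eqP => [->|_]; rewrite ?PP // mul0mx map_mx0 mulmx0.
have actP i j h : tens_grading (e := eO) G i h ->
    mact U h *m P j = P (i + j) *m mact U h.
  move=> Gh; apply: injQ; rewrite !map_mxM !mulmxA -PP -actE -!mulmxA -actE -PP.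
  by rewrite !mulmxA (gproj_act _ _ (map_tens_grading fe Gh)).
pose W := @gmodule_of_proj _ _ (tens_grading (e := eO) G) U _ P (gsupp_uniq V)
  sumP orthP actP.
exists W.
have mQ : is_gmorphism (Q : 'M_(mdim V, mdim (gext fe W))).
  apply/gmorphismP; split=> [h|i]; last first.
    by rewrite gproj_gext gproj_of_proj PP.
  rewrite /= /ext_act mulmx_sumr [h in RHS]tens_expand linear_sum mulmx_suml.
  apply: eq_bigr => k _; rewrite [in RHS]linearZ /= -scalemxAr -scalemxAl.
  rewrite -(actE (tens_basis O k)).
  by rewrite map_tens_basis.
by exists Q, QL; split=> //; apply: is_gmorphism_inv mQ _ _.
Qed.

End Lattice.

Section Integrality.
Variables (A0 A : comNzRingType) (K : fieldType) (H : freeAlgebra A0) (G : int -> set H).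
Variables (eA : {rmorphism A0 -> A}) (eK : {rmorphism A0 -> K}) (iota : {rmorphism A -> K}).
Hypothesis iotaE : forall a, iota (eA a) = eK a.
Hypothesis A_ic : integrally_closed iota.
Hypothesis gG : graded_span G.

(** Each coefficient lies in every valuation ring between [A] and [K]. *)
Lemma gchar_integral (V : gmodule (tens_grading (e := eK) G)) h i :
  exists p : {poly A}, gchar V (tens_in eK h) i = map_poly iota p.
Proof.
have /choice[c cE] : forall k, exists a, (gchar V (tens_in eK h) i)`_k = iota a.
  move=> k; apply: A_ic; apply: contrapT => /valuation_avoiding.
  move=> [O [f [base [injf valf fbase]]]]; apply.
  have fe a : f ((base \o eA) a) = eK a by rewrite /= fbase iotaE.
  have [W WV] := lattice_exists fe injf valf gG V.
  by rewrite -(gchar_giso _ _ WV) gchar_gext coef_map; eexists.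
exists (\poly_(k < size (gchar V (tens_in eK h) i)) c k).
apply/polyP => k; rewrite coef_map coef_poly cE; case: ltnP => // le.
by rewrite -cE nth_default //; apply/esym/rmorph0.
Qed.

End Integrality.

(** * Base change of graded modules *)

Lemma gproj_sum_sub (R : comNzRingType) (H : freeAlgebra R) (G : int -> set H)
    (M : gmodule G) (t : seq int) :
  uniq t -> {subset gsupp M <= t} -> \sum_(i <- t) gproj M i = 1%:M.
Proof.
move=> ut st; apply: gproj_ext => k; rewrite mul1mx mulmx_suml.
have [kt|kt] := boolP (k \in t); last first.
  have -> : gproj M k = 0 by apply: gproj_out; apply: contra kt; apply: st.
  by rewrite big1 // => i _; rewrite mulmx0.
under eq_bigr do rewrite gprojM.
by rewrite -big_mkcond -big_filter filter_pred1_uniq // big_seq1.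
Qed.

Section DirectSum.
Variables (F : fieldType) (H : freeAlgebra F) (G : int -> set H).

Lemma direct_sum_exists (M N : gmodule G) : exists W, gexact M W N.
Proof.
pose D (A : 'M[F]_(mdim M)) (B : 'M[F]_(mdim N)) : 'M_(mdim M + mdim N) :=
  block_mx A 0 0 B.
have DM A B A' B' : D A B *m D A' B' = D (A *m A') (B *m B').
  by rewrite /D mulmx_block !mulmx0 !mul0mx !addr0 add0r.
have D1 : D 1%:M 1%:M = 1%:M by rewrite /D -scalar_mx_block.
have [|a aE] := @linear_exists F H _ (fun h => D (mact M h) (mact N h)).
  move=> c x y; rewrite !linearP /D scale_block_mx add_block_mx.
  by rewrite !scaler0 !addr0.
have a1 : a fa_one = 1%:M by rewrite aE (mact1 M) (mact1 N).
have aM x y : a (fa_mul x y) = a x *m a y by rewrite !aE (mactM M) (mactM N) DM.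
pose t := undup (gsupp M ++ gsupp N); pose P i := D (gproj M i) (gproj N i).
have sumP : \sum_(i <- t) P i = 1%:M.
  have -> : \sum_(i <- t) P i = D (\sum_(i <- t) gproj M i) (\sum_(i <- t) gproj N i).
    elim: (t) => [|i s IH]; first by rewrite !big_nil /D block_mx0.
    by rewrite !big_cons IH /P /D add_block_mx !addr0.
  rewrite !gproj_sum_sub ?undup_uniq // => i iM; rewrite mem_undup mem_cat iM //.
  by rewrite orbT.
have orthP i j : P i *m P j = if i == j then P i else 0.
  by rewrite DM !gprojM; case: eqP => // _; rewrite /D block_mx0.
pose U := UModule a1 aM.
have actP i j h : G i h -> mact U h *m P j = P (i + j) *m mact U h.
  by move=> Gh; rewrite /= aE !DM !(gproj_act _ _ Gh).
pose W := @gmodule_of_proj _ _ G U _ P (undup_uniq _) sumP orthP actP.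
exists W; apply: (@gexactI _ _ _ M W N (col_mx 1%:M 0) (row_mx 1%:M 0)
  (row_mx 0 1%:M) (col_mx 0 1%:M)).
- apply/gmorphismP; split=> [h|i]; rewrite ?gproj_of_proj /= ?aE mul_col_mx
    mul_block_col !mul1mx !mul0mx !mulmx1 !mulmx0 !addr0 //.
- apply/gmorphismP; split=> [h|i]; rewrite ?gproj_of_proj /= ?aE mul_mx_row
    mul_row_block !mul1mx !mul0mx !mulmx1 !mulmx0 !add0r //.
- split.
  + by rewrite mul_row_col mulmx1 mulmx0 addr0.
  + by rewrite mul_row_col mulmx1 mulmx0 add0r.
  + by rewrite !mul_col_row !mul0mx !mulmx0 !mulmx1 add_block_mx !addr0 add0r
       -scalar_mx_block.
Qed.

End DirectSum.

Lemma graded_span_tens (A R : comNzRingType) (e : {rmorphism A -> R})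
    (H : freeAlgebra A) (G : int -> set H) :
  graded_span G -> graded_span (tens_grading (e := e) G).
Proof.
move=> gG; split=> [i|]; first exact: lin_span_submodule.
elim/tens_ind => [|x y [s [Gs ->]] [t [Gt ->]]|a h].
- by exists [::]; rewrite big_nil.
- exists (s ++ t); rewrite big_cat; split=> // p; rewrite mem_cat.
  by move=> /orP[/Gs|/Gt].
have [s [Gs ->]] := gG.2 h.
exists [seq (p.1, a *: (tens_in e p.2 : tens e H)) | p <- s]; split.
  move=> _ /mapP[p /Gs Gp ->] /=; apply: (is_submoduleZ (lin_span_submodule _)).
  by apply: lin_span_sub; exists p.2.
by rewrite big_map tens_in_sum scaler_sumr.
Qed.

Section ExtensionFunctor.
Variables (A : comNzRingType) (L k : fieldType) (H : freeAlgebra A) (G : int -> set H).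
Variables (eL : {rmorphism A -> L}) (ek : {rmorphism A -> k}) (f : {rmorphism L -> k}).
Hypothesis fe : forall a, f (eL a) = ek a.
Implicit Types M N : gmodule (tens_grading (e := eL) G).

Lemma gext_gmorphism M N (X : 'M_(mdim N, mdim M)) : is_gmorphism X ->
  is_gmorphism (map_mx f X : 'M_(mdim (gext fe N), mdim (gext fe M))).
Proof.
move=> /gmorphismP[XH XP]; apply/gmorphismP; split=> [h|i]; last first.
  by rewrite !gproj_gext -!map_mxM XP.
rewrite /= /ext_act mulmx_sumr mulmx_suml; apply: eq_bigr => i _.
by rewrite -scalemxAr -scalemxAl -!map_mxM XH.
Qed.

Lemma gext_exact M' M M'' : gexact M' M M'' ->
  gexact (gext fe M') (gext fe M) (gext fe M'').
Proof.
move=> /gexact_splitting[X [XL [Y [YR [mX mY [XLX YYR E]]]]]].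
apply: (@gexactI _ _ _ (gext fe M') (gext fe M) (gext fe M'')
  (map_mx f X) (map_mx f XL) (map_mx f Y) (map_mx f YR)).
- exact: gext_gmorphism.
- exact: gext_gmorphism.
split; first by rewrite -map_mxM XLX map_mx1.
  by rewrite -map_mxM YYR map_mx1.
by rewrite -!map_mxM -map_mxD E map_mx1.
Qed.

Lemma ext_act_map M (x : tens eL H) :
  mact (gext fe M) (map_mx f x) = map_mx f (mact M x).
Proof.
rewrite [in RHS](tens_expand x) linear_sum raddf_sum; apply: eq_bigr => i _ /=.
by rewrite linearZ /= map_mxZ /tens_coord mxE.
Qed.

(** The matrix units belong to the image of [LH] already. *)
Lemma gext_usimple M : usimple M -> scalar_endos M -> usimple (gext fe M).
Proof.
move=> sM scM; have [[v /eqP v0] _] := sM; split.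
  exists (map_mx f v); apply/eqP => /matrixP fv; apply: v0; apply/matrixP => i j.
  by apply/eqP; rewrite mxE -(fmorph_eq0 f); have := fv i j; rewrite !mxE => ->.
move=> U [subU actU]; have [U0|] := pselect (forall u, U u -> u = 0).
  left; apply/seteqP; split=> u /=; first exact: U0.
  by move=> ->; apply: subU.1.
move=> /existsNP[u /not_implyP[Uu u0]]; right; apply/seteqP; split=> // w _.
have [a ua] : exists a, u a 0 != 0.
  apply: contrapT => /forallNP ua; apply: u0; apply/colP => i.
  by rewrite mxE; apply/eqP/negPn/negP/ua.
have Ub b : U (delta_mx b 0).
  have [s s0|x _ xE] := burnside sM scM (J := setT) (conj (conj I (fun _ _ _ _ _ => I))
    (fun _ _ _ => I)) _ (delta_mx b a).
    apply: simple_transitive => //; exists fa_one => //.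
    by rewrite (mact1 M) mul1mx.
  have := is_submoduleZ subU (u a 0)^-1 (actU (map_mx f x) _ Uu).
  rewrite ext_act_map xE map_delta_mx; congr U; apply/colP => i.
  rewrite !mxE (bigD1 a) //= !mxE eqxx andbT big1 => [|c ca]; last first.
    by rewrite !mxE (negbTE ca) andbF mul0r.
  by rewrite addr0 mulrCA mulVf // mulr1.
rewrite [w]matrix_sum_delta; apply: (is_submodule_sum subU) => i.
by rewrite big_ord1; apply: (is_submoduleZ subU).
Qed.

End ExtensionFunctor.

(** The regular module over the algebra itself, with the given grading. Extending it grades
    the regular module over any ring to which the scalars are extended. *)
Section RegularModule.
Variables (A : comNzRingType) (H : freeAlgebra A) (G : int -> set H).
Hypothesis grG : is_algebra_grading G.
Local Notation n := (dim H).
Local Notation HA := (tens idfun H).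

Lemma tens_in_id (h : H) : tens_in idfun h = v2r h.
Proof. by apply/rowP => i; rewrite mxE. Qed.

Lemma tens_grading_id i (x : HA) :
  tens_grading (e := idfun) G i x -> G i (r2v x).
Proof.
have [[sub _ _] _] := grG; move=> [s [Ss ->]]; rewrite linear_sum big_seq.
elim/big_ind: _ => [||p /Ss[h Gh <-]]; first exact: (sub i).1.
  exact: (is_submoduleD (sub i)).
by rewrite linearZ /= tens_in_id v2rK; apply: (is_submoduleZ (sub i)).
Qed.

Definition regular_comp i : set 'cV[A]_n := [set v | G i (r2v v^T)].

Lemma regular_comp_sum : is_direct_sum regular_comp.
Proof.
have [[sub dec ind] _] := grG; split=> [i|v|s c us Cc c0 i si].
- split=> [|a u v Cu Cv]; first by rewrite /regular_comp /= trmx0 linear0; exact: (sub i).1.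
  by rewrite /regular_comp /= !linearP; apply: (sub i).2.
- have [s [c [us Gc vE]]] := dec (r2v v^T).
  exists s, (fun i => (v2r (c i))^T); split=> // [i|].
    by rewrite /regular_comp /= trmxK v2rK.
  by rewrite -[LHS]trmxK -[v^T]r2vK vE !linear_sum.
have := ind s (fun i => r2v (c i)^T) us Cc.
have -> : \sum_(k <- s) r2v (c k)^T = r2v (\sum_(k <- s) c k)^T :> H.
  by rewrite !linear_sum.
rewrite c0 trmx0 linear0 => /(_ erefl _ si).
by move=> /(congr1 v2r); rewrite r2vK linear0 => /(congr1 trmx); rewrite trmxK trmx0.
Qed.

Definition regular_act (x : HA) : 'M[A]_n :=
  \matrix_(i, j) (fa_mul x (tens_basis A j : HA) : 'rV[A]_n) 0 i.

Lemma regular_act_linear : linear regular_act.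
Proof.
move=> a x y; apply/matrixP => i j.
by rewrite !mxE (@fa_mulDl _ HA) (@fa_mulZl _ HA) !mxE.
Qed.

HB.instance Definition _ := GRing.isLinear.Build A HA 'M[A]_n _
  regular_act regular_act_linear.

Lemma regular_actE x (v : 'cV[A]_n) :
  regular_act x *m v = (fa_mul x (v^T : HA) : 'rV[A]_n)^T.
Proof.
have -> : (v^T : HA) = \sum_j v j 0 *: (tens_basis A j : HA).
  by rewrite [LHS]tens_expand; apply: eq_bigr => j _; rewrite /tens_coord mxE.
rewrite (@fa_mul_sumr _ HA) linear_sum mulmx_colE; apply: eq_bigr => j _.
rewrite (@fa_mulZr _ HA) linearZ /=; congr (_ *: _).
by apply/colP => i; rewrite !mxE.
Qed.

Lemma regular_act1 : regular_act fa_one = 1%:M.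
Proof.
by apply: mulmx_cV_ext => v; rewrite regular_actE (@fa_mul1l _ HA) trmxK mul1mx.
Qed.

Lemma regular_actM x y : regular_act (fa_mul x y) = regular_act x *m regular_act y.
Proof.
apply: mulmx_cV_ext => v; rewrite -mulmxA !regular_actE trmxK.
by rewrite (@fa_mulA _ HA).
Qed.

Definition regular_umodule : umodule HA := UModule regular_act1 regular_actM.

Lemma regular_comp_act i j (h : HA) v : tens_grading (e := idfun) G i h ->
  regular_comp j v -> regular_comp (i + j) (regular_act h *m v).
Proof.
move=> /tens_grading_id Gh Cv; rewrite /regular_comp /= regular_actE trmxK.
have := grG.2 _ _ _ _ Gh Cv; congr (G _ _); apply: (can_inj v2rK).
by rewrite r2vK -!tens_in_id tens_inM !tens_in_id !r2vK.
Qed.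

Definition regular_gmodule : gmodule (tens_grading (e := idfun) G) :=
  @GModule _ _ _ regular_umodule _ regular_comp_sum regular_comp_act.

End RegularModule.

(** * Descent from the residue field *)

Section Residue.
Variables (A : comNzRingType) (L k : fieldType) (H : freeAlgebra A) (G : int -> set H).
Variables (eL : {rmorphism A -> L}) (ek : {rmorphism A -> k}) (f : {rmorphism L -> k}).
Hypothesis fe : forall a, f (eL a) = ek a.
Hypothesis grG : is_algebra_grading G.
Hypothesis split : split_algebra (tens eL H).
Local Notation LHmod := (gmodule (tens_grading (e := eL) G)).
Local Notation kHmod := (gmodule (tens_grading (e := ek) G)).

Let gG := graded_span_of grG.

Definition regularL : LHmod :=
  gext (e := idfun) (e' := eL) (f := eL) (fun=> erefl) (regular_gmodule grG).

Lemma regularL_act h :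
  mact regularL (tens_in eL h) = map_mx eL (regular_act (tens_in idfun h)).
Proof. exact: (@ext_act_in A A L H G idfun eL eL (fun=> erefl) (regular_gmodule grG) h). Qed.

(** The morphism x |-> x u. *)
Lemma regular_gmorphism (U : kHmod) (u : 'cV_(mdim U)) d : gcomp U d u -> u != 0 ->
  exists2 X : 'M_(mdim U, mdim (gext fe (gshift regularL d))),
    is_gmorphism X & X <> 0.
Proof.
move=> Uu u0; pose X : 'M[k]_(mdim U, dim H) :=
  \matrix_(i, j) (mact U (tens_basis k j : tens ek H) *m u) i 0.
have XE h : X *m (map_mx ek (v2r h))^T = mact U (tens_in ek h) *m u.
  rewrite [tens_in _ h](tens_expand (tens_in ek h)) linear_sum mulmx_suml mulmx_colE.
  apply: eq_bigr => j _; rewrite [in RHS]linearZ /= -scalemxAl tens_coord_in !mxE.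
  by congr (_ *: _); apply/colP => i; rewrite !mxE.
have colX j : X *m delta_mx j 0 = mact U (tens_basis k j : tens ek H) *m u.
  by rewrite -colE; apply/colP => i; rewrite !mxE.
set N := gext _ _; exists X; last first.
  move=> X0; case/eqP: u0; have := XE fa_one; rewrite X0 mul0mx.
  rewrite (_ : mact U _ = mact U fa_one) // (mact1 U) mul1mx => <- //.
split.
  elim/tens_ind => [|x y Ex Ey|a h].
  - by rewrite (linear0 (mact N)) (linear0 (mact U)) mulmx0 mul0mx.
  - by rewrite (linearD (mact N)) (linearD (mact U)) /= mulmxDr mulmxDl Ex Ey.
  rewrite [mact N _]linearZ [mact U _]linearZ /= -scalemxAr -scalemxAl.
  congr (_ *: _).
  rewrite /N /= (ext_act_in fe) regularL_act -map_mx_comp.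
  apply: mulmx_delta_ext => j; rewrite -!mulmxA colX.
  have -> : map_mx (f \o eL) (regular_act (tens_in idfun h)) *m delta_mx j 0 =
      (map_mx ek (v2r (fa_mul h (r2v (delta_mx 0 j)))))^T.
    rewrite -(map_delta_mx (f \o eL)) -map_mxM regular_actE trmx_delta.
    rewrite -(tens_in_id (fa_mul _ _)) tens_inM tens_in_basis -map_trmx.
    by apply/matrixP => i i'; rewrite !mxE /= fe.
  by rewrite XE tens_inM (mactM U) tens_in_basis mulmxA.
move=> i v [s [Ss ->]]; rewrite mulmx_sumr big_seq.
have [sub _ _] := gcomp_sum U; have subi := sub i.
elim/big_ind: _ => [||p /Ss[w Nw <-]]; first exact: subi.1.
  exact: (is_submoduleD subi).
rewrite -scalemxAr; apply: (is_submoduleZ subi).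
case: Nw => [t [St ->]]; rewrite raddf_sum mulmx_sumr big_seq.
elim/big_ind: _ => [||q /St[z Gz <-]]; first exact: subi.1.
  exact: (is_submoduleD subi).
rewrite /= map_mxZ -scalemxAr; apply: (is_submoduleZ subi).
have -> : map_mx f (map_mx eL z) = (map_mx ek (v2r (r2v z^T : H)))^T.
  by rewrite r2vK map_trmx trmxK; apply/matrixP => a b; rewrite !mxE fe.
rewrite XE -[i](subrK d); apply: gcomp_act Uu.
by apply: lin_span_sub; exists (r2v z^T).
Qed.

(** A quotient map can be cancelled on the right. *)
Lemma gmorphism_factor (M N N' : kHmod) (X : 'M_(mdim N', mdim M))
    (Y : 'M_(mdim N, mdim M)) (YR : 'M_(mdim M, mdim N)) (Z : 'M_(mdim N', mdim N)) :
  is_gmorphism X -> is_gmorphism Y -> Y *m YR = 1%:M -> X = Z *m Y ->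
  is_gmorphism Z.
Proof.
move=> /gmorphismP[XH XP] /gmorphismP[YH YP] YYR XE.
have ZE : Z = X *m YR by rewrite XE -mulmxA YYR mulmx1.
apply/gmorphismP; split=> [h|i].
  by rewrite -[LHS]mulmx1 -YYR mulmxA -(mulmxA Z) -YH !mulmxA -XE XH -!mulmxA -ZE.
by rewrite -[LHS]mulmx1 -YYR mulmxA -(mulmxA Z) -YP !mulmxA -XE XP -!mulmxA -ZE.
Qed.

(** Take [M] of least dimension such that the extension of [M] maps nontrivially to [U].
    It is simple, because the map is nonzero on a submodule or factors through
    the quotient; by [gext_usimple] its extension is simple as well. *)
Lemma gsimple_residue (U : kHmod) : gsimple U ->
  exists2 M : LHmod, gsimple M & giso (gext fe M) U.
Proof.
move=> sU; pose P d := `[< exists (M : LHmod) (X : 'M_(mdim U, mdim (gext fe M))),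
  [/\ mdim M = d, is_gmorphism X & X <> 0] >].
have exP : exists d, P d.
  have [[u0 u00] _] := sU.
  have [d ud] : exists d, gproj U d *m u0 != 0.
    apply: contrapT => /forallNP Pu; case/eqP: u00.
    by rewrite (gproj_decomp u0) big1 // => i _; apply/eqP/negPn/negP/Pu.
  have [X mX X0] := regular_gmorphism (gproj_comp d u0) ud.
  exists (mdim (gshift regularL d)); apply/asboolP.
  by exists (gshift regularL d), X.
case: (ex_minnP exP) => d /asboolP[M [X [dM mX X0]]] mind.
have gLG := graded_span_tens eL gG; have gkG := graded_span_tens ek gG.
have sM : gsimple M.
  split.
    apply: not_gzero => M0; apply: X0; apply: mulmx_delta_ext => j.
    have /colP/(_ j)/eqP := M0 (delta_mx j 0).
    by rewrite !mxE !eqxx oner_eq0.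
  move=> V gV; have [M' [M'' [Xs [XL [Y [YR [mXs mY S VX]]]]]]] :=
    graded_submodule_exact gV.
  have dims := splitting_dim S; have [XLX YYR E] := S.
  have [XX0|XX0] := pselect (X *m map_mx f Xs = 0).
    left; have le : (d <= mdim M'')%N.
      apply: mind; apply/asboolP; exists M'', (X *m map_mx f YR).
      have XE : X = X *m map_mx f YR *m map_mx f Y.
        rewrite -[LHS]mulmx1 -(map_mx1 f) -E map_mxD !map_mxM mulmxDr !mulmxA.
        by rewrite XX0 mul0mx add0r.
      split=> //; last by move=> XY0; apply: X0; rewrite XE XY0 mul0mx.
      apply: (gmorphism_factor (M := gext fe M) (N := gext fe M'') (YR := map_mx f YR)
        mX (gext_gmorphism fe mY) _ XE).
      by rewrite -map_mxM YYR map_mx1.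
    have M'0 : mdim M' = 0%N by move: le; rewrite -dM; lia.
    apply/seteqP; split=> v /=; last by move=> ->; exact: gV.1.1.1.
    by move=> /VX[w ->]; rewrite [w]gzero_dim // mulmx0.
  right; have le : (d <= mdim M')%N.
    apply: mind; apply/asboolP; exists M', (X *m map_mx f Xs); split=> //.
    exact: (is_gmorphism_comp (M := gext fe M') (gext_gmorphism fe mXs) mX).
  have M''0 : mdim M'' = 0%N by move: le; rewrite -dM; lia.
  apply/seteqP; split=> // v _; apply/VX; exists (XL *m v).
  rewrite mulmxA -[LHS]mul1mx -E mulmxDl -(mulmxA YR).
  by rewrite [Y *m v]gzero_dim // mulmx0 addr0.
exists M => //; have uM := gsimple_usimple gLG sM.
have [|Y [XY YX]] := schur (gext_usimple fe uM _) (gsimple_usimple gkG sU) mX.1 X0.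
  by move=> Z; apply: split.
by exists X, Y; split=> //; apply: is_gmorphism_inv mX _ _.
Qed.

(** Extend the direct sum of the simple modules that give the composition factors. *)
Lemma gclass_residue (V : kHmod) : exists W : LHmod, gclass V = gclass (gext fe W).
Proof.
have [s Vs] := gseries_exists V; rewrite (gclass_gseries Vs).
have := gseries_gsimple Vs; elim: s {V Vs} => [|S s IH] sS.
  exists (zero_gmodule (tens_grading (e := eL) G)); rewrite big_nil; apply/esym.
  have z : gseries (gext fe (zero_gmodule (tens_grading (e := eL) G))) [::].
    by constructor=> v; apply/matrixP => -[].
  by rewrite (gclass_gseries z) big_nil.
have [|W WE] := IH; first by move=> T Ts; apply: sS; rewrite inE Ts orbT.
have [|M _ MS] := @gsimple_residue S; first by apply: sS; rewrite inE eqxx.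
have [D ex] := direct_sum_exists M W; exists D.
by rewrite big_cons WE (gclass_exact (gext_exact fe ex)) (gclass_giso MS).
Qed.

End Residue.

(** * Decomposition maps on graded characters *)

Section ClassRepresentatives.
Variables (F : fieldType) (H : freeAlgebra F) (G : int -> set H).

Lemma gclass_repE (x : R0plus G) : gclass (gclass_rep x) = val x.
Proof. by rewrite /gclass_rep; case: cid2. Qed.

Lemma R0plus_inj (x y : R0plus G) :
  gclass (gclass_rep x) = gclass (gclass_rep y) -> x = y.
Proof. by rewrite !gclass_repE => /val_inj. Qed.

Lemma gclass_rep_plus (M : gmodule G) : gclass (gclass_rep (gclass_plus M)) = gclass M.
Proof. by rewrite gclass_repE. Qed.

End ClassRepresentatives.

Section DecompositionMapTheory.
Variables (A0 A : comNzRingType) (K L : fieldType).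
Variables (H : freeAlgebra A0) (G : int -> set H).
Variables (eA : {rmorphism A0 -> A}) (eK : {rmorphism A0 -> K}).
Variables (eL : {rmorphism A0 -> L}).
Variables (iota : {rmorphism A -> K}) (theta : {rmorphism A -> L}).
Hypothesis iotaE : forall a, iota (eA a) = eK a.
Hypothesis thetaE : forall a, theta (eA a) = eL a.
Hypothesis iota_inj : injective iota.
Hypothesis theta_frac : is_fraction_field theta.
Hypothesis grG : is_algebra_grading G.
Hypothesis A_ic : integrally_closed iota.
Hypothesis split : split_algebra (tens eL H).

Let gG := graded_span_of grG.
Local Notation drel := (decomp_rel (H := H) (G := G) iotaE thetaE).
Local Notation dmap := (decomp_map (H := H) (G := G) iotaE thetaE).

Lemma decomp_rel_exists (x : R0plus (tens_grading (e := eK) G)) :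
  exists y, drel x y.
Proof.
have [O _] := valuation_ring_exists iota_inj theta_frac.
have [V VE] := lattice_exists (vr_inE iotaE O) (@vr_in_inj _ _ _ _ _ O)
  (@vr_valuation _ _ _ _ _ O) gG (gclass_rep x).
have [W WE] := gclass_residue (vr_embLE eL O) grG split (special_fibre thetaE V).
exists (gclass_plus W), O, V, W; split=> //.
by apply: R0plus_inj; rewrite gclass_rep_plus -(gclass_giso VE).
Qed.

Lemma decomp_mapP (x : R0plus (tens_grading (e := eK) G)) : drel x (dmap x).
Proof. by have [y xy] := decomp_rel_exists x; apply: xgetPex; exists y. Qed.

(** Let [V] be a lattice for [x]. The character of [V] over [O] becomes that of [x] in
    [K], so it is the image of a polynomial [p] over [A]; its reduction is the
    character of the image of [x], extended to the residue field. *)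
Lemma decomp_map_gchar (x : R0plus (tens_grading (e := eK) G)) (h : H) i : exists p : {poly A},
  gchar (gclass_rep x) (tens_in eK h) i = map_poly iota p /\
  gchar (gclass_rep (dmap x)) (tens_in eL h) i = map_poly theta p.
Proof.
have [O [V [W [xE yE VW]]]] := decomp_mapP x; rewrite yE.
have [p pE] := gchar_integral iotaE A_ic gG (gclass_rep x) h i.
exists p; split=> //; rewrite (gclass_gchar _ _ (gclass_rep_plus W)).
have := pE; rewrite {1}xE (gclass_gchar _ _ (gclass_rep_plus _)) gchar_gext.
have -> : map_poly iota p = map_poly (vr_in O) (map_poly (vr_base O) p).
  by apply/polyP => k; rewrite !coef_map /= vr_baseE.
move=> /polyP qE; have {}qE : gchar V (tens_in (vr_base O \o eA) h) i =
    map_poly (vr_base O) p.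
  by apply/polyP => k; apply: (@vr_in_inj _ _ _ _ _ O); have := qE k; rewrite !coef_map.
apply: (map_poly_inj (vr_emb O)); rewrite -(gchar_gext (vr_embLE eL O)).
rewrite -(gclass_gchar _ _ VW) gchar_gext qE.
by apply/polyP => k; rewrite !coef_map /= vr_embE.
Qed.

(** Clear denominators. *)
Lemma rational_degree0 (x : tens eL H) : is_fraction_field eL ->
  tens_grading (e := eL) G 0 x ->
  exists2 b, b != 0 & (tens_in eL (H := H) @` G 0) (b *: x).
Proof.
move=> frac [s [Ss ->]]; have [sub _] := gG; have sub0 := sub 0.
suff [a [a0 [h Gh E]]] : exists a, eL a != 0 /\ exists2 h, G 0 h &
    eL a *: (\sum_(p <- s) p.1 *: p.2) = tens_in eL h.
  by exists (eL a); rewrite // E; exists h.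
elim: s Ss => [|p s IH] Ss.
  exists 1; rewrite rmorph1 oner_neq0; split=> //; exists 0; first exact: sub0.1.
  by rewrite big_nil scaler0 tens_in0.
have [|a [a0 [h Gh E]]] := IH; first by move=> q qs; apply: Ss; rewrite inE qs orbT.
have [h' Gh' hE] : (tens_in eL (H := H) @` G 0) p.2 by apply: Ss; rewrite inE eqxx.
have [u [v [v0 pE]]] := frac p.1.
exists (a * v); rewrite rmorphM mulf_neq0 //; split=> //.
exists ((a * u) *: h' + v *: h).
  by apply: sub0.2 => //; apply: (is_submoduleZ sub0).
rewrite big_cons scalerDr tens_inD !tens_inZ rmorphM -E pE -hE !scalerA.
congr (_ *: _ + _ *: _); last exact: mulrC.
by rewrite -mulrA [eL v * _]mulrC divfK // rmorphM.
Qed.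

End DecompositionMapTheory.

(** * Laurent polynomials of multiplicities *)

Section Irreducibles.
Variables (F : fieldType) (H : freeAlgebra F) (G : int -> set H).
Hypothesis gG : graded_span G.
Hypothesis split : split_algebra H.
Variable Delta : set H.
Hypothesis DeltaP : forall x, G 0 x -> exists2 b, b != 0 & Delta (b *: x).
Variables (n : nat) (M : 'I_n -> gmodule G).
Hypothesis irrM : is_graded_irr M.

Let uM j : usimple (M j). Proof. by case: irrM. Qed.

Lemma irr_gsimple j k : gsimple (gshift (M j) k).
Proof. exact/gshift_gsimple/usimple_gsimple. Qed.

Lemma irr_shift S : gsimple S -> exists p : 'I_n * int, giso S (gshift (M p.1) p.2).
Proof.
move=> sS; have [_ _ surj] := irrM; have [j Sj] := surj S (gsimple_usimple gG sS).
have [k Sk] := uiso_giso_shift gG sS (usimple_gsimple (uM j)) Sj.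
by exists (j, k).
Qed.

(** An isomorphism between shifts of one simple module is a scalar, which preserves the
    degrees of the unshifted module. *)
Lemma irr_shift_inj j k j' k' :
  giso (gshift (M j) k) (gshift (M j') k') -> j = j' /\ k = k'.
Proof.
move=> e; have jj' : j = j'.
  have [_ inj _] := irrM; apply: inj.
  by have [X [Y [? ? ? ?]]] := giso_uiso e; exists X, Y.
split=> //; move: e; rewrite -{}jj' => -[X [Y [mX mY XY YX]]].
have [c Xc] := split (uM j) mX.1.
have [[v v0] _] := uM j.
have [d vd] : exists d, gproj (M j) d *m v != 0.
  apply: contrapT => /forallNP Pv; case/eqP: v0.
  by rewrite (gproj_decomp v) big1 // => i _; apply/eqP/negPn/negP/Pv.
pose w := gproj (M j) d *m v; have Mw : gcomp (M j) d w := gproj_comp d v.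
have Sw : gcomp (gshift (M j) k) (d + k) w by rewrite /= /shift_comp addrK.
have := mX.2 _ _ Sw; rewrite /= /shift_comp => Xw.
have := gprojE d Xw; case: eqP => [e _|_].
  by move: e; rewrite -addrA -{1}[d]addr0 => /addrI/esym/eqP; rewrite subr_eq0 => /eqP.
rewrite Xc mul_scalar_mx -scalemxAr /w mulmxA gprojM eqxx => cw.
case/eqP: vd; rewrite -[LHS]mul1mx -YX Xc mul_mx_scalar -scalemxAl scalemxAr cw.
exact: mulmx0.
Qed.

Definition irr_list (t : seq ('I_n * int)) := [seq gshift (M p.1) p.2 | p <- t].

Lemma irr_list_gsimple t S : S \in irr_list t -> gsimple S.
Proof. by move=> /mapP[p _ ->]; apply: irr_gsimple. Qed.

Lemma count_irr_list t j k :
  count (fun N => `[< giso N (gshift (M j) k) >]) (irr_list t) = count_mem (j, k) t.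
Proof.
rewrite count_map; apply: eq_count => -[j' k'] /=; apply/asboolP/eqP => [|[-> ->]].
  by move=> /irr_shift_inj[/= -> ->].
exact: giso_refl.
Qed.

Lemma irr_list_exists (W : gmodule G) : exists t,
  (forall S, gsimple S ->
     gmult W S = count (fun N => `[< giso N S >]) (irr_list t)) /\
  forall h i, gchar W h i = \prod_(p <- t) gchar (M p.1) h (i - p.2).
Proof.
have [s Ws] := gseries_exists W.
suff [t [ct gt]] : exists t,
    (forall S, count (fun N => `[< giso N S >]) s =
       count (fun N => `[< giso N S >]) (irr_list t)) /\
    forall h i, \prod_(N <- s) gchar N h i = \prod_(p <- t) gchar (M p.1) h (i - p.2).
  exists t; split=> [S sS|h i]; last by rewrite (gchar_gseries _ _ Ws).
  by rewrite (gmult_gseries gG split DeltaP Ws sS).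
have := gseries_gsimple Ws; elim: s {Ws} => [|N s IH] sN.
  by exists [::]; split=> [//|h i]; rewrite !big_nil.
have [|t [ct gt]] := IH; first by move=> T Ts; apply: sN; rewrite inE Ts orbT.
have [|p Np] := @irr_shift N; first by apply: sN; rewrite inE eqxx.
exists (p :: t); split=> [S|h i].
  rewrite /= ct; congr (nat_of_bool _ + _)%N; apply/asbool_equiv_eq.
  by split; apply: giso_trans => //; apply: giso_sym.
by rewrite !big_cons gt (gchar_giso _ _ Np) gchar_shift.
Qed.

(** A pair [p] stands for [M p.1] shifted by [p.2]; this counts the shifts of [M c]. *)
Definition laurent_row (t : seq ('I_n * int)) (c : 'I_n) : {fraction {poly int}} :=
  \sum_(p <- t | p.1 == c) laurent_q ^ p.2.

Lemma laurent_rowE (m : int -> nat) t c :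
  (forall k, m k = count_mem (c, k) t) ->
  \sum_(k \in [set: int]) laurent_q ^ k *+ m k = laurent_row t c.
Proof.
move=> mE; rewrite (fsbigE (undup [seq p.2 | p <- t])) ?undup_uniq //; last first.
  move=> k _; rewrite mem_undup => kt; rewrite mE (_ : count_mem _ _ = 0%N) //.
  apply/eqP; rewrite -leqn0 leqNgt -has_count has_pred1; apply: contra kt.
  by move=> ckt; apply/mapP; exists (c, k).
under eq_bigl do rewrite in_setT.
under eq_bigr => k _ do rewrite mE.
rewrite /laurent_row; have : {subset [seq p.2 | p <- t] <= undup [seq p.2 | p <- t]}.
  by move=> k; rewrite mem_undup.
have := undup_uniq [seq p.2 | p <- t]; move: (undup _) => u uu.
elim: t {mE} => [|[b l] t IH] tu; first by rewrite big_nil big1 // => k _; rewrite mulr0n.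
rewrite big_cons -IH; last by move=> k kt; apply: tu; rewrite inE kt orbT.
under eq_bigr do rewrite /= mulrnDr; rewrite big_split /=.
have -> : \sum_(k <- u) laurent_q ^ k *+ ((b, l) == (c, k)) =
    if b == c then laurent_q ^ l else 0.
  rewrite (bigD1_seq l) //=; last by apply: tu; rewrite inE eqxx.
  rewrite big1 => [|k kl]; last by rewrite xpair_eqE [l == k]eq_sym (negbTE kl) andbF.
  by rewrite addr0 xpair_eqE eqxx andbT; case: (b == c).
by case: ifP; rewrite ?add0r.
Qed.

(** The characters of [W] determine its multiplicities, hence the sum over all shifts,
    which has only finitely many nonzero terms. *)
Lemma laurent_row_gmult (W : gmodule G) t c :
  (forall h i, Delta h -> gchar W h i = \prod_(p <- t) gchar (M p.1) h (i - p.2)) ->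
  \sum_(k \in [set: int]) laurent_q ^ k *+ gmult W (gshift (M c) k) = laurent_row t c.
Proof.
move=> Wt; apply: laurent_rowE => k; have [t' [mt' gt']] := irr_list_exists W.
rewrite mt'; last exact: irr_gsimple.
rewrite -count_irr_list; apply: (count_gchar gG DeltaP).
- exact: irr_list_gsimple.
- exact: irr_list_gsimple.
- move=> h i Dh; rewrite !big_map; under eq_bigr do rewrite gchar_shift.
  under [RHS]eq_bigr do rewrite gchar_shift.
  by rewrite -gt' Wt.
- exact: irr_gsimple.
- by move=> X; apply: split; apply: uM.
Qed.

End Irreducibles.

(** * Composition of decomposition maps *)

Theorem proposition2p10
  (A : idomainType) (K : fieldType) (iota : {rmorphism A -> K})
  (iota_inj : injective iota) (K_frac : is_fraction_field iota)
  (A_ic : integrally_closed iota)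
  (H : freeAlgebra A) (G : int -> set H) (H_graded : is_algebra_grading G)
  (L L' : fieldType) (theta : {rmorphism A -> L}) (theta' : {rmorphism A -> L'})
  (L_frac : is_fraction_field theta) (L'_frac : is_fraction_field theta')
  (ker_theta : forall a, theta a = 0 -> theta' a = 0)
  (B : comNzRingType) (j : {rmorphism B -> L}) (j_inj : injective j)
  (alpha : {rmorphism A -> B}) (j_alpha : forall a, j (alpha a) = theta a)
  (B_ic : integrally_closed j)
  (phi : {rmorphism B -> L'}) (phi_alpha : forall a, phi (alpha a) = theta' a)
  (LH_split : split_algebra (tens theta H))
  (L'H_split : split_algebra (tens theta' H)) :
  let d_theta :=
    decomp_map (G := G) (eA := idfun) (eK := iota) (eL := theta)
      (iota := iota) (theta := theta) (fun=> erefl) (fun=> erefl) in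
  let d_theta' :=
    decomp_map (G := G) (eA := idfun) (eK := iota) (eL := theta')
      (iota := iota) (theta := theta') (fun=> erefl) (fun=> erefl) in
  let d_theta_theta' :=
    decomp_map (G := G) (eA := alpha) (eK := theta) (eL := theta')
      (iota := j) (theta := phi) j_alpha phi_alpha in
  d_theta' =1 d_theta_theta' \o d_theta /\
  forall (nK nL nL' : nat)
    (MK : 'I_nK -> gmodule (tens_grading (e := iota) G))
    (ML : 'I_nL -> gmodule (tens_grading (e := theta) G))
    (ML' : 'I_nL' -> gmodule (tens_grading (e := theta') G)),
    is_graded_irr MK -> is_graded_irr ML -> is_graded_irr ML' ->
    decomp_matrix d_theta' MK ML' =
      decomp_matrix d_theta MK ML *m decomp_matrix d_theta_theta' ML ML'.
Proof.
move=> d1 d d2; have gG := graded_span_of H_graded.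
have inj_j : injective (map_poly j).
  by move=> p q; apply: map_inj_poly => //; apply: rmorph0.
have inj_iota : injective (map_poly iota).
  by move=> p q; apply: map_inj_poly => //; apply: rmorph0.
have phi_frac : is_fraction_field phi.
  move=> x; have [a [b [b0 ->]]] := L'_frac x.
  by exists (alpha a), (alpha b); rewrite !phi_alpha.
have gG' := graded_span_tens theta' gG.
have DeltaP x : tens_grading (e := theta') G 0 x ->
    exists2 b, b != 0 & (tens_in theta' (H := H) @` G 0)%classic (b *: x).
  exact: rational_degree0.
have char1 (x : R0plus (tens_grading (e := iota) G)) (h : H) i : exists p : {poly A},
    gchar (gclass_rep x) (tens_in iota h) i = map_poly iota p /\
    gchar (gclass_rep (d1 x)) (tens_in theta h) i = map_poly theta p.
  exact: decomp_map_gchar.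
have char (x : R0plus (tens_grading (e := iota) G)) (h : H) i : exists p : {poly A},
    gchar (gclass_rep x) (tens_in iota h) i = map_poly iota p /\
    gchar (gclass_rep (d x)) (tens_in theta' h) i = map_poly theta' p.
  exact: decomp_map_gchar.
have char2 (y : R0plus (tens_grading (e := theta) G)) (h : H) i : exists p : {poly B},
    gchar (gclass_rep y) (tens_in theta h) i = map_poly j p /\
    gchar (gclass_rep (d2 y)) (tens_in theta' h) i = map_poly phi p.
  exact: decomp_map_gchar.
have comp : d =1 d2 \o d1.
  move=> x; apply: R0plus_inj; apply: (gclass_eq_gchar gG' L'H_split DeltaP).
  move=> _ i [h Gh <-]; have [p [px ->]] := char x h i.
  have [q [qx q1]] := char1 x h i; have [r [r1 ->]] := char2 (d1 x) h i.
  have qp : q = p by apply: inj_iota; rewrite -px -qx.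
  have -> : r = map_poly alpha p.
    apply: inj_j; rewrite -r1 q1 qp.
    by apply/polyP => k; rewrite !coef_map /= j_alpha.
  by apply/polyP => k; rewrite !coef_map /= phi_alpha.
split=> // nK nL nL' MK ML ML' irrK irrL irrL'.
have gGL := graded_span_tens theta gG.
have DeltaPL x : tens_grading (e := theta) G 0 x ->
    exists2 b, b != 0 & (tens_in theta (H := H) @` G 0)%classic (b *: x).
  exact: rational_degree0.
apply/matrixP => i c; rewrite !mxE.
pose Z l := gclass_rep (d2 (gclass_plus (ML l))).
have /choice[t tP] : forall l, exists t : seq ('I_nL' * int), forall h a,
    gchar (Z l) h a = \prod_(p <- t) gchar (ML' p.1) h (a - p.2).
  move=> l; have [t [_ gt]] := irr_list_exists gG' L'H_split DeltaP irrL' (Z l).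
  by exists t.
pose y := d1 (gclass_plus (MK i)).
have [s [_ sP]] := irr_list_exists gGL LH_split DeltaPL irrL (gclass_rep y).
(* Replace each composition factor of d_theta by those of its image. *)
pose u := [seq (r.1, r.2 + p.2) | p <- s, r <- t p.1].
have rowL l : decomp_matrix d1 MK ML i l = laurent_row s l.
  by rewrite mxE; apply: (laurent_row_gmult gGL LH_split DeltaPL irrL) => h a _; apply: sP.
have rowL' l : decomp_matrix d2 ML ML' l c = laurent_row (t l) c.
  by rewrite mxE; apply: (laurent_row_gmult gG' L'H_split DeltaP irrL') => h a _; apply: tP.
under [RHS]eq_bigr => l _ do rewrite rowL rowL'.
transitivity (laurent_row u c).
  apply: (laurent_row_gmult gG' L'H_split DeltaP irrL') => _ a [h Gh <-].
  rewrite comp /= -/y; have [r [r1 ->]] := char2 y h a.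
  have /choice[q qP] : forall p : 'I_nL * int, exists q : {poly B},
      gchar (ML p.1) (tens_in theta h) (a - p.2) = map_poly j q /\
      gchar (Z p.1) (tens_in theta' h) (a - p.2) = map_poly phi q.
    move=> p; have [q [q1 q2]] := char2 (gclass_plus (ML p.1)) h (a - p.2).
    exists q; split; last exact: q2.
    by rewrite -q1; apply: gclass_gchar; rewrite gclass_rep_plus.
  have -> : r = \prod_(p <- s) q p.
    apply: inj_j; rewrite -r1 sP rmorph_prod; apply: eq_bigr => p _.
    by case: (qP p).
  rewrite rmorph_prod big_allpairs_dep; apply: eq_bigr => p _ /=.
  case: (qP p) => _ <-; rewrite tP; apply: eq_bigr => b _ /=.
  by rewrite opprD addrA addrAC.
rewrite /laurent_row big_mkcond big_allpairs_dep /=.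
transitivity (\sum_(p <- s) laurent_q ^ p.2 * laurent_row (t p.1) c).
  apply: eq_bigr => p _; rewrite /laurent_row mulr_sumr [RHS]big_mkcond.
  apply: eq_bigr => r _ /=; case: ifP => // _.
  by rewrite expfzDr ?tofrac_eq0 ?polyX_eq0 // mulrC.
transitivity (\sum_(l < nL) \sum_(p <- s | p.1 == l)
    laurent_q ^ p.2 * laurent_row (t p.1) c).
  rewrite (exchange_big_dep xpredT) //=; apply: eq_bigr => p _.
  by rewrite (big_pred1 p.1) // => l; rewrite /= eq_sym.
apply: eq_bigr => l _; rewrite mulr_suml; apply: eq_bigr => p /eqP ->.
by [].
Qed.
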